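(* For all integers $k\ge 3$ and $1\le \ell<k$ such that $(k-\ell)\nmid k$ and every $0<\Delta<1$, there exists $\gamma>0$ such that the following holds for all sufficiently large $n\in(k-\ell)\mathbb{N}$, where $s=\lceil \frac{k}{k-\ell}\rceil$. Suppose that $\mathcal{H}=(V,E)$ is an $n$-vertex $k$-graph. If $\mathcal{H}$ is not $\Delta$-extremal and satisfies $$\delta_{k-1}(\mathcal{H})\ge \left(\frac{1}{s(k-\ell)}-\gamma\right)n,$$ then $\mathcal{H}$ contains a Hamilton $\ell$-cycle.
   Context: A $k$-graph ($k$-uniform hypergraph) $\mathcal{H}=(V,E)$ has a finite vertex set $V$ and edge set $E\subseteq\binom{V}{k}$. For a $(k-1)$-set $S\subseteq V$, $\deg_{\mathcal{H}}(S)$ is the number of vertices $v\in V\setminus S$ with $S\cup\{v\}\in E$, and the minimum co-degree $\delta_{k-1}(\mathcal{H})$ is the minimum of $\deg_{\mathcal{H}}(S)$ over all $(k-1)$-sets $S\subseteq V$. For $B\subseteq V$, $e(B)$ is the number of edges of $\mathcal{H}$ contained in $B$. For $\Delta>0$ (and given $k,\ell$, $s=\lceil \frac{k}{k-\ell}\rceil$), an $n$-vertex $k$-graph $\mathcal{H}$ is called $\Delta$-extremal if there is a set $B\subseteq V(\mathcal{H})$ such that $|B|=\left\lfloor\left(1-\frac{1}{s(k-\ell)}\right)n\right\rfloor$ and $e(B)\le \Delta n^k$. A $k$-graph is a ($k$-uniform) $\ell$-cycle if there is a cyclic ordering of its vertices such that every edge consists of $k$ consecutive vertices and two consecutive edges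 share exactly $\ell$ vertices. $\mathcal{H}$ contains a Hamilton $\ell$-cycle if it contains an $\ell$-cycle as a spanning subhypergraph. *)

(* Defs.v *)
From mathcomp Require Import all_boot all_order all_algebra.
From mathcomp Require Import reals.

Set Implicit Arguments.
Unset Strict Implicit.
Unset Printing Implicit Defensive.

Import Order.TTheory GRing.Theory Num.Theory.

Local Open Scope ring_scope.

(* A hypergraph on the finite vertex type V is given by its edge set
   E : {set {set V}}. *)
Section Hypergraph.

Variable V : finType.
Implicit Types (E C : {set {set V}}) (S B : {set V}).

Definition uniform (k : nat) E : Prop := forall e, e \in E -> #|e| = k.

Definition codeg E S : nat := #|[set v | v \notin S & v |: S \in E]|.

(* The neutral element #|V| bounds every codegree, so it only matters when
   V has no (k-1)-subset. *)
Definition min_codeg (k : nat) E : nat :=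
  \big[minn/#|V|]_(S : {set V} | #|S| == k.-1) codeg E S.

Definition edges_in E B : nat := #|[set e in E | e \subset B]|.

(* The k consecutive vertices starting at position p of the cyclic ordering
   listed by c. *)
Definition arc_at (k : nat) (c : seq V) (p : nat) : {set V} :=
  [set x in take k (rot p c)].

(* c is the cyclic ordering, and the increasing sequence P lists the positions
   at which the edges start, so that "consecutive edges" are those starting at
   cyclically consecutive entries of P. The condition cover C = setT says
   that the cycle has no isolated vertex; it rules out two edges that
   overlap in l vertices on one side only. *)
Definition is_lcycle (k l : nat) C : Prop :=
  exists (c : seq V) (P : seq nat),
    [/\ perm_eq c (enum V),
        sorted ltn P && all (fun p => p < size c)%N P,
        C = [set:: [seq arc_at k c p | p <- P]],
        cover C = [set: V]
      & path.cycle (fun p q => #|arc_at k c p :&: arc_at k c q| == l) P].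

Definition has_hamilton_lcycle (k l : nat) E : Prop :=
  exists C : {set {set V}}, [/\ C \subset E, uniform k C & is_lcycle k l C].

End Hypergraph.

Definition ceil_ratio (k l : nat) : int :=
  Num.ceil (k%:R / (k - l)%N%:R : rat).

Definition extremal (R : realType) (k l : nat) (Delta : R) (V : finType)
    (E : {set {set V}}) : Prop :=
  let n := #|V| in
  exists B : {set V},
    #|B|%:Z =
      Num.floor ((1 - 1 / ((ceil_ratio k l)%:~R * (k - l)%N%:R)) * n%:R : R)
    /\ (edges_in E B)%:R <= Delta * n%:R ^+ k.

(* Main.v *)
(** Absorption, with counting arguments in place of the regularity method.
    Write k = l + d, s = ceil (k / d) and a = s d. A property of q-tuples is
    dense if a constant proportion of V^q has it; Erdos supersaturation
    (blowing up by power means) turns dense families of k-tuples into dense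
    families of complete k-partite blocks. Inside a block, an l-path is a word
    over the parts, so connections and absorbers become statements on words.

    Any two l-tuples are joined by densely many connectors: a chain of edges,
    consecutive ones sharing at least l vertices, is blown up and traversed,
    the order of the vertices of an edge being permuted by walking around it
    (this uses that d does not divide k). Two words with the same ends using
    the same letters except that one occurrence of a letter is traded for
    another yield gadgets exchanging any vertex x for any vertex y, and chains
    of exchanges absorb any d-tuple. Linearly many disjoint gadgets, with many good for
    every possible request, are selected greedily by an exponential potential.

    Almost all vertices are covered by tiles: complete k-partite pieces with
    one part of size (k-1)t and k-1 parts of size (a-1)t, each nearly spanned by
    one path. If a tiling leaves many vertices uncovered, cut tiles and the
    uncovered set into clusters; the reduced k-graph of dense cluster k-tuples
    either has a nearly balanced fractional tiling by pointed edges, whose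
    realization at a finer scale gains a constant proportion, or LP duality
    gives a set S of k-1 clusters whose neighbourhood has size about p/a and
    outside of which there are almost no edges, making the k-graph extremal. *)

Require Import Defs.
From mathcomp Require Import all_boot all_order all_algebra.
From mathcomp Require Import reals.
From mathcomp Require Import zify ring lra.
From mathcomp Require Import boolp.

Set Implicit Arguments.
Unset Strict Implicit.
Unset Printing Implicit Defensive.

(** * Walks and words *)

(** Write [k = s1 * d + r] with [0 < r < d], so that [a = s1.+1 * d]. A window of [k] letters
    starting at a multiple of [d] contains exactly one position congruent to [d.-1] modulo [s1 * d]
    and exactly one congruent to 0 modulo [a]. So inside one blown-up edge a letter may recur with
    frequency [1 / a] or with frequency [1 / (s1 * d)]. The low frequency is the origin of the
    unbalanced tiles and of the threshold [1 / a]. A word using both frequencies at once, with the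
    two letters interchanged over a common period, trades one occurrence of a letter for one of the
    other: this is the origin of the exchange gadgets. That [d] does not divide [k] matters for
    walks too: otherwise walking around an edge would only permute whole blocks of [d] letters, and
    two neighbours in different blocks would never meet in one block. Densities are recorded by
    their reciprocals, so the argument runs in [nat]; the real hypotheses are translated only in the
    final theorem. *)

Section Walks.
Variables (l d : nat).
Local Notation k := (l + d).

(** An l-path written as a word. Only the windows that start at a multiple of [d] and fit into [c]
    are tested, so a word shorter than [k] qualifies vacuously. *)
Definition epath T (A : pred (seq T)) (c : seq T) : Prop :=
  forall j, j * d + k <= size c -> A (take k (drop (j * d) c)).

(** Since [d] divides [size a], a window starting inside [a] starts at least [d] letters before [b],
    hence ends within the first [l] letters of [b]; every other window lies in [b ++ c]. *)
Lemma epath_cat T (A : pred (seq T)) (a b c : seq T) :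
  0 < d -> d %| size a -> l <= size b ->
  epath A (a ++ b) -> epath A (b ++ c) -> epath A (a ++ b ++ c).
Proof.
move=> dp /dvdnP[q aq] lb Eab Ebc j; rewrite !size_cat => hj.
have [qj|jq] := leqP q j.
  have qd : q * d <= j * d by rewrite leq_mul2r qj orbT.
  have := Ebc (j - q); rewrite [in X in _ -> X]drop_cat aq ltnNge qd /=.
  by rewrite -mulnBl; apply; rewrite size_cat mulnBl; lia.
have jd : j.+1 * d <= q * d by rewrite leq_mul2r jq orbT.
rewrite catA drop_cat size_cat; have := Eab j; rewrite size_cat.
have -> : j * d < size a + size b by rewrite mulSn in jd; lia.
rewrite takel_cat; first by apply; rewrite mulSn in jd; lia.
by rewrite size_drop size_cat; rewrite mulSn in jd; lia.
Qed.

(** For a length congruent to [l] modulo [d], reversal maps aligned windows to aligned windows: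
    window [j] comes from window [m - j.+1]. *)
Lemma epath_rev T (A : pred (seq T)) (c : seq T) m : 0 < d -> size c = l + m * d ->
  (forall w, A w -> A (rev w)) -> epath A c -> epath A (rev c).
Proof.
move=> dp sc Ar E j; rewrite size_rev sc => hj.
have jm : j < m.
  by rewrite -(ltn_pmul2r dp); lia.
have := E (m - j.+1); rewrite sc mulnBl => /(_ _) h.
have hm : j.+1 * d <= m * d by rewrite leq_mul2r jm orbT.
rewrite drop_rev take_rev; rewrite mulSn in hm h.
have {h} := h ltac:(lia) => /Ar.
congr (A (rev _)); rewrite size_take sc.
have -> : (if l + m * d - j * d < l + m * d then l + m * d - j * d else l + m * d) = l + m * d - j * d by case: ifP; lia.
have -> : l + m * d - j * d - (l + d) = m * d - (d + j * d) by lia.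
rewrite take_drop; congr (drop _ (take _ _)); lia.
Qed.

Lemma epath_impl T (A B : pred (seq T)) c :
  (forall w, A w -> B w) -> epath A c -> epath B c.
Proof. by move=> AB E j hj; apply: AB; apply: E. Qed.

(** A walk of [m] shifts by [d] letters from the window [u] to the window [v]; the last equation
    says that the word ends with [v]. *)
Definition conn T (A : pred (seq T)) m (u v : seq T) : Prop :=
  exists w, [/\ size w = m * d, epath A (u ++ w) &
     exists2 w', size w' = m * d & u ++ w = w' ++ v].

Lemma conn_trans T (A : pred (seq T)) m1 m2 u v x : 0 < d -> size v = k ->
  conn A m1 u v -> conn A m2 v x -> conn A (m1 + m2) u x.
Proof.
move=> dp sv [w1 [s1 E1 [w1' s1' e1]]] [w2 [s2 E2 [w2' s2' e2]]].
exists (w1 ++ w2); split; first by rewrite size_cat mulnDl s1 s2.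
  rewrite catA e1 -catA; apply: epath_cat; rewrite ?sv -?e1 ?s1' ?dvdn_mull //.
  exact: leq_addr.
exists (w1' ++ w2'); first by rewrite size_cat mulnDl s1' s2'.
by rewrite catA e1 -!catA e2.
Qed.

Lemma conn_refl T (A : pred (seq T)) u : size u = k -> A u -> conn A 0 u u.
Proof.
move=> su Au; exists [::]; split=> //; last by exists [::]; rewrite ?cats0.
rewrite cats0 => j; rewrite su => hj.
suff -> : j * d = 0 by rewrite drop0 take_oversize ?su.
lia.
Qed.

Lemma conn_step T (A : pred (seq T)) u p : 0 < l -> 0 < d -> size u = k -> size p = d ->
  A u -> A (drop d u ++ p) -> conn A 1 u (drop d u ++ p).
Proof.
move=> lp dp su sp Au Av; exists p; split; rewrite ?mul1n //; last first.
  exists (take d u); first by rewrite size_takel // su leq_addl.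
  by rewrite catA cat_take_drop.
move=> [|[|j]]; rewrite size_cat su sp => hj.
- by rewrite mul0n drop0 take_cat su ltnn subnn take0 cats0.
- rewrite mul1n drop_cat su ifT; last by lia.
  by rewrite take_oversize // size_cat size_drop su sp; lia.
- by rewrite !mulSn in hj; lia.
Qed.

Lemma conn_impl T (A B : pred (seq T)) m u v :
  (forall w, A w -> B w) -> conn A m u v -> conn B m u v.
Proof.
by move=> AB [w [sw E ?]]; exists w; split=> //; apply: epath_impl E.
Qed.

Section Box.
Variables (T : eqType) (K : seq T).
Hypotheses (sK : size K = k) (hl : 0 < l) (hd : 2 <= d) (hkd : ~~ (d %| k)).
Local Notation A := (perm_eq K).

Lemma perm_size_box u : A u -> size u = k.
Proof. by move=> /perm_size <-. Qed.

(** Each step appends the [d] letters that are just being left: this is the walk around a single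
    edge. *)
Lemma conn_rot m u : A u -> conn A m u (iter m (rot d) u).
Proof.
elim: m => [|m IH] Au; first by apply: conn_refl => //; apply: perm_size_box.
have Am : A (iter m (rot d) u).
  elim: m {IH} => //= m IHm; rewrite (perm_trans IHm) // perm_sym; exact/permPl/perm_rot.
rewrite -addn1 addn1 /= -addn1; apply: conn_trans (ltnW hd) (perm_size_box Am) (IH Au) _.
apply: conn_step => //; rewrite ?(perm_size_box Am) //; first by lia.
  by rewrite size_takel // (perm_size_box Am) leq_addl.
by rewrite (perm_trans Am) // perm_sym; apply/permPl/perm_rot.
Qed.

Lemma iter_rot m (u : seq T) : d <= size u ->
  iter m (rot d) u = rot ((m * d) %% size u) u.
Proof.
move=> du; elim: m => [|m IH] /=; first by rewrite mul0n mod0n rot0.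
have u0 : 0 < size u by lia.
rewrite IH rot_add_mod // ?(ltnW (ltn_pmod _ _)) // mulSn.
have := ltn_pmod (m * d) u0; set x := (m * d) %% size u => xs.
have -> : (d + m * d) %% size u = (d + x) %% size u by rewrite /x modnDmr.
case: leqP => h.
  move: h; rewrite leq_eqVlt => /orP[/eqP h|h]; last by rewrite modn_small.
  by rewrite h modnn rot0 rot_size.
rewrite -(subnK (ltnW h)) modnDr modn_small; last by lia.
congr (rot _ u); lia.
Qed.

Lemma iter_rot_k (u : seq T) : size u = k -> iter k (rot d) u = u.
Proof. by move=> su; rewrite iter_rot su ?leq_addl // modnMr rot0. Qed.

Lemma iter_rot_cat m (u v : seq T) : size u = m * d ->
  iter m (rot d) (u ++ v) = v ++ u.
Proof.
elim: m u v => [|m IH] u v; first by move/size0nil ->; rewrite cats0.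
rewrite mulSn => su; rewrite -(cat_take_drop d u) -catA iterSr.
have st : size (take d u) = d by rewrite size_takel // su leq_addr.
rewrite [X in rot X _](_ : d = size (take d u)) // rot_size_cat -catA IH ?catA //.
by rewrite size_drop su; lia.
Qed.

(* A pair of neighbours that straddles a block boundary is moved inside a block
   by s = k %/ d + 1 further rotations, because d does not divide k. *)
Lemma rot_to_block (A0 B : seq T) : size A0 + (size B).+2 = k ->
  exists m C1 C2, [/\ m < k, size C1 + 2 <= d &
    forall x y, iter m (rot d) (A0 ++ x :: y :: B) = C1 ++ x :: y :: C2].
Proof.
move=> sAB; pose q := size A0 %/ d; pose b := size A0 %% d.
have sA : size A0 = q * d + b by exact: divn_eq.
have bd : b < d by rewrite ltn_mod; lia.
have qk : q * 2 + 2 <= k.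
  have : q * 2 <= q * d by rewrite leq_mul2l hd orbT.
  lia.
have sA1 : size (take (q * d) A0) = q * d by rewrite size_takel // sA leq_addr.
have sA2 : size (drop (q * d) A0) = b by rewrite size_drop sA addKn.
rewrite -(cat_take_drop (q * d) A0).
set A1 := take _ _ in sA1 *; set A2 := drop _ _ in sA2 *.
have [b1|b1] := ltnP b.+1 d.
  exists q, A2, (B ++ A1); split; rewrite ?sA2; try lia.
  by move=> x y; rewrite -catA iter_rot_cat // -!catA.
have bE : b = d.-1 by lia.
set C := B ++ A1.
pose s1 := k %/ d; pose r := k %% d.
have kE : k = s1 * d + r by exact: divn_eq.
have r0 : 0 < r by rewrite lt0n; apply: contra hkd; rewrite /dvdn.
have rd : r < d by rewrite ltn_mod; lia.
have qs : q + 1 <= s1.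
  rewrite leqNgt; apply/negP => h.
  have : s1 * d <= q * d by rewrite leq_mul2r; lia.
  lia.
have sC : size C + d.+1 = k by rewrite size_cat sA1; lia.
have s1k : q + 1 + s1 < k.
  have : s1 * 2 <= s1 * d by rewrite leq_mul2l hd orbT.
  lia.
(* after q rotations: A2 ++ x :: y :: C with size A2 = d - 1 *)
pose F := drop r.-1 (take d.-1 A2).
exists (q + 1 + s1), (drop (d - r) A2), (C ++ take (d - r) A2); split=> //.
  by rewrite size_drop sA2 bE; lia.
move=> x y; rewrite -addnA addnC iterD -catA iter_rot_cat // -!catA -/C addnC iterD /=.
have -> : rot d (A2 ++ x :: y :: C) = y :: C ++ A2 ++ [:: x].
  have -> : A2 ++ x :: y :: C = (A2 ++ [:: x]) ++ y :: C by rewrite -catA.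
  rewrite [X in rot X _](_ : d = size (A2 ++ [:: x])); last by rewrite size_cat sA2 bE /=; lia.
  by rewrite rot_size_cat.
have -> : y :: C ++ A2 ++ [:: x] = (y :: C ++ take (d - r) A2) ++ (drop (d - r) A2 ++ [:: x]).
  by rewrite /= -catA; congr (_ :: _ ++ _); rewrite catA cat_take_drop.
rewrite iter_rot_cat.
  by rewrite /C -!catA.
by rewrite /= (size_cat C) size_takel ?sA2; lia.
Qed.

(** The letters of the block that is left may be appended in any order. Rotate until the pair lies
    in this block, append the block with the pair exchanged, and complete the turn to [k] rotations,
    which compose to the identity. *)
Lemma conn_swap (A0 B : seq T) x y : A (A0 ++ x :: y :: B) ->
  conn A k (A0 ++ x :: y :: B) (A0 ++ y :: x :: B).
Proof.
set u := A0 ++ _; set v := A0 ++ y :: _ => Au.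
have su := perm_size_box Au.
have Av : A v.
  rewrite (perm_trans Au) // /u /v perm_cat2l.
  exact/permPl/(perm_catCA [:: x] [:: y] B).
have sv := perm_size_box Av.
have [m [C1 [C2 [mk sC1 E]]]] : exists m C1 C2, [/\ m < k, size C1 + 2 <= d &
    forall x y, iter m (rot d) (A0 ++ x :: y :: B) = C1 ++ x :: y :: C2].
  by apply: rot_to_block; rewrite -su /u size_cat /=.
have c1 := conn_rot m Au; rewrite {2}/u E in c1.
have aperm n w : A w -> A (iter n (rot d) w).
  by elim: n => //= n IH /IH h; rewrite (perm_trans h) // perm_sym; apply/permPl/perm_rot.
have A1 : A (C1 ++ x :: y :: C2) by rewrite -E; exact: aperm.
have A2 : A (C1 ++ y :: x :: C2) by rewrite -E; exact: aperm.
have s1 := perm_size_box A1; have s2 := perm_size_box A2.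
(* The two arrangements differ only within their first [d] letters, so a step from the first may
   continue as a step from the second. *)
have eqd : drop d (C1 ++ x :: y :: C2) = drop d (C1 ++ y :: x :: C2).
  have dE : d = d - size C1 - 2 + 2 + size C1 by lia.
  rewrite dE -!drop_drop !drop_size_cat // !addn2 //.
have c2 : conn A 1 (C1 ++ x :: y :: C2) (rot d (C1 ++ y :: x :: C2)).
  rewrite /rot -eqd; apply: conn_step => //; first by lia.
    by rewrite size_takel // s2 leq_addl.
  by rewrite eqd (perm_trans A2) // perm_sym; apply/permPl/perm_rot.
have c3 := conn_rot (k - m.+1) (aperm 1 _ A2).
have {}c3 : conn A (k - m.+1) (rot d (C1 ++ y :: x :: C2)) v.
  move: c3; rewrite /= -E -iterS -iterD.
  by rewrite subnK // iter_rot_k.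
have -> : k = m + (1 + (k - m.+1)) by lia.
apply: (conn_trans (ltnW hd) s1 c1); apply: (conn_trans (ltnW hd) _ c2 c3).
by rewrite size_rot.
Qed.

Lemma conn_idle m u : A u -> conn A (m * k) u u.
Proof.
move=> Au; have := conn_rot (m * k) Au.
suff -> : iter (m * k) (rot d) u = u by [].
elim: m => //= m IH; rewrite mulSn addnC iterD iter_rot_k //.
exact: perm_size_box.
Qed.

(** Sorting by swaps of neighbours, each of which costs a multiple of [k] steps. Idling around the
    edge then provides every larger multiple, so that lengths of different walks can be matched. *)
Lemma box_conn u v : A u -> A v ->
  exists M, forall M', M <= M' -> conn A (M' * k) u v.
Proof.
move=> Au Av; suff [M hM] : exists M, conn A (M * k) u v.
  exists M => M' MM; rewrite -(subnKC MM) mulnDl.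
  exact: conn_trans (ltnW hd) (perm_size_box Av) hM (conn_idle _ Av).
have uv : perm_eq u v by rewrite perm_sym (perm_trans _ Au) // perm_sym.
rewrite -[u]cat0s -[v]cat0s; rewrite -[u]cat0s in Au.
elim: u [::] v Au uv {Av} => [|x u IH] pre v Au.
  by rewrite perm_sym => /perm_nilP->; exists 0; rewrite mul0n; apply: conn_refl => //; apply: perm_size_box.
move=> uv; have xv : x \in v by rewrite -(perm_mem uv) mem_head.
case/splitPr: xv uv => v1 v2 uv.
have uv' : perm_eq u (v1 ++ v2).
  by rewrite -(perm_cons x) (perm_trans uv) // (perm_catCA v1 [:: x] v2).
have Au' : A ((pre ++ [:: x]) ++ u) by rewrite -catA.
have [M hM] := IH _ _ Au' uv'.
have sz : size ((pre ++ [:: x]) ++ v1 ++ v2) = k.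
  by rewrite -(perm_size_box Au') !size_cat (perm_size uv') !size_cat.
suff [M' hM'] : exists M', conn A (M' * k) (pre ++ x :: v1 ++ v2) (pre ++ v1 ++ x :: v2).
  exists (M + M'); rewrite mulnDl; apply: (conn_trans (ltnW hd) _ _ hM') => //.
    by rewrite -sz -!catA.
  by move: hM; rewrite -!catA.
have : A (pre ++ x :: v1 ++ v2).
  rewrite (perm_trans Au) // perm_cat2l //; by rewrite perm_cons.
elim: v1 pre {IH uv uv' Au Au' hM sz} => [|y v1 IH] pre Ap.
  by exists 0; rewrite mul0n; apply: conn_refl => //; apply: perm_size_box.
have Ap' : A ((pre ++ [:: y]) ++ x :: v1 ++ v2).
  rewrite (perm_trans Ap) // -catA perm_cat2l /=.
  exact/permPl/(perm_catCA [:: x] [:: y] (v1 ++ v2)).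
have [M' hM'] := IH _ Ap'; exists (1 + M'); rewrite mulnDl mul1n.
have sz := perm_size_box Ap'.
rewrite -catA /= in sz; move: hM'; rewrite -!catA /= => hM'.
by apply: (conn_trans (ltnW hd) _ _ hM') => //; apply: conn_swap.
Qed.

End Box.

(** Permute the letters of [K] so that the common letters [L] come last; one step then replaces [K1]
    by [K2]. *)
Lemma conn_cross (T : eqType) (B : pred (seq T)) K K' K1 L K2 u v :
  size K = k -> size K' = k -> 0 < l -> 2 <= d -> ~~ (d %| k) ->
  (forall w, perm_eq K w -> B w) -> (forall w, perm_eq K' w -> B w) ->
  size L = l -> perm_eq K (K1 ++ L) -> perm_eq K' (L ++ K2) ->
  perm_eq K u -> perm_eq K' v -> exists m, conn B m u v.
Proof.
move=> sK sK' hl hd hk BK BK' sL p1 p2 pu pv.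
have [M1 h1] := box_conn sK hl hd hk pu p1.
have [M2 h2] := box_conn sK' hl hd hk p2 pv.
exists (M1 * k + (1 + M2 * k)).
apply: (conn_trans (ltnW hd) _ (conn_impl BK (h1 _ (leqnn _)))).
  by rewrite -(perm_size p1).
apply: (conn_trans (ltnW hd) _ _ (conn_impl BK' (h2 _ (leqnn _)))).
  by rewrite -(perm_size p2).
have s1 : size K1 = d by move: (perm_size p1); rewrite size_cat; lia.
have s2 : size K2 = d by move: (perm_size p2); rewrite size_cat; lia.
have := @conn_step _ B (K1 ++ L) K2 hl ltac:(lia) _ s2 (BK _ p1).
by rewrite drop_size_cat //; apply; [rewrite size_cat; lia | apply: BK'].
Qed.

End Walks.

(** * Residues and ranks in windows of consecutive positions *)

Section CountWindow.

Lemma count_modn_iota G o B m : o < G ->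
  count (fun x => x %% G == o) (iota B (G * m)) = m.
Proof.
move=> oG; suff base : count (fun x => x %% G == o) (iota B G) = 1.
  elim: m B base => [|m IH] B base; first by rewrite muln0.
  rewrite mulnS iotaD count_cat base IH // -[RHS]base.
  have -> : iota (B + G) G = map (addn G) (iota B G) by rewrite -iotaDl addnC.
  by rewrite count_map; apply: eq_count => x /=; rewrite modnDl.
elim: B => [|B IH].
  rewrite (eq_in_count (a2 := pred1 o)).
    by rewrite count_uniq_mem ?iota_uniq // mem_iota oG.
  by move=> x; rewrite mem_iota add0n /= => xG; rewrite modn_small.
have G0 : 0 < G by lia.
case: G G0 oG IH => // G' _ oG IH.
have -> : iota B.+1 G'.+1 = iota B.+1 G' ++ [:: B + G'.+1].
  by rewrite -(addn1 G') iotaD addn1 /= addSnnS.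
by rewrite -IH count_cat /= addn0 modnDr addnC.
Qed.

Lemma count1_inj (T : eqType) (p : pred T) s x y :
  count p s = 1 -> x \in s -> y \in s -> p x -> p y -> x = y.
Proof.
rewrite -size_filter => h xs ys px py.
have : x \in filter p s by rewrite mem_filter px.
have : y \in filter p s by rewrite mem_filter py.
by case: (filter p s) h => [|z [|]] // _; rewrite !inE => /eqP -> /eqP ->.
Qed.

(** Numbers the positions with property [ns]. Taken modulo the number of such positions in a window,
    the rank serves as a letter that does not repeat inside the window. *)
Definition rank (ns : pred nat) x := count ns (iota 0 x).

Lemma rank_lt (ns : pred nat) x y : x < y -> ns x -> rank ns x < rank ns y.
Proof.
move=> xy nx; rewrite /rank -(subnKC xy) iotaD count_cat -[x.+1]addn1 iotaD count_cat /=.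
by rewrite add0n nx; lia.
Qed.

Lemma rank_window (ns : pred nat) b n c x y : count ns (iota b n) = c ->
  b <= x -> x < y -> y < b + n -> ns x -> ns y ->
  rank ns x < rank ns y < rank ns x + c.
Proof.
move=> <- bx xy yb nx ny; rewrite rank_lt //=.
rewrite /rank -(subnKC (ltnW xy)) iotaD count_cat ltn_add2l add0n.
have -> : n = (x - b) + ((y - x) + (1 + (b + n - y.+1))) by lia.
rewrite !iotaD !count_cat /= -!addnA.
have -> : b + (x - b + (y - x)) = y by lia.
by rewrite ny subnKC //; lia.
Qed.

Lemma modn_window_neq u v c : u < v -> v < u + c -> u %% c != v %% c.
Proof.
move=> uv vc; apply/negP => /eqP h.
have : c %| v - u by rewrite -eqn_mod_dvd ?(ltnW uv) // h.
by move=> /dvdn_leq; lia.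
Qed.

Lemma rank_inj (ns : pred nat) x y : ns x -> ns y -> rank ns x = rank ns y -> x = y.
Proof. by move=> nx ny h; case: (ltngtP x y) => // /rank_lt; [move=> /(_ _ nx) | move=> /(_ _ ny)]; rewrite h ltnn. Qed.

End CountWindow.

(** * Periodic words with letters of unequal frequency on one edge *)

Section Words.
Variables (l d s1 r : nat).
Hypotheses (hl : 0 < l) (hd : 2 <= d) (s1_gt0 : 0 < s1).
Hypotheses (kE : l + d = s1 * d + r) (r0 : 0 < r < d).
Local Notation k := (l + d).
Local Notation G := (s1 * d).
Local Notation a := (s1.+1 * d).

Lemma kltna : k < a.
Proof. by rewrite kE mulSn; lia. Qed.

(** The first [G] positions contain the residue once. The other [r] positions start at a multiple of
    [d], so their residues modulo [d] stay below [r] and miss [d.-1]. *)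
Lemma count_win0 w : count (fun x => x %% G == d.-1) (iota (w * d) k) = 1.
Proof.
rewrite kE iotaD count_cat -{2}[G]muln1.
have G0 : d.-1 < G.
  have := s1_gt0; move=> h; have : 1 * d <= G by rewrite leq_mul2r h orbT.
  lia.
rewrite count_modn_iota // addnC; suff -> : count (fun x => x %% G == d.-1) (iota (w * d + G) r) = 0 by [].
apply/eqP; rewrite -leqn0 leqNgt -has_count; apply/hasPn => x.
rewrite mem_iota => xr; apply/negP => /eqP h.
have h2 : x %% d = d.-1.
  by rewrite -(modn_dvdm x (dvdn_mull s1 (dvdnn d))) h modn_small; lia.
have := modnMDl (w + s1) (x - (w * d + G)) d.
rewrite mulnDl subnKC; last by lia.
rewrite h2 modn_small; lia.
Qed.

(** A window of length [a] contains the residue once; what it has beyond the first [k] positions are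
    residues from [r] to [d.-1] modulo [d], and none of them is 0. *)
Lemma count_win1 w : count (fun x => x %% a == 0) (iota (w * d) k) = 1.
Proof.
have ka := kltna.
have := @count_modn_iota a 0 (w * d) 1 ltac:(lia); rewrite muln1.
have -> : iota (w * d) a = iota (w * d) k ++ iota (w * d + k) (a - k).
  by rewrite -iotaD subnKC // ltnW.
rewrite count_cat => <-; rewrite -[LHS]addn0; congr (_ + _); symmetry.
apply/eqP; rewrite -leqn0 leqNgt -has_count; apply/hasPn => x.
rewrite mem_iota => xr; apply/negP => /eqP h.
have h2 : x %% d = 0.
  by rewrite -(modn_dvdm x (dvdn_mull s1.+1 (dvdnn d))) h mod0n.
have := modnMDl (w + s1) (x - (w * d + G)) d.
rewrite mulnDl subnKC; last by lia.
rewrite mulSn in xr ka.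
rewrite h2 modn_small; lia.
Qed.

Local Notation A := (perm_eq (iota 0 k)).

Lemma epath_map_iota (c : nat -> nat) N :
  (forall w, A (map c (iota (w * d) k))) -> epath l d A (map c (iota 0 N)).
Proof.
move=> h j; rewrite size_map size_iota => jN.
by rewrite -map_drop drop_iota -map_take take_iota (minn_idPl _) ?add0n //; lia.
Qed.

Lemma perm_window (c : nat -> nat) b : (forall x, c x < k) ->
  (forall x y : nat, x \in iota b k -> y \in iota b k -> x < y -> c x <> c y) ->
  A (map c (iota b k)).
Proof.
move=> ck cinj; rewrite perm_sym.
have U : uniq (map c (iota b k)).
  rewrite map_inj_in_uniq ?iota_uniq // => x y xb yb e.
  by case: (ltngtP x y) => // h; [case: (cinj _ _ xb yb h) | case: (cinj _ _ yb xb h)].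
apply: uniq_perm => //; first exact: iota_uniq.
have sub : {subset map c (iota b k) <= iota 0 k}.
  by move=> _ /mapP[x _ ->]; rewrite mem_iota ck.
by apply: (uniq_min_size U sub _).2; rewrite size_map !size_iota.
Qed.

Definition tile_ns x := ~~ (a %| x).
(** The word traced in a tile: letter 0 at the multiples of [a], the other letters in cyclic order
    at the remaining positions. The second component counts the earlier occurrences of the letter,
    so it names a fresh vertex of the part. *)
Definition tile_pos x : nat * nat :=
  if a %| x then (0, x %/ a)
  else ((rank tile_ns x %% k.-1).+1, rank tile_ns x %/ k.-1).

Lemma tile_pos_inj : injective tile_pos.
Proof.
have k1 : 0 < k.-1 by lia.
move=> x y; rewrite /tile_pos; case: ifPn => hx; case: ifPn => hy // [].
  by move=> h; rewrite -(divnK hx) -(divnK hy) h.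
move=> h1 h2; apply: (@rank_inj tile_ns) => //.
by rewrite (divn_eq (rank _ x) k.-1) h1 h2 -divn_eq.
Qed.

Lemma tile_pos_lt x : (tile_pos x).1 < k.
Proof.
rewrite /tile_pos; case: ifP => _ /=; first by lia.
have : rank tile_ns x %% k.-1 < k.-1 by rewrite ltn_mod; lia.
lia.
Qed.

(** Among the first [a * k.-1 * M] positions, [k.-1 * M] are multiples of [a], and the other [k.-1]
    letters share the rest evenly. This is where the part sizes of a tile come from. *)
Lemma tile_pos_copy M x : x < a * k.-1 * M ->
  (tile_pos x).2 < if (tile_pos x).1 == 0 then k.-1 * M else a.-1 * M.
Proof.
have a0 : 0 < a by have := kltna; lia.
have k1 : 0 < k.-1 by lia.
move=> xM; rewrite /tile_pos; case: ifPn => hx /=.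
  by rewrite ltn_divLR // mulnC mulnA.
rewrite ltn_divLR //.
have h : rank tile_ns (a * (k.-1 * M)) = a * (k.-1 * M) - k.-1 * M.
  rewrite /rank -[in LHS](eq_count (a1 := predC (fun x => x %% a == 0))) //.
  have := count_predC (fun x => x %% a == 0) (iota 0 (a * (k.-1 * M))).
  by rewrite count_modn_iota // size_iota => e; apply/eqP; rewrite -(eqn_add2l (k.-1 * M)) e subnKC // leq_pmull.
rewrite -mulnA in xM.
have := @rank_lt tile_ns _ _ xM hx; rewrite h -{2}[k.-1 * M]mul1n -mulnBl subn1.
by rewrite mulnA mulnAC.
Qed.

Lemma tile_window w : A (map (fun x => (tile_pos x).1) (iota (w * d) k)).
Proof.
apply: perm_window => [x|x y xw yw xy]; first exact: tile_pos_lt.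
have c1 := count_win1 w.
rewrite /tile_pos; case: ifPn => hx; case: ifPn => hy //= h.
  by have e := count1_inj c1 xw yw hx hy; rewrite e ltnn in xy.
have cn : count tile_ns (iota (w * d) k) = k.-1.
  have := count_predC (fun x => x %% a == 0) (iota (w * d) k).
  rewrite c1 size_iota (eq_count (a1 := predC _) (a2 := tile_ns)) // => e.
  by rewrite -{2}e.
rewrite !mem_iota in xw yw.
have [/andP[bx _] /andP[_ yb]] := (xw, yw).
have /andP[r1 r2] := rank_window cn bx xy yb hx hy.
case: h => h; by have := modn_window_neq r1 r2; rewrite h eqxx.
Qed.

Definition p0 x := x %% G == d.-1.
Definition p1 x := x %% a == 0.
Definition ns x := ~~ p0 x && ~~ p1 x.
(** Letter 0 has period [G] and letter 1 the longer period [a], yet each occurs exactly once in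
    every aligned window; the other letters fill the remaining [k - 2] places cyclically. *)
Definition c x := if p0 x then 0 else if p1 x then 1 else 2 + rank ns x %% (k - 2).
Definition sw x := if x == 0 then 1 else if x == 1 then 0 else x.
(** A multiple of both periods: an interval of length [L] contains [s1.+1] letters 0 and [s1]
    letters 1, so interchanging these letters there changes each count by one. *)
Definition L := s1 * a.
Definition c' x := if L + d <= x < L + L + d then sw (c x) else c x.

Lemma k3 : 3 <= k. Proof. by lia. Qed.

Lemma p01 x : p0 x -> p1 x -> False.
Proof.
rewrite /p0 /p1 => /eqP h0 /eqP h1.
have : x %% d = d.-1.
  rewrite -(modn_dvdm x (dvdn_mull s1 (dvdnn d))) h0 modn_small; lia.
rewrite -(modn_dvdm x (dvdn_mull s1.+1 (dvdnn d))) h1 mod0n; lia.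
Qed.

Lemma c_lt x : c x < k.
Proof.
rewrite /c; case: ifP => _; first by lia.
case: ifP => _; first by lia.
have : rank ns x %% (k - 2) < k - 2 by rewrite ltn_mod; lia.
lia.
Qed.

Lemma count_ns w : count ns (iota (w * d) k) = k - 2.
Proof.
have h1 := count_win0 w; have h2 := count_win1 w.
have := count_predUI p0 p1 (iota (w * d) k); rewrite h1 h2.
have -> : count (predI p0 p1) (iota (w * d) k) = 0.
  apply/eqP; rewrite -leqn0 leqNgt -has_count; apply/hasPn => x _ /=.
  by apply/negP => /andP[/p01].
have := count_predC (predU p0 p1) (iota (w * d) k); rewrite size_iota.
rewrite (eq_count (a1 := predC _) (a2 := ns)); last by move=> x; rewrite /ns /= negb_or.
lia.
Qed.

Lemma c_inj w (x y : nat) : x \in iota (w * d) k -> y \in iota (w * d) k -> x < y -> c x <> c y.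
Proof.
move=> xw yw xy; have h0 := count_win0 w; have h1 := count_win1 w.
rewrite /c; case: (boolP (p0 x)) => x0; case: (boolP (p0 y)) => y0.
- by have e := count1_inj h0 xw yw x0 y0; rewrite e ltnn in xy.
- by case: ifP.
- by case: ifP.
case: (boolP (p1 x)) => x1; case: (boolP (p1 y)) => y1 // e.
  by have e' := count1_inj h1 xw yw x1 y1; rewrite e' ltnn in xy.
have nx : ns x by rewrite /ns x0.
have ny : ns y by rewrite /ns y0.
rewrite !mem_iota in xw yw.
have [/andP[bx _] /andP[_ yb]] := (xw, yw).
have /andP[r1 r2] := rank_window (count_ns w) bx xy yb nx ny.
by have := modn_window_neq r1 r2; move: e => /addnI ->; rewrite eqxx.
Qed.

Lemma c0 x : (c x == 0) = p0 x.
Proof. by rewrite /c; case: ifP => // _; case: ifP. Qed.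

Lemma c1 x : (c x == 1) = p1 x.
Proof.
rewrite /c; case: ifP => [h|_]; last by case: ifP.
by apply/esym/negP => /p01; apply.
Qed.

(* A window meeting both sides of an aligned boundary [b + d] with [G %| b] and
   [a %| b] contains the block starting at [b], hence its letters 0 and 1 both
   lie before the boundary. *)
Lemma boundary m w (x y : nat) : x \in iota (w * d) k -> y \in iota (w * d) k ->
  p0 x -> p1 y -> (x < m * L + d) = (y < m * L + d).
Proof.
move=> xw yw px py; apply/idP/idP => h.
- rewrite ltnNge; apply/negP => h'.
  have wm : w <= m * (s1 * s1.+1).
    rewrite leqNgt; apply/negP => hh.
    have : (m * (s1 * s1.+1)).+1 * d <= w * d by rewrite leq_mul2r hh orbT.
    have -> : (m * (s1 * s1.+1)).+1 * d = m * L + d by rewrite /L mulSn !mulnA addnC.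
    by rewrite mem_iota in xw; clear -h xw; lia.
  have : w * d <= m * L by rewrite /L !mulnA leq_mul2r -mulnA wm orbT.
  move=> wb; have yb : m * L \in iota (w * d) k by move: yw; rewrite !mem_iota; lia.
  have pb : p1 (m * L) by rewrite /p1 /L mulnA modnMl.
  have := count1_inj (count_win1 w) yw yb py pb; lia.
- rewrite ltnNge; apply/negP => h'.
  have wm : w <= m * (s1 * s1.+1).
    rewrite leqNgt; apply/negP => hh.
    have : (m * (s1 * s1.+1)).+1 * d <= w * d by rewrite leq_mul2r hh orbT.
    have -> : (m * (s1 * s1.+1)).+1 * d = m * L + d by rewrite /L mulSn !mulnA addnC.
    by rewrite mem_iota in yw; clear -h yw; lia.
  have : w * d <= m * L by rewrite /L !mulnA leq_mul2r -mulnA wm orbT.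
  move=> wb; have xb : m * L + d.-1 \in iota (w * d) k by move: xw; rewrite !mem_iota; lia.
  have Gd : d <= G by rewrite leq_pmull // s1_gt0.
  have pb : p0 (m * L + d.-1).
    have -> : m * L = m * s1.+1 * G by rewrite /L; nia.
    by rewrite /p0 modnMDl modn_small //; clear -hd Gd; lia.
  have := count1_inj (count_win0 w) xw xb px pb; lia.
Qed.

(** A repetition could only arise in a window with one of its letters 0 and 1 inside the
    interchanged interval and the other outside; [boundary], used at both ends of the interval,
    excludes this. *)
Lemma c'_inj w (x y : nat) : x \in iota (w * d) k -> y \in iota (w * d) k -> x < y -> c' x <> c' y.
Proof.
move=> xw yw xy; have h := c_inj xw yw xy.
have swK : involutive sw by case=> [|[|n]].
have key u v : u \in iota (w * d) k -> v \in iota (w * d) k -> c u = 0 -> c v = 1 ->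
    (L + d <= u < L + L + d) = (L + d <= v < L + L + d).
  move=> uw vw /eqP u0 /eqP v1; rewrite c0 in u0; rewrite c1 in v1.
  have := boundary 1 uw vw u0 v1; have := boundary 2 uw vw u0 v1.
  rewrite mul1n mul2n -addnn !(leqNgt (L + d)) => -> -> //.
have sw2 u : 1 < c u -> sw (c u) = c u by case: (c u) => [|[|]].
have sw_inj u v : sw (c u) = sw (c v) -> c u = c v by move/(can_inj swK).
rewrite /c'; case: ifP => xi; case: ifP => yi; do ?[by []]; first by move/sw_inj.
  case E : (c x) => [|[|n]]; rewrite /sw /=; move=> e; last by apply: h; rewrite E.
    by have := key _ _ xw yw E (esym e); rewrite xi yi.
  by have := key _ _ yw xw (esym e) E; rewrite xi yi.
case E : (c y) => [|[|n]]; rewrite /sw /=; move=> e; last by apply: h; rewrite E.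
  by have := key _ _ yw xw E e; rewrite xi yi.
by have := key _ _ xw yw e E; rewrite xi yi.
Qed.

(** The middle words are the plain and the interchanged version of one interval of length [L]. It
    starts at [L + d], one block after a common multiple of the periods, because that is where a
    change is safe. *)
Lemma exch_word : exists u m1 m2 v : seq nat,
  [/\ d %| size u, l <= size u, size v = k /\ d %| size m1,
      epath l d A (u ++ m1 ++ v) /\ epath l d A (u ++ m2 ++ v)
    & perm_eq (1 :: m1) (0 :: m2)].
Proof.
exists (map c (iota 0 (L + d))), (map c (iota (L + d) L)),
  (map sw (map c (iota (L + d) L))), (map c (iota (L + L + d) k)).
have Ld : d %| L by rewrite /L mulnA dvdn_mull.
have La : a <= L by rewrite leq_pmull // s1_gt0.
have iE : iota 0 (L + d + (L + k)) = iota 0 (L + d) ++ iota (L + d) L ++ iota (L + L + d) k.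
  by rewrite (iotaD 0 (L + d)) (iotaD _ L k) add0n addnAC.
split; rewrite ?size_map ?size_iota //.
- by rewrite dvdn_add.
- by have := kltna; lia.
- split.
    rewrite -!map_cat -iE; apply: epath_map_iota => w.
    by apply: perm_window => [x|x y xw yw]; [apply: c_lt | apply: c_inj xw yw].
  have -> : map c (iota 0 (L + d)) ++ map sw (map c (iota (L + d) L)) ++ map c (iota (L + L + d) k)
     = map c' (iota 0 (L + d + (L + k))).
    rewrite iE !map_cat -map_comp; congr (_ ++ _ ++ _); apply/eq_in_map => x;
    rewrite mem_iota /c' => hx /=; case: ifP => //; lia.
  apply: epath_map_iota => w; apply: perm_window => [x|x y xw yw]; last exact: c'_inj xw yw.
  have := c_lt x; rewrite /c'; case: ifP => // _; rewrite /sw; case: ifP => _; first by lia.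
  by case: ifP => // _; lia.
- have n0 : count_mem 0 (map c (iota (L + d) L)) = s1.+1.
    rewrite count_map (eq_count (a2 := p0)) => [|x]; last exact: c0.
    have -> : L = G * s1.+1 by rewrite /L; lia.
    by rewrite count_modn_iota // ; have := s1_gt0; nia.
  have n1 : count_mem 1 (map c (iota (L + d) L)) = s1.
    rewrite count_map (eq_count (a2 := p1)) => [|x]; last exact: c1.
    have -> : L = a * s1 by rewrite /L; lia.
    by rewrite count_modn_iota //; lia.
  apply/allP => x _ /=; rewrite [count_mem x (map sw _)]count_map.
  rewrite (eq_count (a2 := pred1 (sw x))); last first.
    by move=> y /=; case: (x) => [|[|x']]; case: y => [|[|y]].
  by case: x => [|[|x]] /=; rewrite ?n0 ?n1 ?add0n ?add1n.
Qed.

End Words.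

(** * Dense families of tuples *)

Section Counting.
Variable V : finType.
Local Notation n := #|V|.

Fixpoint msum q (f : seq V -> nat) : nat :=
  if q is q'.+1 then \sum_(v : V) msum q' (fun s => f (v :: s)) else f [::].

Definition cnt q (P : pred (seq V)) := msum q (fun s => P s).

(** [C] is the reciprocal of a density, so all constants remain natural numbers. *)
Definition dense C q (P : pred (seq V)) := n ^ q <= C * cnt q P.

Lemma eq_msum q f g : (forall s, size s = q -> f s = g s) -> msum q f = msum q g.
Proof.
elim: q f g => [|q IH] f g fg /=; first exact: fg.
by apply: eq_bigr => v _; apply: IH => s ss; apply: fg; rewrite /= ss.
Qed.

Lemma leq_msum q f g : (forall s, size s = q -> f s <= g s) -> msum q f <= msum q g.
Proof.
elim: q f g => [|q IH] f g fg /=; first exact: fg.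
by apply: leq_sum => v _; apply: IH => s ss; apply: fg; rewrite /= ss.
Qed.

Lemma msum_cat q1 q2 f :
  msum (q1 + q2) f = msum q1 (fun s1 => msum q2 (fun s2 => f (s1 ++ s2))).
Proof. by elim: q1 f => [|q1 IH] f //=; apply: eq_bigr => v _; rewrite IH. Qed.

Lemma msumD q f g : msum q (fun s => f s + g s) = msum q f + msum q g.
Proof.
elim: q f g => [|q IH] f g //=; rewrite -big_split; apply: eq_bigr => v _.
by rewrite IH.
Qed.

Lemma msumM q c f : msum q (fun s => c * f s) = c * msum q f.
Proof.
by elim: q f => [|q IH] f //=; rewrite big_distrr; apply: eq_bigr => v _; rewrite IH.
Qed.

Lemma msum_const q c : msum q (fun _ => c) = c * n ^ q.
Proof.
elim: q => [|q IH] /=; first by rewrite muln1.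
by rewrite sum_nat_const cardT -cardE IH expnS mulnCA.
Qed.

Lemma msum_sum (I : Type) (r : seq I) (P : pred I) q F :
  msum q (fun s => \sum_(i <- r | P i) F i s) = \sum_(i <- r | P i) msum q (F i).
Proof.
elim: q F => [|q IH] F //=; rewrite exchange_big /=.
by apply: eq_bigr => v _; rewrite IH.
Qed.

Lemma msum_swap q1 q2 f :
  msum q1 (fun s1 => msum q2 (fun s2 => f s1 s2)) =
  msum q2 (fun s2 => msum q1 (fun s1 => f s1 s2)).
Proof.
elim: q1 f => [|q1 IH] f //=.
by rewrite msum_sum; apply: eq_bigr => v _; rewrite IH.
Qed.

Lemma cntP q P : 0 < cnt q P -> exists2 s, size s = q & P s.
Proof.
rewrite /cnt; elim: q P => [|q IH] P /=; first by case E: (P [::]) => // _; exists [::].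
rewrite lt0n sum_nat_eq0 negb_forall => /existsP[v] /=; rewrite -lt0n.
by move/(IH (fun s => P (v :: s))) => [s ss Ps]; exists (v :: s) => //=; rewrite ss.
Qed.

Lemma cnt_le q (P Q : pred (seq V)) :
  (forall s, size s = q -> P s -> Q s) -> cnt q P <= cnt q Q.
Proof. by move=> PQ; apply: leq_msum => s /PQ; case: (P s) => // ->. Qed.

Lemma cnt_predT q : cnt q predT = n ^ q.
Proof. by rewrite /cnt (eq_msum (g := fun=> 1)) // msum_const mul1n. Qed.

Lemma cnt_le_all q P : cnt q P <= n ^ q.
Proof. by rewrite -cnt_predT; apply: cnt_le. Qed.

Lemma cnt1 P : cnt 1 P = #|[pred v | P [:: v]]|.
Proof. by rewrite /cnt /= -sum1_card [RHS]big_mkcond; apply: eq_bigr => v _; rewrite inE; case: (P _). Qed.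

Lemma cnt_or q (P Q R : pred (seq V)) :
  (forall s, size s = q -> P s -> Q s || R s) -> cnt q P <= cnt q Q + cnt q R.
Proof.
move=> h; rewrite /cnt -msumD; apply: leq_msum => s /h.
by case: (P s) => //; case: (Q s); case: (R s) => // /(_ isT).
Qed.

Lemma dense_le C C' q (P Q : pred (seq V)) : C <= C' ->
  (forall s, size s = q -> P s -> Q s) -> dense C q P -> dense C' q Q.
Proof. by move=> CC PQ /leq_trans; apply; apply: leq_mul => //; apply: cnt_le. Qed.

Lemma dense_exists C q P : 0 < n -> dense C q P -> exists2 s, size s = q & P s.
Proof.
move=> n0 h; apply: cntP; rewrite lt0n; apply: contraL h => /eqP h.
by rewrite /dense h muln0 -ltnNge expn_gt0 n0.
Qed.

(** The prefixes with fewer than [n ^ q2 / (2 * C)] good completions account for at most half of the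
    good tuples. *)
Lemma dense_markov C q1 q2 (P : pred (seq V)) : 0 < n -> dense C (q1 + q2) P ->
  dense (2 * C) q1 (fun s1 => `[< dense (2 * C) q2 (fun s2 => P (s1 ++ s2)) >]).
Proof.
move=> n0; rewrite /dense /cnt msum_cat => h.
set f := fun s1 => msum q2 _ in h; set B := fun s1 => _.
have : 2 * C * msum q1 f <= 2 * C * (n ^ q2 * msum q1 (fun s => B s)) + n ^ (q1 + q2).
  rewrite expnD -msumM -[X in _ <= _ + X]mulnC -msum_const -!msumM -msumD.
  apply: leq_msum => s _; rewrite /B; case: asboolP => hB /=.
    rewrite muln1; apply: leq_trans (leq_addr _ _).
    by rewrite leq_mul2l (cnt_le_all q2 (fun s2 => P (s ++ s2))) orbT.
  by rewrite !muln0 add0n ltnW // ltnNge; apply/negP.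
have q0 : 0 < n ^ q2 by rewrite expn_gt0 n0.
move=> h2; rewrite -(leq_pmul2r q0) -expnD -mulnA [_ * n ^ q2]mulnC.
by rewrite -(leq_add2r (n ^ (q1 + q2))); apply: leq_trans h2; rewrite addnn -mul2n -mulnA leq_mul2l.
Qed.

Lemma dense_comp C1 C2 q1 q2 (P1 : pred (seq V)) (P2 : seq V -> pred (seq V)) :
  dense C1 q1 P1 -> (forall s, size s = q1 -> P1 s -> dense C2 q2 (P2 s)) ->
  dense (C1 * C2) (q1 + q2) (fun s => P1 (take q1 s) && P2 (take q1 s) (drop q1 s)).
Proof.
rewrite /dense => h1 h2; rewrite /cnt msum_cat.
have : n ^ q2 * cnt q1 P1 <= C2 * msum q1 (fun s1 => msum q2 (fun s2 =>
    P1 (take q1 (s1 ++ s2)) && P2 (take q1 (s1 ++ s2)) (drop q1 (s1 ++ s2)))).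
  rewrite /cnt -!msumM; apply: leq_msum => s ss.
  case: (boolP (P1 s)) => [Es|_]; last by rewrite muln0.
  have h := h2 s ss Es.
  rewrite muln1 (leq_trans h) // leq_mul2l; apply/orP; right.
  apply: leq_msum => s2 _; by rewrite -ss take_size_cat // drop_size_cat // Es.
move=> h; rewrite expnD; apply: leq_trans (leq_mul h1 (leqnn _)) _.
by rewrite -!mulnA leq_mul2l mulnC h orbT.
Qed.

Lemma dense_greedy C j (P : pred (seq V)) : P [::] ->
  (forall s, size s < j -> P s -> n <= C * #|[pred v | P (rcons s v)]|) ->
  dense (C ^ j) j P.
Proof.
move=> P0 hP; have : forall i, i <= j -> dense (C ^ i) i P.
  elim=> [_|i IH ij]; first by rewrite /dense /cnt /= P0.
  have := @dense_comp (C ^ i) C i 1 P (fun s t => P (s ++ t)) (IH (ltnW ij)).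
  rewrite -expnSr addn1; move=> /(_ _)/(dense_le (leqnn _)); apply.
    by move=> s ss /andP[_]; rewrite cat_take_drop.
  move=> s ss Ps; rewrite /dense expn1 cnt1 (leq_trans (hP s _ Ps)) ?ss //.
  rewrite leq_mul2l; apply/orP; right; apply: subset_leq_card.
  by apply/subsetP => v; rewrite !inE cats1.
by apply.
Qed.

(** Induction on [q] with the first vertex moved into the forbidden list, so that a repetition
    becomes a case of meeting [Z]. *)
Lemma cnt_meet q (Z : seq V) :
  n * cnt q (fun s => ~~ (uniq s && ~~ has (mem Z) s)) <= q * (q + size Z) * n ^ q.
Proof.
rewrite /cnt; elim: q Z => [|q IH] Z /=; first by rewrite muln0.
have : \sum_v msum q (fun s => ~~ ((v \notin s) && uniq s && ~~ ((v \in Z) || has (mem Z) s)))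
    <= \sum_v ((v \in Z) * n ^ q + msum q (fun s => ~~ (uniq s && ~~ has (mem (v :: Z)) s))).
  apply: leq_sum => v _; rewrite -msum_const -msumD; apply: leq_msum => s _.
  case: (boolP (v \in Z)) => vZ /=; first by rewrite andbF.
  case: (boolP (v \in s)) => vs /=.
    have -> : has (mem (v :: Z)) s by apply/hasP; exists v => //; exact: mem_head.
    by rewrite andbF.
  case: (uniq s) => //=; rewrite negbK add0n; case: hasP => [[x xs xZ]|//].
  have -> : has (mem (v :: Z)) s by apply/hasP; exists x => //=; rewrite inE; apply/orP; right.
  by [].
rewrite -(leq_pmul2l (_ : 0 < 1)) // !mul1n => h.
apply: leq_trans (leq_mul (leqnn n) h) _; rewrite big_split /= mulnDr -big_distrl /=.
have hz : \sum_(v : V) (v \in Z : nat) <= size Z.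
  by rewrite -big_mkcond sum1_card; apply: card_size.
have h2 : n * \sum_(v : V) msum q (fun s => ~~ (uniq s && ~~ has (mem (v :: Z)) s))
     <= n * (q * (q + (size Z).+1) * n ^ q).
  rewrite [X in X <= _]big_distrr /=.
  have -> : n * (q * (q + (size Z).+1) * n ^ q) = \sum_(v : V) q * (q + (size Z).+1) * n ^ q.
    by rewrite sum_nat_const.
  by apply: leq_sum => v _; apply: IH.
apply: leq_trans (leq_add (leq_mul (leqnn n) (leq_mul hz (leqnn _))) h2) _.
have -> : n * (size Z * n ^ q) + n * (q * (q + (size Z).+1) * n ^ q) =
  (size Z + q * (q + (size Z).+1)) * (n * n ^ q) by lia.
by rewrite -expnS leq_mul2r; apply/orP; right; lia.
Qed.

Lemma dense_uniq C q (P : pred (seq V)) (Z : seq V) :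
  0 < n -> 2 * C * (q * (q + size Z)) <= n -> dense C q P ->
  dense (2 * C) q (fun s => [&& P s, uniq s & ~~ has (mem Z) s]).
Proof.
move=> n0 hC; rewrite /dense => h; have h1 := cnt_meet q Z.
set B := fun s => ~~ _ in h1; set Q := fun s => _.
have h2 : cnt q P <= cnt q Q + cnt q B.
  by apply: cnt_or => s _ Ps; rewrite /Q /B Ps /= orbN.
have h3 : 2 * C * cnt q B <= n ^ q.
  rewrite -(leq_pmul2l n0) mulnCA; apply: leq_trans (leq_mul (leqnn _) h1) _.
  by rewrite mulnA leq_mul2r hC orbT.
have : 2 * n ^ q <= 2 * C * cnt q P by lia.
have := leq_mul (leqnn (2 * C)) h2; lia.
Qed.

Lemma dense_has C q (P : pred (seq V)) (Z : seq V) :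
  0 < n -> 2 * C * (q * (q + size Z)) <= n -> dense C q P ->
  exists s, [/\ size s = q, P s, uniq s & ~~ has (mem Z) s].
Proof.
move=> n0 hC h; have := dense_uniq n0 hC h.
by move=> /(dense_exists n0)[s ss /and3P[]]; exists s.
Qed.

Lemma leq_exp2 x y t : x <= y -> x ^ t <= y ^ t.
Proof. by move=> xy; elim: t => // t IH; rewrite !expnS leq_mul. Qed.

(** Chebyshev's sum inequality for the similarly ordered functions [f] and [f ^ t]: the
    rearrangement inequality, summed over all pairs of arguments. *)
Lemma chebyshev_msum q t (f : seq V -> nat) :
  msum q f * msum q (fun s => f s ^ t) <= n ^ q * msum q (fun s => f s ^ t.+1).
Proof.
have rearr x y : x * y ^ t + y * x ^ t <= x ^ t.+1 + y ^ t.+1.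
  rewrite !expnS; case/orP: (leq_total x y) => /[dup] xy /(leq_exp2 t); nia.
have e1 : msum q f * msum q (fun s => f s ^ t) =
   msum q (fun s => msum q (fun s' => f s * f s' ^ t)).
  by rewrite mulnC -msumM; apply: eq_msum => s _; rewrite mulnC -msumM.
have e2 : msum q f * msum q (fun s => f s ^ t) =
   msum q (fun s => msum q (fun s' => f s' * f s ^ t)).
  by rewrite e1 msum_swap.
rewrite -(leq_pmul2l (_ : 0 < 2)) // mul2n -addnn {1}e1 e2 -msumD.
have -> : 2 * (n ^ q * msum q (fun s => f s ^ t.+1)) =
   msum q (fun s => msum q (fun s' => f s ^ t.+1 + f s' ^ t.+1)).
  rewrite [RHS](eq_msum (g := fun s => n ^ q * f s ^ t.+1 + msum q (fun s' => f s' ^ t.+1))).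
    by rewrite msumD msumM msum_const [_ * n ^ q]mulnC addnn mul2n.
  by move=> s _; rewrite msumD msum_const mulnC.
by apply: leq_msum => s _; rewrite -msumD; apply: leq_msum => s' _; rewrite addnC; apply: leq_trans (rearr _ _) _; rewrite addnC.
Qed.

(** Convexity of the power [t.+1], in integer form. *)
Lemma power_mean q t (f : seq V -> nat) :
  msum q f ^ t.+1 <= (n ^ q) ^ t * msum q (fun s => f s ^ t.+1).
Proof.
elim: t => [|t IH]; first by rewrite expn1 expn0 mul1n; apply: leq_msum => s _; rewrite expn1.
rewrite expnS; apply: leq_trans (leq_mul (leqnn _) IH) _.
rewrite mulnCA [(n ^ q) ^ t.+1]expnS -mulnA [n ^ q * _]mulnCA leq_mul2l.
by rewrite chebyshev_msum orbT.
Qed.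

Lemma cnt_all t (P : pred V) : cnt t (all P) = #|P| ^ t.
Proof.
rewrite /cnt; elim: t => [|t IH] //=.
rewrite (eq_bigr (fun v => P v * #|P| ^ t)); last first.
  move=> v _; rewrite -IH -msumM; apply: eq_msum => s _.
  by case: (P v); rewrite ?mul1n ?mul0n.
rewrite -big_distrl /= expnS; congr (_ * _).
by rewrite -sum1_card [RHS]big_mkcond; apply: eq_bigr => v _; rewrite unfold_in; case: (P v).
Qed.

(* [s] lists [N] blocks of length [t]; every transversal of the blocks satisfies [Q]. *)
Fixpoint blow t N (Q : pred (seq V)) (s : seq V) : bool :=
  if N is N'.+1
  then blow t N' (fun s' => all (fun v => Q (v :: s')) (take t s)) (drop t s)
  else Q [::].

Lemma blowP t N Q s x0 (g : nat -> nat) : size s = N * t -> (forall i, g i < t) ->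
  blow t N Q s -> Q [seq nth x0 s (i * t + g i) | i <- iota 0 N].
Proof.
elim: N Q s g => [|N IH] Q s g //= ss gt /IH -/(_ (fun i => g i.+1)).
rewrite size_drop ss mulSn addKn => /(_ erefl (fun i => gt _)) /allP.
move=> /(_ (nth x0 s (g 0))); rewrite -(nth_take x0 (gt 0)) mem_nth; last first.
  by rewrite size_takel ?gt // ss mulSn leq_addr.
rewrite nth_take // => /(_ isT); congr (Q (_ :: _)).
rewrite -[1]/(1 + 0) iotaDl -map_comp; apply: eq_map => i /=.
by rewrite nth_drop add1n mulSn addnA.
Qed.

End Counting.

(** Induction on the number of parts. By power means, densely many pairs of a [T]-tuple of first
    vertices and a tail are compatible throughout; by [dense_markov], densely many [T]-tuples leave
    a dense family of common tails, which is blown up in turn. *)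
Lemma blow_dense t N C : exists C', forall (V : finType) (Q : pred (seq V)),
  0 < #|V| -> dense C N Q -> dense C' (N * t.+1) (blow t.+1 N Q).
Proof.
set T := t.+1; elim: N C => [|N IH] C; first by exists C.
have [C'' h''] := IH (2 * C ^ T); exists (2 * C ^ T * C'') => V Q n0 hQ.
pose f s' := #|[pred v | Q (v :: s')]|.
have e1 : cnt N.+1 Q = msum N f.
  rewrite /cnt /= -msum_sum; apply: eq_msum => s _; rewrite /f -sum1_card [RHS]big_mkcond.
  by apply: eq_bigr => v _; rewrite inE; case: (Q _).
pose R s := all (fun v => Q (v :: drop T s)) (take T s).
have e2 : cnt (T + N) R = msum N (fun s => f s ^ T).
  rewrite /cnt msum_cat msum_swap; apply: eq_msum => s _.
  rewrite -(cnt_all T [pred v | Q (v :: s)]); apply: eq_msum => vs svs.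
  by rewrite /R -svs drop_size_cat // take_size_cat.
have hR : dense (C ^ T) (T + N) R.
  rewrite /dense e2; move: hQ; rewrite /dense e1 => /(leq_exp2 T).
  rewrite expnMn -expnM => h.
  have := leq_trans h (leq_mul (leqnn _) (power_mean N t f)).
  rewrite mulnCA -expnM.
  have -> : N.+1 * T = N * t + (T + N) by rewrite /T; lia.
  by rewrite expnD leq_pmul2l ?expn_gt0 ?n0.
have h1 := dense_markov n0 hR.
have := @dense_comp _ _ C'' _ (N * T) _ (fun vs => blow T N (fun s' => R (vs ++ s'))) h1.
rewrite -mulSn => /(_ _)/(dense_le (leqnn _)); apply; last first.
  by move=> vs svs /asboolP; apply: h''.
move=> s ss /andP[_] /=; congr (is_true (blow _ _ _ _)).
apply: funext => s'; rewrite /R drop_size_cat ?take_size_cat // size_takel //.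
all: by rewrite ss mulSn leq_addr.
Qed.

Section Reverse.
Variable V : finType.

Lemma msum_rev q (f : seq V -> nat) : msum q f = msum q (fun s => f (rev s)).
Proof.
elim: q f => [|q IH] f //.
have -> : msum q.+1 f = \sum_v msum q (fun s => f (rcons s v)).
  rewrite -addn1 msum_cat /= msum_sum.
  by apply: eq_bigr => v _; apply: eq_msum => s _; rewrite cats1.
by apply: eq_bigr => v _; rewrite IH; apply: eq_msum => s _; rewrite rev_cons.
Qed.

Lemma dense_rev C q (P : pred (seq V)) : dense C q P -> dense C q (fun s => P (rev s)).
Proof. by rewrite /dense /cnt msum_rev. Qed.

Lemma dense_rot C q1 q2 (P : pred (seq V)) : dense C (q1 + q2) P ->
  dense C (q2 + q1) (fun s => P (drop q2 s ++ take q2 s)).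
Proof.
rewrite /dense /cnt [X in _ ^ X]addnC => /leq_trans; apply; rewrite leq_mul2l; apply/orP; right.
rewrite [X in X <= _]msum_cat [X in X <= _]msum_swap msum_cat; apply: leq_msum => s2 h2.
by apply: leq_msum => s1 _; rewrite -h2 drop_size_cat // take_size_cat.
Qed.

End Reverse.

(** * Connecting *)

Section Occurrences.

(** Labels every letter with the number of its earlier occurrences, so that a repeated letter
    receives distinct vertices of its part. *)
Fixpoint occs (seen w : seq nat) : seq (nat * nat) :=
  if w is x :: w' then (x, count_mem x seen) :: occs (x :: seen) w' else [::].

Lemma occs_fst seen w : map fst (occs seen w) = w.
Proof. by elim: w seen => //= x w IH seen; rewrite IH. Qed.

Lemma occs_bound seen w p : p \in occs seen w ->
  count_mem p.1 seen <= p.2 < count_mem p.1 seen + size w.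
Proof.
elim: w seen => //= x w IH seen; rewrite inE => /orP[/eqP -> /=|/IH /=].
  by rewrite leqnn -addn1 leq_add2l.
by case: (x == p.1); lia.
Qed.

Lemma occs_uniq seen w : uniq (occs seen w).
Proof.
elim: w seen => //= x w IH seen; rewrite IH andbT; apply/negP => /occs_bound /=.
by rewrite eqxx; lia.
Qed.

End Occurrences.

Section Graph.
Variables (l d : nat).
Hypotheses (hl : 0 < l) (hd : 2 <= d) (hkd : ~~ (d %| l + d)).
Local Notation k := (l + d).

Definition edge (V : finType) (E : {set {set V}}) (w : seq V) : bool :=
  [set x in w] \in E.

(** Codegrees at least [n / mu]: the weak form of the hypothesis on which connecting and absorbing
    rest. *)
Definition codense mu (V : finType) (E : {set {set V}}) : Prop :=
  (forall e, e \in E -> #|e| = k) /\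
  (forall S : seq V, uniq S -> size S = k.-1 ->
     #|V| <= mu * #|[pred v | edge E (rcons S v)]|).

Definition inKS (KS : seq (seq nat)) (w : seq nat) := has (fun K => perm_eq K w) KS.

Definition KSgood N (KS : seq (seq nat)) :=
  forall K, K \in KS -> [/\ uniq K, size K = k & all (fun i => i < N) K].

Section OneGraph.
Variables (V : finType) (E : {set {set V}}).

Lemma edge_perm (w w' : seq V) : perm_eq w w' -> edge E w = edge E w'.
Proof. by move=> p; rewrite /edge; congr (_ \in E); apply/setP => x; rewrite !inE (perm_mem p). Qed.

Lemma edge_rev w : edge E w -> edge E (rev w).
Proof. by rewrite (@edge_perm _ w) //; apply/permPl/perm_rev. Qed.

Lemma edge_uniq (w : seq V) : (forall e, e \in E -> #|e| = k) -> size w = k -> edge E w -> uniq w.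
Proof.
move=> hE sw /hE; rewrite cardsE => h; apply/card_uniqP; rewrite sw -h.
by apply: eq_card.
Qed.

Variable x0 : V.

Definition vtx t (b : seq V) (p : nat * nat) := nth x0 b (p.1 * t + p.2).

Lemma vtx_inj t N (b : seq V) p p' : uniq b -> size b = N * t -> p.1 < N -> p'.1 < N ->
  p.2 < t -> p'.2 < t -> vtx t b p = vtx t b p' -> p = p'.
Proof.
case: p p' => i m [i' m'] /= ub sb iN iN' mt mt' /eqP.
have lt i1 m1 : i1 < N -> m1 < t -> i1 * t + m1 < N * t.
  move=> h1 h2; have : i1.+1 * t <= N * t by rewrite leq_mul2r h1 orbT.
  by rewrite mulSn; lia.
rewrite /vtx nth_uniq ?sb ?lt //= => /eqP h.
have t0 : 0 < t by lia.
have := congr1 (fun x => x %/ t) h; rewrite !divnMDl // !divn_small // !addn0 => ->.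
by have := congr1 (fun x => x %% t) h; rewrite !modnMDl !modn_small // => ->.
Qed.

Lemma vtx_mem t N (b : seq V) p : size b = N * t -> p.1 < N -> p.2 < t -> vtx t b p \in b.
Proof.
move=> sb pN pt; apply: mem_nth; rewrite sb.
have : p.1.+1 * t <= N * t by rewrite leq_mul2r pN orbT.
by rewrite mulSn; lia.
Qed.

Lemma map_vtx_uniq t N (b : seq V) (z : seq (nat * nat)) : uniq b -> size b = N * t ->
  all (fun p => (p.1 < N) && (p.2 < t)) z -> uniq z -> uniq (map (vtx t b) z).
Proof.
move=> ub sb /allP hz uz; rewrite map_inj_in_uniq // => p p' /hz /andP[h1 h2] /hz /andP[h3 h4].
exact: vtx_inj ub sb h1 h3 h2 h4.
Qed.

(** The choices in different parts are independent: take the prescribed copy in each part met by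
    [zz] and copy 0 in the others. *)
Lemma blow_transversal t N (Q : pred (seq V)) (b : seq V) (zz : seq (nat * nat)) :
  size b = N * t -> blow t N Q b -> uniq (map fst zz) -> 0 < t ->
  all (fun p => (p.1 < N) && (p.2 < t)) zz ->
  exists s, [/\ size s = N, Q s & forall p, p \in zz -> nth x0 s p.1 = vtx t b p].
Proof.
move=> sb hb uz t0 /allP hz.
pose g i := nth 0 (map snd zz) (index i (map fst zz)).
have gE p : p \in zz -> g p.1 = p.2.
  move=> pz; set j := index p zz; have jz : j < size zz by rewrite index_mem.
  have pE : p = nth (0, 0) zz j by rewrite nth_index.
  have iE : index p.1 (map fst zz) = j.
    rewrite {1}pE -(nth_map _ 0) // index_uniq ?size_map //.
  by rewrite /g iE (nth_map (0, 0)) // -pE.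
have gt i : g i < t.
  rewrite /g; case: (ltnP (index i (map fst zz)) (size (map snd zz))) => h.
    have /mapP[p pz ->] : nth 0 (map snd zz) (index i (map fst zz)) \in map snd zz by exact: mem_nth.
    by have /andP[] := hz p pz.
  by rewrite nth_default.
exists [seq nth x0 b (i * t + g i) | i <- iota 0 N]; split.
- by rewrite size_map size_iota.
- exact: blowP.
- move=> p pz; have /andP[pN _] := hz p pz.
  by rewrite (nth_map 0) ?size_iota // nth_iota // add0n gE.
Qed.

(** The letters of a window are pairwise distinct, so its vertices belong to one transversal of the
    block, and all transversals satisfy [Q]. *)
Lemma blow_epath t N KS (Q : pred (seq V)) (b : seq V) (z : seq (nat * nat)) : KSgood N KS ->
  (forall s, size s = N -> Q s -> all (fun K => edge E (map (nth x0 s) K)) KS) ->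
  size b = N * t -> blow t N Q b -> all (fun p => p.2 < t) z ->
  epath l d (inKS KS) (map fst z) -> epath l d (edge E) (map (vtx t b) z).
Proof.
move=> hKS hQ sb hb /allP hz Ez j; rewrite size_map => hj.
have := Ez j; rewrite size_map => /(_ hj) /hasP[K KK].
rewrite -map_drop -map_take -map_drop -map_take; set zz := take _ _ => pK.
have [uK sK /allP NK] := hKS K KK.
have zsub p : p \in zz -> p \in z by move/mem_take/mem_drop.
have zzN p : p \in zz -> (p.1 < N) && (p.2 < t).
  move=> pz; rewrite hz ?zsub // andbT; apply: NK; rewrite (perm_mem pK); exact: map_f.
have k0 : 0 < size zz by rewrite -(size_map fst) -(perm_size pK) sK; lia.
have t0 : 0 < t.
  case: zz {pK zsub} zzN k0 => // p zz' zzN _.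
  by have /andP[_] := zzN p (mem_head _ _); case: (t).
have uz : uniq (map fst zz) by rewrite -(perm_uniq pK).
have [s [ss Qs sE]] := blow_transversal sb hb uz t0 (introT allP zzN).
have /allP/(_ K KK) := hQ s ss Qs.
rewrite (edge_perm (perm_map (nth x0 s) pK)) -map_comp.
by rewrite (_ : map _ zz = map (vtx t b) zz) //; apply/eq_in_map => p pz /=; rewrite sE.
Qed.

Variable mu : nat.
Hypothesis hE : codense mu E.

Lemma mu_gt0 : k <= #|V| -> 0 < mu.
Proof.
move=> kV; have [_ h] := hE.
have ue := enum_uniq V.
have eV : size (enum V) = #|V| by rewrite cardE.
have := h (take k.-1 (enum V)) (take_uniq _ ue).
rewrite size_takel; last by rewrite eV; lia.
by case: (mu) => // /(_ erefl); rewrite mul0n; lia.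
Qed.

(** The last [k.-1] vertices and the new one are asked to form an edge even when no aligned window
    ends there, which avoids a case distinction on the length. *)
Lemma epath_rcons (c : seq V) : k <= #|V| -> uniq c -> epath l d (edge E) c ->
  exists U : pred V, #|V| <= mu * #|U| /\ forall v, U v -> epath l d (edge E) (rcons c v).
Proof.
move=> kV uc Ec; have [_ hc] := hE.
have ext (U : pred V) : (k.-1 <= size c -> forall v, U v -> edge E (rcons (drop (size c - k.-1) c) v)) ->
    forall v, U v -> epath l d (edge E) (rcons c v).
  move=> hU v Uv j hj0; have : j * d + k <= (size c).+1 by rewrite -(size_rcons c v).
  rewrite leq_eqVlt => /orP[/eqP hj|]; last first.
    rewrite ltnS => hj; rewrite -cats1 drop_cat ifT; last by lia.
    by rewrite takel_cat ?size_drop; [apply: Ec | lia].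
  have -> : take k (drop (j * d) (rcons c v)) = rcons (drop (size c - k.-1) c) v.
    have jc : j * d <= size c by clear -hj hl; lia.
    rewrite drop_rcons //.
    rewrite take_oversize ?size_rcons ?size_drop; last by lia.
    by congr (rcons (drop _ _) _); lia.
  by apply: hU => //; lia.
case: (leqP k.-1 (size c)) => h.
  exists [pred v | edge E (rcons (drop (size c - k.-1) c) v)]; split.
    by apply: hc; [exact: drop_uniq | rewrite size_drop; lia].
  exact: ext.
exists predT; split; last by apply: ext => h'; lia.
by rewrite cardT -cardE leq_pmull // mu_gt0.
Qed.

Lemma extension_dense q (S : seq V) : size S = l -> uniq S -> k <= #|V| ->
  2 * mu * (l + q) <= #|V| ->
  dense ((2 * mu) ^ q) q (fun z => uniq (S ++ z) && `[< epath l d (edge E) (S ++ z) >]).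
Proof.
move=> sS uS kV hq; apply: dense_greedy.
  rewrite cats0 uS /=; apply/asboolP => j; rewrite sS; lia.
move=> s sq /andP[us /asboolP Es].
have [U [hU UE]] := epath_rcons kV us Es.
have : #|U| <= #|[pred v | uniq (S ++ rcons s v) && `[< epath l d (edge E) (S ++ rcons s v) >]]| + (l + q).
  have cl : #|[pred v | v \in S ++ s]| <= l + q.
    by apply: leq_trans (card_size _) _; rewrite size_cat sS; lia.
  apply: leq_trans (leq_add (leqnn _) cl).
  rewrite -cardUI; apply: leq_trans (leq_addr _ _); apply: subset_leq_card.
  apply/subsetP => v Uv; rewrite !inE -rcons_cat rcons_uniq us andbT.
  case: (boolP (v \in _)) => //= _; rewrite orbF.
  by apply/asboolP; exact: UE.
set X := #|U| in hU *; set Y := #|_| => XY.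
have := leq_mul (leqnn (2 * mu)) XY; rewrite mulnDr; lia.
Qed.

(** The connecting word may use only some of the vertices of [W], which allows [W] to contain a
    whole blown-up block. *)
Definition connector (S T W : seq V) : Prop :=
  exists c, [/\ {subset c <= W}, uniq c, d %| l + size c
              & epath l d (edge E) (S ++ c ++ T)].

(** The length of the padding between a prescribed end and the link: [l + q0 = l * d], so a window
    starts right after it. *)
Local Notation q0 := (d.-1 * l).
Local Notation C0 := (2 * (2 * mu) ^ (q0 + k)).

Definition fwd (S x : seq V) := dense C0 q0 (fun z => `[< epath l d (edge E) (S ++ z ++ x) >]).
Definition bwd (T y : seq V) := dense C0 q0 (fun z => `[< epath l d (edge E) (y ++ z ++ T) >]).

Lemma fwd_dense (S : seq V) : size S = l -> uniq S -> k <= #|V| ->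
  2 * mu * (l + (q0 + k)) <= #|V| -> dense C0 k (fun x => `[< fwd S x >]).
Proof.
move=> sS uS kV hV; have h := extension_dense sS uS kV hV.
have n0 : 0 < #|V| by lia.
have := dense_markov n0 (dense_rot h); apply: dense_le => // x sx /asboolP hx.
apply/asboolP; apply: dense_le hx => // z sz /=.
by rewrite -sx drop_size_cat // take_size_cat // => /andP[].
Qed.

Lemma bwd_dense (T : seq V) : size T = l -> uniq T -> k <= #|V| ->
  2 * mu * (l + (q0 + k)) <= #|V| -> dense C0 k (fun y => `[< bwd T y >]).
Proof.
move=> sT uT kV hV; have := @fwd_dense (rev T).
rewrite size_rev rev_uniq => /(_ sT uT kV hV) /dense_rev.
apply: dense_le => // y sy /asboolP /dense_rev hy; apply/asboolP.
apply: dense_le hy => // z sz /asboolP h; apply/asboolP.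
have -> : y ++ z ++ T = rev (rev T ++ rev z ++ rev y).
  by rewrite !rev_cat !revK catA.
apply: (@epath_rev _ _ _ _ _ l.+1) h; first by lia.
  by rewrite !size_cat !size_rev sy sz sT; nia.
exact: edge_rev.
Qed.

End OneGraph.

Lemma epath_letters N KS (c : seq nat) m : KSgood N KS -> size c = k + m * d ->
  epath l d (inKS KS) c -> all (fun x => x < N) c.
Proof.
move=> hKS sc Ec; apply/allP => x xc.
pose p := index x c; have pc : p < size c by rewrite index_mem.
have [j [hj jp pj]] : exists j, [/\ j * d + k <= size c, j * d <= p & p < j * d + k].
  have a2 := leq_trunc_div p d; have := ltn_ceil p (ltnW hd); rewrite mulSn => a3.
  case: (leqP (p %/ d) m) => h; have a1 := leq_mul h (leqnn d).
    exists (p %/ d); move: (p %/ d * d) a1 a2 a3 => e a1 a2 a3.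
    by clear -a1 a2 a3 sc; split; lia.
  exists m; move: (p %/ d * d) a1 a2 a3 => e; rewrite mulSn => a1 a2 a3.
  by clear -a1 a2 a3 sc pc; split; lia.
have /hasP[K KK pK] := Ec j hj; have [_ _ /allP] := hKS K KK; apply.
rewrite (perm_mem pK) -(nth_index 0 xc) -/p -(subnKC jp) -nth_drop.
have lt : p - j * d < k by clear -jp pj; lia.
rewrite -(nth_take 0 lt); apply: mem_nth.
have ks : k <= size (drop (j * d) c) by rewrite size_drop; clear -hj; lia.
by rewrite size_takel.
Qed.

Lemma conn_sub N KS K K' L (u v : seq nat) : KSgood N KS -> K \in KS -> K' \in KS ->
  uniq L -> size L = l -> {subset L <= K} -> {subset L <= K'} ->
  perm_eq K u -> perm_eq K' v -> exists m, conn l d (inKS KS) m u v.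
Proof.
move=> hKS hK hK' uL sL LK LK' pu pv.
have split K0 : uniq K0 -> {subset L <= K0} -> perm_eq K0 ([seq x <- K0 | x \notin L] ++ L).
  move=> uK0 LK0; apply: uniq_perm => //.
    rewrite cat_uniq filter_uniq //= uL andbT; apply/hasPn => x xL.
    by rewrite /= mem_filter xL.
  move=> x; rewrite mem_cat mem_filter; case: (boolP (x \in L)) => [/LK0 ->|_] //=.
  by rewrite orbF.
have [uK sK _] := hKS K hK; have [uK' sK' _] := hKS K' hK'.
apply: (@conn_cross l d _ (inKS KS) K K' [seq x <- K | x \notin L] L
   [seq x <- K' | x \notin L]) => //.
- by move=> w pw; apply/hasP; exists K.
- by move=> w pw; apply/hasP; exists K'.
- exact: split.
- by rewrite (perm_trans (split K' uK' LK')) // perm_catC.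
Qed.

(* Letters [0..k-1] stand for an edge x, [k..2k-1] for an edge y and [2k + i] for
   auxiliary vertices w_i; consecutive sets of the chain
   x, {y_0, x_1, .., x_(k-2), w_0}, .., {y_0, .., y_(k-2), w_(k-2)}, y
   share at least k - 2 >= l letters. *)
Definition link_set i := iota k i.+1 ++ iota i.+1 (k - 2 - i) ++ [:: 2 * k + i].
Definition link_chain := iota 0 k :: iota k k :: [seq link_set i | i <- iota 0 k.-1].

Lemma link_chain_good : KSgood (2 * k + k.-1) link_chain.
Proof.
move=> K; rewrite !inE => /or3P[/eqP->|/eqP->|/mapP[i]].
- by split; rewrite ?iota_uniq ?size_iota //; apply/allP => x; rewrite mem_iota; lia.
- by split; rewrite ?iota_uniq ?size_iota //; apply/allP => x; rewrite mem_iota; lia.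
rewrite mem_iota => ik ->; rewrite /link_set; split.
- rewrite !cat_uniq !iota_uniq !andTb !andbT; apply/andP; split.
    by apply/hasPn => x; rewrite mem_cat inE !mem_iota; lia.
  by apply/hasPn => x; rewrite inE mem_iota; lia.
- by rewrite !size_cat !size_iota /=; lia.
- apply/allP => x; rewrite !mem_cat !mem_iota inE; lia.
Qed.

Lemma link_word : exists m, conn l d (inKS link_chain) m (iota 0 k) (iota k k).
Proof.
have hG := link_chain_good.
have XK : iota 0 k \in link_chain by rewrite mem_head.
have YK : iota k k \in link_chain by rewrite !inE eqxx orbT.
have eK i : i < k.-1 -> link_set i \in link_chain.
  by move=> ik; rewrite !inE map_f ?orbT // mem_iota.
have chain i : i < k.-1 -> exists m, conn l d (inKS link_chain) m (iota 0 k) (link_set i).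
  elim: i => [|i IH] ik.
    apply: (conn_sub (L := iota 1 l) hG XK (eK 0 ik)) => //; rewrite ?iota_uniq ?size_iota //.
      by move=> x; rewrite !mem_iota; lia.
    by move=> x; rewrite !mem_cat !mem_iota; lia.
  have [m1 h1] := IH (ltnW ik).
  pose L := take l (iota k i.+1 ++ iota i.+2 (k - 3 - i)).
  have uL : uniq L.
    apply: take_uniq; rewrite cat_uniq !iota_uniq andbT andTb.
    by apply/hasPn => x; rewrite !mem_iota; lia.
  have sL : size L = l by rewrite size_takel // size_cat !size_iota; lia.
  have L1 : {subset L <= link_set i} by move=> x /mem_take; rewrite !mem_cat !mem_iota; lia.
  have L2 : {subset L <= link_set i.+1} by move=> x /mem_take; rewrite !mem_cat !mem_iota; lia.
  have [m2 h2] := conn_sub hG (eK i (ltnW ik)) (eK i.+1 ik) uL sL L1 L2 (perm_refl _) (perm_refl _).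
  exists (m1 + m2); apply: conn_trans h1 h2; first by lia.
  by have [_ ->] := hG _ (eK i (ltnW ik)).
have k2 : k - 2 < k.-1 by lia.
have [m1 h1] := chain _ k2.
have L1 : {subset iota k l <= link_set (k - 2)} by move=> x; rewrite !mem_cat !mem_iota; lia.
have L2 : {subset iota k l <= iota k k} by move=> x; rewrite !mem_iota; lia.
have [m2 h2] := conn_sub hG (eK _ k2) YK (iota_uniq _ _) (size_iota _ _) L1 L2 (perm_refl _) (perm_refl _).
exists (m1 + m2); apply: conn_trans h1 h2; first by lia.
by have [_ ->] := hG _ (eK _ k2).
Qed.

Section Link.
Variables (V : finType) (E : {set {set V}}) (x0 : V) (mu : nat).
Hypothesis hE : codense mu E.

(** The tuple lists [x], then [y], then the auxiliary vertices. The paddings towards [S] and [T] are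
    only required to be plentiful here; they are chosen after the blow-up. *)
Definition link_ok (S T s : seq V) : bool :=
  let x := take k s in let y := take k (drop k s) in
  [&& `[< fwd E mu S x >], `[< bwd E mu T y >]
    & all (fun K => edge E (map (nth x0 s) K)) link_chain].

Local Notation q0 := (d.-1 * l).
Local Notation C0 := (2 * (2 * mu) ^ (q0 + k)).

Lemma fwd_edge (S x : seq V) : 0 < #|V| -> size S = l -> size x = k -> fwd E mu S x -> edge E x.
Proof.
move=> n0 sS sx /(dense_exists n0)[z sz /asboolP h].
have := h l; rewrite catA drop_size_cat; last by rewrite size_cat sS sz; nia.
rewrite take_oversize ?sx //; apply.
by rewrite !size_cat sS sz sx; nia.
Qed.

Lemma bwd_edge (T y : seq V) : 0 < #|V| -> size T = l -> size y = k -> bwd E mu T y -> edge E y.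
Proof.
move=> n0 sS sx /(dense_exists n0)[z sz /asboolP h].
have := h 0; rewrite mul0n drop0 take_size_cat //; apply.
by rewrite !size_cat sS sz sx; lia.
Qed.

(** Once [x] and [y] are chosen, the other [k.-1] letters of each [link_set i] are fixed distinct
    vertices, so the auxiliary vertices can be added one by one by the codegree condition. *)
Lemma link_ok_dense (S T : seq V) : size S = l -> size T = l -> uniq S -> uniq T -> k <= #|V| ->
  2 * mu * (l + (q0 + k)) <= #|V| -> 2 * (C0 * C0) * ((k + k) * (k + k)) <= #|V| ->
  dense (2 * (C0 * C0) * mu ^ k.-1) (2 * k + k.-1) (link_ok S T).
Proof.
move=> sS sT uS uT kV h1 h2; have n0 : 0 < #|V| by lia.
have hx := fwd_dense hE sS uS kV h1; have hy := bwd_dense hE sT uT kV h1.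
have hxy := dense_comp hx (fun _ _ _ => hy).
have := @dense_uniq _ _ _ _ [::] n0 _ hxy; rewrite /= addn0 => /(_ h2) {}hxy; clear h1 h2 hx hy.
pose A xy i := map (nth x0 xy) (iota k i.+1 ++ iota i.+1 (k - 2 - i)) : seq V.
pose P2 xy w := all (fun i => edge E (rcons (A xy i) (nth x0 w i))) (iota 0 (size w)).
have := @dense_comp _ _ (mu ^ k.-1) (k + k) k.-1 _ P2 hxy.
rewrite addnn -mul2n => /(_ _)/(dense_le (leqnn _)); apply; last first.
  move=> xy sxy /and3P[_ uxy _]; apply: dense_greedy => //.
  move=> w sw Pw; have [_ hc] := hE.
  apply: leq_trans (hc (A xy (size w)) _ _) _.
  - rewrite map_inj_in_uniq; last first.
      move=> i j; rewrite !mem_cat !mem_iota => hi hj /eqP.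
      by rewrite nth_uniq ?sxy //; [move/eqP | clear -hi sw hl hd; lia | clear -hj sw hl hd; lia].
    rewrite cat_uniq !iota_uniq andbT andTb.
    by apply/hasPn => x; rewrite !mem_iota; lia.
  - by rewrite size_map size_cat !size_iota; lia.
  rewrite leq_mul2l; apply/orP; right; apply: subset_leq_card.
  apply/subsetP => v; rewrite !inE /P2 size_rcons -addn1 iotaD all_cat add0n [all _ (iota (size w) 1)]/= andbT.
  rewrite nth_rcons ltnn eqxx => ->; rewrite andbT; apply/allP => i.
  move=> iI; have := iI; rewrite mem_iota add0n leq0n andTb => iw; rewrite nth_rcons iw; exact: (allP Pw).
move=> s ss /andP[/and3P[/andP[f1 f2] _ _] /allP hw].
have sx : size (take (2 * k) s) = 2 * k by rewrite size_takel // ss leq_addr.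
have t1 : take k (take (2 * k) s) = take k s by rewrite take_takel //; lia.
have t2 : drop k (take (2 * k) s) = take k (drop k s).
  by rewrite take_drop; congr (drop _ (take _ _)); lia.
rewrite t1 in f1; rewrite t2 in f2; rewrite /link_ok f1 f2 /=.
have n1 : map (nth x0 s) (iota 0 k) = take k s.
  by rewrite map_nth_iota ?drop0 //; lia.
have n2 : map (nth x0 s) (iota k k) = take k (drop k s).
  by rewrite map_nth_iota //; rewrite ss; lia.
rewrite n1 n2 (fwd_edge n0 sS _ (asboolW f1)); last by rewrite size_takel //; lia.
rewrite (bwd_edge n0 sT _ (asboolW f2)); last by rewrite size_takel // size_drop; lia.
apply/and3P; split=> //; apply/allP => K /mapP[i iK ->]; move: iK; rewrite mem_iota => ik.
have := hw i; rewrite mem_iota size_drop ss => /(_ ltac:(lia)).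
move=> hwi; rewrite (_ : map _ _ = rcons (A (take (2 * k) s) i) (nth x0 (drop (2 * k) s) i)) //.
rewrite /A /link_set catA map_cat cats1 nth_drop; congr (rcons _ _).
apply/eq_in_map => j; rewrite mem_cat !mem_iota => hj.
by rewrite nth_take //; clear -hj ik hl hd; lia.
Qed.

End Link.

(** Trace the link word in a blown-up [link_ok] tuple. Its first and last windows belong to
    transversals of the block, so they inherit [fwd] and [bwd], and paddings attach them to [S] and
    [T]. *)
Lemma connecting mu : exists q C n0, forall (V : finType) (E : {set {set V}}),
  codense mu E -> n0 <= #|V| -> forall S T : seq V,
  size S = l -> size T = l -> uniq S -> uniq T ->
  dense C q (fun W => `[< connector E S T W >]).
Proof.
have [m [w [sw Ew [w' sw' ww']]]] := link_word.
set X := iota 0 k in ww' Ew *; set Y := iota k k in ww' *.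
pose q0 := d.-1 * l; pose C0 := 2 * (2 * mu) ^ (q0 + k).
pose N := 2 * k + k.-1; pose t := k + m * d.
pose C1 := 2 * (C0 * C0) * mu ^ k.-1.
have [C2 hC2] := blow_dense t N C1.
pose C3 := 2 * C2; pose qb := N * t.+1.
pose C4 := C3 * (C0 * C0); pose q := qb + (q0 + q0).
exists q, (2 * C4), (maxn k (maxn (2 * mu * (l + (q0 + k)))
  (maxn (2 * (C0 * C0) * ((k + k) * (k + k))) (maxn (2 * C2 * (qb * qb)) (2 * C4 * (q * q)))))).
move=> V E hE; rewrite !geq_max => /and5P[h1 h2 h3 h4 h5] S T sS sT uS uT.
have n0 : 0 < #|V| by apply: leq_trans h1; clear -hl; lia.
have /card_gt0P[x0 _] := n0.
have hL := link_ok_dense x0 hE sS sT uS uT h1 h2 h3.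
have hB := hC2 _ _ n0 hL.
have := @dense_uniq _ _ _ _ [::] n0 _ hB; rewrite /= addn0 => /(_ h4) {}hB.
pose z := occs [::] (X ++ w).
have zX : map fst z = X ++ w by exact: occs_fst.
have sX : size X = k by exact: size_iota.
have sz : size z = k + m * d by rewrite -(size_map fst) zX size_cat sX sw.
pose pth b := map (vtx x0 t.+1 b) z.
have hG := link_chain_good.
have zb : all (fun p => (p.1 < N) && (p.2 < t.+1)) z.
  apply/allP => p pz; have := occs_bound pz.
  rewrite /= add0n size_cat sX sw ltnS => /ltnW ->; rewrite andbT.
  have : p.1 \in X ++ w by rewrite -zX map_f.
  by apply/allP: p.1; apply: (epath_letters hG _ Ew); rewrite size_cat sX sw.
have uz : uniq z by exact: occs_uniq.
have pth_ok b : size b = qb -> blow t.+1 N (link_ok E x0 mu S T) b -> uniq b ->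
    [/\ epath l d (edge E) (pth b), fwd E mu S (take k (pth b)),
        bwd E mu T (drop (m * d) (pth b)) & uniq (pth b) /\ {subset pth b <= b}].
  move=> sb hb ub; split.
  - apply: (blow_epath (x0 := x0) (Q := link_ok E x0 mu S T) hG) hb _ _ => //.
    + by move=> s _ /and3P[].
    + by apply/allP => p /(allP zb) /andP[].
    + by rewrite zX.
  - have [|||s [ss /and3P[/asboolP hs _ _] sE]] := blow_transversal x0 (zz := take k z) sb hb.
    + by rewrite map_take zX take_size_cat // iota_uniq.
    + by [].
    + by apply/allP => p /mem_take /(allP zb).
    have <- : take k s = take k (pth b) => //.
    rewrite -map_take; transitivity (map (nth x0 s) X).
      by rewrite /X map_nth_iota ?drop0 // ss /N; clear; lia.
    rewrite -(_ : map fst (take k z) = X); last by rewrite map_take zX take_size_cat.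
    by rewrite -map_comp; apply/eq_in_map => p pz /=; rewrite sE.
  - have [|||s [ss /and3P[_ /asboolP hs _] sE]] := blow_transversal x0 (zz := drop (m * d) z) sb hb.
    + by rewrite map_drop zX ww' drop_size_cat // iota_uniq.
    + by [].
    + by apply/allP => p /mem_drop /(allP zb).
    have <- : take k (drop k s) = drop (m * d) (pth b) => //.
    rewrite -map_drop; transitivity (map (nth x0 s) Y).
      by rewrite /Y map_nth_iota // ss /N; clear; lia.
    rewrite -(_ : map fst (drop (m * d) z) = Y); last by rewrite map_drop zX ww' drop_size_cat.
    by rewrite -map_comp; apply/eq_in_map => p pz /=; rewrite sE.
  - split; first by apply: map_vtx_uniq ub sb zb uz.
    by move=> _ /mapP[p /(allP zb)/andP[p1 p2] ->]; apply: vtx_mem sb p1 p2.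
pose P2 b z := [&& `[< epath l d (edge E) (S ++ take q0 z ++ take k (pth b)) >]
   & `[< epath l d (edge E) (drop (m * d) (pth b) ++ drop q0 z ++ T) >]].
have hW : dense C4 q (fun W => [&& blow t.+1 N (link_ok E x0 mu S T) (take qb W),
     uniq (take qb W) & P2 (take qb W) (drop qb W)]).
  have := @dense_comp _ _ (C0 * C0) qb (q0 + q0) _ P2 hB.
  move=> /(_ _)/(dense_le (leqnn _)); apply; last first.
    move=> b sb /and3P[hb ub _]; have [_ f1 f2 _] := pth_ok b sb hb ub.
    exact: (dense_comp f1 (fun _ _ _ => f2)).
  by move=> W _ /andP[/and3P[-> -> _] ->].
have := @dense_uniq _ _ _ _ [::] n0 _ hW; rewrite /= addn0 => /(_ h5).
apply: dense_le => // W sW /and3P[/and3P[hb ub /andP[/asboolP e1 /asboolP e2]] uW _].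
have sb : size (take qb W) = qb by rewrite size_takel // sW leq_addr.
have [e3 _ _ [up sp]] := pth_ok _ sb hb ub.
move: e1 e2 e3 up sp; set c := pth _; set z1 := take q0 _; set z2 := drop q0 _ => e1 e2 e3 up sp.
have sc : size c = k + m * d by rewrite size_map sz.
have sdW : size (drop qb W) = q0 + q0 by rewrite size_drop sW addKn.
have sz1 : size z1 = q0 by rewrite size_takel // sdW leq_addr.
have sz2 : size z2 = q0 by rewrite size_drop sdW addKn.
have eW : W = take qb W ++ z1 ++ z2 by rewrite !cat_take_drop.
have lq0 : l + q0 = l * d by rewrite /q0 -mulSn prednK 1?mulnC //; clear -hd; lia.
apply/asboolP; exists (z1 ++ c ++ z2); split.
- move=> x; rewrite eW !mem_cat => /or3P[->|/sp ->|->] //; rewrite ?orbT //.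
- rewrite (perm_uniq (_ : perm_eq _ (c ++ z1 ++ z2))); last by rewrite perm_catCA.
  rewrite eW cat_uniq in uW; have /and3P[_ uW1 uW2] := uW.
  rewrite cat_uniq up uW2 andbT /=; apply: contra uW1 => /hasP[x xz xc].
  by apply/hasP; exists x => //; apply: sp.
- rewrite !size_cat sz1 sz2 sc addnA lq0 dvdn_addr ?dvdn_mull //.
  have -> : k + m * d + q0 = d + m * d + (l + q0) by clear; lia.
  by rewrite lq0 !dvdn_addr ?dvdn_mull.
have e4 : epath l d (edge E) ((S ++ z1) ++ c).
  rewrite -[c](cat_take_drop k); apply: epath_cat.
  - by clear -hd; lia.
  - by rewrite size_cat sS sz1 lq0 dvdn_mull.
  - by rewrite size_takel ?sc; clear; lia.
  - by rewrite -catA.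
  - by rewrite cat_take_drop.
have e5 : epath l d (edge E) (((S ++ z1) ++ take (m * d) c) ++ drop (m * d) c ++ (z2 ++ T)).
  apply: epath_cat.
  - by clear -hd; lia.
  - rewrite !size_cat sS sz1 lq0 size_takel; last by rewrite sc; clear; lia.
    by rewrite dvdn_addr ?dvdn_mull.
  - by rewrite size_drop sc; clear; lia.
  - by rewrite -[X in epath _ _ _ X]catA cat_take_drop.
  - exact: e2.
by move: e5; rewrite -!catA (catA (take _ c)) cat_take_drop.
Qed.

End Graph.

(** * Exchange gadgets and absorbers *)

Section Reindex.
Variables (V : finType) (x0 : V).

Lemma msum_tuple q (f : seq V -> nat) : msum q f = \sum_(t : q.-tuple V) f t.
Proof.
elim: q f => [|q IH] f /=.
  by rewrite (bigD1 [tuple]) //= big1 ?addn0 // => t; rewrite (tuple0 t).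
transitivity (\sum_(p : V * q.-tuple V) f (p.1 :: p.2)).
  by rewrite -(pair_bigA _ (fun v (t : q.-tuple V) => f (v :: t))) /=; apply: eq_bigr => v _; rewrite IH.
rewrite (reindex (fun p : V * q.-tuple V => [tuple of p.1 :: p.2])) //=.
exists (fun t : q.+1.-tuple V => (thead t, [tuple of behead t])).
  by move=> [v t] _; congr pair; apply: val_inj.
by move=> t _; apply: val_inj => /=; rewrite [in RHS](tuple_eta t).
Qed.

Lemma msum_perm q (f : seq V -> nat) s : perm_eq s (iota 0 q) ->
  msum q f = msum q (fun t => f (map (nth x0 t) s)).
Proof.
move=> ps; rewrite !msum_tuple.
have ss : size s = q by rewrite (perm_size ps) size_iota.
have hs (t : q.-tuple V) : size (map (nth x0 t) s) == q by rewrite size_map ss.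
rewrite (reindex_inj (h := fun t : q.-tuple V => Tuple (hs t))) //.
move=> t t' [] /eq_in_map e; apply: val_inj; apply: (@eq_from_nth _ x0).
  by rewrite !size_tuple.
by move=> i; rewrite size_tuple => iq; apply: e; rewrite (perm_mem ps) mem_iota.
Qed.

(** A subtuple extends to at most [n ^ (q - size idx)] tuples, so keeping only the coordinates
    [idx], in any order, preserves the constant. *)
Lemma dense_proj C q (P P' : pred (seq V)) (idx : seq nat) : 0 < #|V| ->
  uniq idx -> all (fun i => i < q) idx ->
  (forall b, size b = q -> P' b -> P (map (nth x0 b) idx)) ->
  dense C q P' -> dense C (size idx) P.
Proof.
move=> n0 ui /allP iq PP; rewrite /dense => h.
pose s := idx ++ [seq i <- iota 0 q | i \notin idx].
have ps : perm_eq s (iota 0 q).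
  apply: uniq_perm; rewrite ?iota_uniq //.
    rewrite cat_uniq ui filter_uniq ?iota_uniq // andbT /=.
    by apply/hasPn => i; rewrite mem_filter => /andP[].
  move=> i; rewrite mem_cat mem_filter mem_iota /= add0n.
  by case: (boolP (i \in idx)) => //= /iq ->.
have sq : q = size idx + (q - size idx).
  by rewrite subnKC // -[q in X in _ <= X](size_iota 0) -(perm_size ps) size_cat leq_addr.
have : cnt q P' <= msum q (fun t => P (take (size idx) t)).
  rewrite (msum_perm _ ps) /cnt; apply: leq_msum => b sb.
  rewrite -map_take take_size_cat //.
  by have := PP b sb; case: (P' b) => // /(_ isT) ->.
have -> : msum q (fun t => P (take (size idx) t)) = #|V| ^ (q - size idx) * cnt (size idx) P.
  rewrite {1}sq msum_cat /cnt -msumM; apply: eq_msum => t st.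
  rewrite mulnC -msum_const; apply: eq_msum => u _.
  by rewrite -st take_size_cat.
move=> h2; have := leq_trans h (leq_mul (leqnn C) h2).
rewrite {1}sq expnD mulnCA mulnC leq_pmul2l //.
by rewrite expn_gt0 n0.
Qed.

End Reindex.

(** Lets a supply of labelled letters be reordered so as to spell a given word. *)
Lemma perm_lift (A : seq (nat * nat)) w : perm_eq (map fst A) w ->
  exists2 z, perm_eq z A & map fst z = w.
Proof.
elim: w A => [|x w IH] A.
  by move/perm_nilP => /(congr1 size); rewrite size_map => /size0nil ->; exists [::].
move=> pA; have : x \in map fst A by rewrite (perm_mem pA) mem_head.
case/mapP => p pin xE; have pA' := perm_to_rem pin.
have [|z zA zw] := IH (rem p A).
  by rewrite -(perm_cons x) -(permPr pA) xE -[p.1 :: _]/(map fst (p :: rem p A)) perm_map // perm_sym.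
exists (p :: z); last by rewrite /= zw xE.
by rewrite perm_sym (perm_trans pA') // perm_cons perm_sym.
Qed.

Lemma relabel_iota m : 2 <= m ->
  map (fun i => if i is i'.+2 then 2 * m + i' else if i == 1 then m.-1 else 2 * m - 1) (iota 0 m)
  = 2 * m - 1 :: m.-1 :: iota (2 * m) (m - 2).
Proof.
case: m => [|[|m]] // _; rewrite [iota 0 _]/= !map_cons -[iota 2 m]/(iota (2 + 0) m) iotaDl -map_comp.
have -> : m.+2 - 2 = m by rewrite !subSS subn0.
have -> : iota (2 * m.+2) m = map (addn (2 * m.+2)) (iota 0 m) by rewrite -iotaDl addn0.
by congr [:: _, _ & _]; apply: eq_map.
Qed.

Section Exchange.
Variables (l d s1 r : nat).
Hypotheses (hl : 0 < l) (hd : 2 <= d) (s1_gt0 : 0 < s1).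
Hypotheses (kE : l + d = s1 * d + r) (r0 : 0 < r < d).
Local Notation k := (l + d).

Section EdgeExt.
Variables (V : finType) (E : {set {set V}}) (mu : nat).
Hypothesis hE : codense l d mu E.

(** Fill [B] up to [k.-1] distinct vertices arbitrarily, then use the codegree for the last one. *)
Lemma edge_ext (B : seq V) : uniq B -> size B < k -> 2 * k <= #|V| ->
  dense (2 ^ k * mu) (k - size B) (fun v => edge E (B ++ v)).
Proof.
move=> uB sB hV; have n0 : 0 < #|V| by lia.
have h1 : dense (2 ^ k) (k - (size B).+1) (fun v => uniq (B ++ v)).
  apply: (@dense_le _ (2 ^ (k - (size B).+1)) _ _ (fun v => uniq (B ++ v))) => //.
    by rewrite leq_exp2l // leq_subr.
  apply: dense_greedy; first by rewrite cats0.
  move=> s ss us; set Y := #|_|.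
  suff : #|V| <= Y + k by move: ss; lia.
  have cl : #|[pred v | v \in B ++ s]| <= k.
    by apply: leq_trans (card_size _) _; rewrite size_cat; lia.
  apply: leq_trans (leq_add (leqnn _) cl).
  rewrite -cardUI; apply: leq_trans (leq_addr _ _); apply: subset_leq_card.
  apply/subsetP => v _; rewrite !inE -rcons_cat rcons_uniq us andbT.
  exact: orNb.
have [_ hc] := hE.
have := @dense_comp _ _ mu _ 1 _ (fun s v => edge E ((B ++ s) ++ v)) h1.
have -> : k - (size B).+1 + 1 = k - size B by lia.
move=> /(_ _)/(dense_le (leqnn _)); apply; last first.
  move=> s ss us; rewrite /dense cnt1 expn1.
  have := hc (B ++ s) us; rewrite size_cat ss => /(_ ltac:(lia)) h.
  apply: leq_trans h _; rewrite leq_mul2l; apply/orP; right.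
  by apply: subset_leq_card; apply/subsetP => v; rewrite !inE cats1.
by move=> s ss /andP[_]; rewrite -catA cat_take_drop.
Qed.

Definition pathlike (p : seq V) := [/\ l <= size p, d %| size p - l & epath l d (edge E) p].
Definition ends (p : seq V) := (take l p, drop (size p - l) p).
(** The two paths may differ in length: only their ends matter for the neighbouring connections. *)
Definition swap (p p' : seq V) := [/\ pathlike p, pathlike p' & ends p = ends p'].

Lemma ends_cat (a m m' c : seq V) : l <= size a -> l <= size c ->
  ends (a ++ m ++ c) = ends (a ++ m' ++ c).
Proof.
move=> la lc; rewrite /ends !takel_cat // !catA; congr pair.
have key (X : seq V) : drop (size (X ++ c) - l) (X ++ c) = drop (size c - l) c.
  rewrite drop_cat size_cat ltnNge -addnBA // leq_addr /=; congr drop.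
  by rewrite addKn.
by rewrite !key.
Qed.

Variable x0 : V.

(** Letters below [N] stand for parts of the block, those from [N] on for the prescribed vertices
    [xs], which have a single copy. *)
Definition vtxe N t (b xs : seq V) (p : nat * nat) :=
  if p.1 < N then vtx x0 t b p else nth x0 xs (p.1 - N).

Lemma blow_epath_ext t N KS (Q : pred (seq V)) (b xs : seq V) (z : seq (nat * nat)) :
  KSgood l d (N + size xs) KS -> 0 < t ->
  (forall s, size s = N -> Q s -> all (fun K => edge E (map (nth x0 (s ++ xs)) K)) KS) ->
  size b = N * t -> blow t N Q b -> all (fun p => p.2 < t) z ->
  epath l d (inKS KS) (map fst z) -> epath l d (edge E) (map (vtxe N t b xs) z).
Proof.
move=> hKS t0 hQ sb hb /allP hz Ez j; rewrite size_map => hj.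
have := Ez j; rewrite size_map => /(_ hj) /hasP[K KK].
rewrite -map_drop -map_take -map_drop -map_take; set zz := take _ _ => pK.
have [uK sK /allP NK] := hKS K KK.
have zsub p : p \in zz -> p \in z by move/mem_take/mem_drop.
pose zf := [seq p <- zz | p.1 < N].
have zfN : all (fun p => (p.1 < N) && (p.2 < t)) zf.
  by apply/allP => p; rewrite mem_filter => /andP[-> /zsub /hz].
have uz : uniq (map fst zz) by rewrite -(perm_uniq pK).
have uzf : uniq (map fst zf) by apply: subseq_uniq uz; apply/map_subseq/filter_subseq.
have [s [ss Qs sE]] := blow_transversal x0 sb hb uzf t0 zfN.
have /allP/(_ K KK) := hQ s ss Qs.
rewrite (edge_perm _ (perm_map (nth x0 (s ++ xs)) pK)) -map_comp.
rewrite (_ : map _ zz = map (vtxe N t b xs) zz) //; apply/eq_in_map => p pz /=.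
rewrite /vtxe nth_cat ss; case: ifP => // pN.
by rewrite sE // mem_filter pN.
Qed.

End EdgeExt.

Definition ins T p (y : T) W := take p W ++ y :: drop p W.

(** [W] is a family of paths with one vertex missing at place [p]. Filled with [y], it can be
    rerouted, with all ends kept, so as to contain [x] in place of [y]. *)
Definition exch (V : finType) (E : {set {set V}}) sh p (x y : V) (W : seq V) : Prop :=
  exists ps', List.Forall2 (swap E) (reshape sh (ins p y W)) ps' /\
    perm_eq (flatten ps') (x :: W).

(** Congruent to [l] modulo [d], and large enough that position [2 * k - 1] is outside both ends of
    the path. *)
Local Notation L1 := (l + 3 * k * d).
Local Notation cpos c := (fun i => (c + i %% k, i %/ k)).

(* Position 2k - 1 of the cyclic word c, .., c + k - 1, c, .. (residue k - 1) is replaced by [p]. *)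
Definition cyc c (p : nat * nat) :=
  map (cpos c) (iota 0 (2 * k - 1)) ++ p :: map (cpos c) (iota (2 * k) (L1 - 2 * k)).

Lemma inKS_perm KS (w w' : seq nat) : perm_eq w w' -> inKS KS w -> inKS KS w'.
Proof. by move=> p /hasP[K hK pK]; apply/hasP; exists K => //; apply: perm_trans pK p. Qed.

Lemma perm_residues c b : perm_eq (map (fun i => c + i %% k) (iota b k)) (iota c k).
Proof.
have kp : 0 < k by lia.
have h := @perm_window l d (fun i => i %% k) b (fun x => ltn_pmod x kp).
rewrite (map_comp (addn c) (fun i => i %% k)) -[X in perm_eq _ (iota X _)]addn0 iotaDl.
apply: perm_map; rewrite perm_sym; apply: h => x y; rewrite !mem_iota => xb yb xy /eqP.
by apply/negP/modn_window_neq => //; move: xb yb; clear; lia.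
Qed.

Lemma L1_ge : 2 * k + l <= L1.
Proof.
have : 3 * k * 1 <= 3 * k * d by rewrite leq_mul2l; apply/orP; right; lia.
by rewrite muln1; lia.
Qed.

Lemma cyc_fst c p : map fst (cyc c p) =
  map (fun i => if i == 2 * k - 1 then p.1 else c + i %% k) (iota 0 L1).
Proof.
have h := L1_ge.
have -> : iota 0 L1 = iota 0 (2 * k - 1) ++ (2 * k - 1) :: iota (2 * k) (L1 - 2 * k).
  have -> : L1 = (2 * k - 1) + (1 + (L1 - 2 * k)) by lia.
  by rewrite !iotaD /= add0n; congr (_ ++ _ :: iota _ _); lia.
rewrite /cyc !map_cat /= eqxx -!map_comp; congr (_ ++ _ :: _); apply/eq_in_map => i;
  rewrite mem_iota => hi /=; case: eqP => // ei; lia.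
Qed.

(** A window meets every residue modulo [k] once. If it contains position [2 * k - 1], then the only
    change is that [p] stands for the letter [c + k.-1]. *)
Lemma cyc_epath KS c p : inKS KS (iota c k) -> inKS KS (p.1 :: iota c k.-1) ->
  epath l d (inKS KS) (map fst (cyc c p)).
Proof.
move=> h1 h2; rewrite cyc_fst => j; rewrite size_map size_iota => hj.
rewrite -map_drop drop_iota -map_take take_iota (minn_idPl _) ?add0n; last by lia.
have pr := perm_residues c (j * d).
case: (boolP (2 * k - 1 \in iota (j * d) k)) => hq; last first.
  rewrite (_ : map _ _ = map (fun i => c + i %% k) (iota (j * d) k)).
    by apply: inKS_perm h1; rewrite perm_sym.
  by apply/eq_in_map => i hi; case: eqP => // ei; move: hq; rewrite -ei hi.
have ui := iota_uniq (j * d) k.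
move: pr ui; case/splitPr: hq => A B pr ui; apply: inKS_perm h2.
rewrite map_cat /= eqxx.
have nA : map (fun i => if i == 2 * k - 1 then p.1 else c + i %% k) A = map (fun i => c + i %% k) A.
  apply/eq_in_map => i iA; case: eqP => // ei; move: ui; rewrite cat_uniq => /and3P[_ /negP[]].
  by rewrite /= -ei iA.
have nB : map (fun i => if i == 2 * k - 1 then p.1 else c + i %% k) B = map (fun i => c + i %% k) B.
  apply/eq_in_map => i iB; case: eqP => // ei; move: ui; rewrite cat_uniq /= => /and3P[_ _ /andP[/negP[]]].
  by rewrite -ei iB.
rewrite nA nB perm_sym -cat1s perm_catCA /= perm_cons -map_cat.
have e1 : (2 * k - 1) %% k = k.-1.
  have -> : 2 * k - 1 = 1 * k + k.-1 by lia.
  by rewrite modnMDl modn_small //; lia.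
rewrite -(perm_cons (c + k.-1)); rewrite map_cat /= e1 in pr.
rewrite (perm_trans (_ : perm_eq _ (iota c k))) //.
  rewrite -(permPr pr) map_cat; exact/permPl/(perm_catCA [:: c + k.-1]).
have -> : iota c k = iota c k.-1 ++ [:: c + k.-1].
  have e : k = k.-1 + 1 by clear -hl; lia.
  by rewrite {1}e iotaD.
by rewrite -[X in perm_eq _ X]cat1s perm_catC.
Qed.

Lemma cyc_full c : cyc c (c + k.-1, 1) = map (cpos c) (iota 0 L1).
Proof.
have h := L1_ge.
have -> : iota 0 L1 = iota 0 (2 * k - 1) ++ (2 * k - 1) :: iota (2 * k) (L1 - 2 * k).
  have -> : L1 = (2 * k - 1) + (1 + (L1 - 2 * k)) by lia.
  by rewrite !iotaD /= add0n; congr (_ ++ _ :: iota _ _); lia.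
rewrite map_cat /=; congr (_ ++ _ :: _).
have -> : 2 * k - 1 = 1 * k + k.-1 by lia.
by rewrite modnMDl divnMDl ?modn_small ?divn_small ?addn0 //; lia.
Qed.

Lemma size_cyc c p : size (cyc c p) = L1.
Proof. by have h := L1_ge; rewrite size_cat /= !size_map !size_iota; lia. Qed.

Lemma count_cyc c p (a : pred (nat * nat)) :
  count a (cyc c p) = a p + (count a (map (cpos c) (iota 0 (2 * k - 1))) +
    count a (map (cpos c) (iota (2 * k) (L1 - 2 * k)))).
Proof. by rewrite count_cat /=; lia. Qed.

Section ExchangeBoxes.
Variables (V : finType) (E : {set {set V}}) (x0 : V) (mu : nat).
Hypothesis hE : codense l d mu E.

(* Letters: z_i = i (i < k-1), u = k-1, z'_i = k+i (i < k-1), w = 2k-1, v_i = 2k+i (i < k-2),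
   x = 3k-2, y = 3k-1. *)
Definition exch_sets : seq (seq nat) :=
  [:: iota 0 k; iota k k; 2 * k - 1 :: k.-1 :: iota (2 * k) (k - 2);
      3 * k - 2 :: iota 0 k.-1; 3 * k - 1 :: iota k k.-1].

Lemma exch_sets_good : KSgood l d (3 * k - 2 + 2) exch_sets.
Proof.
have k3 : 3 <= k by lia.
move=> K; rewrite !inE; move: (l + d) k3 => k' k3 hK.
case/or4P: hK => [/eqP->|/eqP->|/eqP->|/orP[/eqP->|/eqP->]].
- by split; rewrite ?iota_uniq ?size_iota //; apply/allP => x; rewrite mem_iota; lia.
- by split; rewrite ?iota_uniq ?size_iota //; apply/allP => x; rewrite mem_iota; lia.
- split; rewrite /= ?iota_uniq ?size_iota ?inE ?mem_iota //; try lia.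
  by apply/andP; split; [lia|apply/andP; split; [lia|apply/allP => x; rewrite mem_iota; lia]].
- split; rewrite /= ?iota_uniq ?size_iota ?inE ?mem_iota //; try lia.
  by apply/andP; split; [lia|apply/allP => x; rewrite mem_iota; lia].
- split; rewrite /= ?iota_uniq ?size_iota ?inE ?mem_iota //; try lia.
  by apply/andP; split; [lia|apply/allP => x; rewrite mem_iota; lia].
Qed.

Definition exch_ok (x y : V) (s : seq V) :=
  all (fun K => edge E (map (nth x0 (s ++ [:: x; y])) K)) exch_sets.

Local Notation Ce := (2 ^ k * mu).

(** The first [k.-1] entries form an edge with [x] and also with the last entry, so [x] and the last
    entry can stand in for each other. *)
Lemma two_edges_dense x : 2 * k <= #|V| ->
  dense (Ce * Ce) k (fun s => edge E (x :: take k.-1 s) && edge E s).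
Proof.
move=> hV; have k3 : 3 <= k by lia.
have h1 := @edge_ext _ _ _ hE [:: x] isT (ltnW k3) hV.
have := @dense_comp _ _ Ce _ (k - k.-1) _ (fun z u => edge E (z ++ u)) h1.
have -> : k - size [:: x] + (k - k.-1) = k by rewrite /=; lia.
move=> /(_ _)/(dense_le (leqnn _)); apply; last first.
  move=> s ss es; have [hu _] := hE.
  have us : uniq (x :: s) by apply: edge_uniq hu _ es; rewrite /= ss /=; lia.
  have := @edge_ext _ _ _ hE s; have -> : size s = k.-1 by rewrite ss /=; lia.
  by apply=> //; [move/andP: us => [] | lia].
move=> s _ /=; have -> : k - 1 = k.-1 by lia.
by move=> /andP[-> ]; rewrite cat_take_drop.
Qed.

Lemma exch_ok_dense x y : 2 * k <= #|V| ->
  2 * (Ce * Ce * (Ce * Ce)) * ((k + k) * (k + k)) <= #|V| ->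
  dense (2 * (Ce * Ce * (Ce * Ce)) * Ce) (3 * k - 2) (exch_ok x y).
Proof.
move=> hV h2; have k3 : 3 <= k by lia.
have n0 : 0 < #|V| by lia.
have h12 := dense_comp (two_edges_dense x hV) (fun _ _ _ => two_edges_dense y hV).
have := @dense_uniq _ _ _ _ [::] n0 _ h12; rewrite /= addn0 => /(_ h2) {}h12; clear h2.
pose P2 s v := edge E ([:: nth x0 s (2 * k - 1); nth x0 s k.-1] ++ v).
have := @dense_comp _ _ Ce _ (k - 2) _ P2 h12.
have -> : k + k + (k - 2) = 3 * k - 2 by lia.
move=> /(_ _)/(dense_le (leqnn _)); apply; last first.
  move=> s ss /and3P[_ us _]; apply: (@edge_ext _ _ _ hE) => //=.
  by rewrite inE nth_uniq ?ss // ?andbT; lia.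
move=> s ss /andP[/and3P[/andP[/andP[a1 a2] /andP[a3 a4]] _ _] a5].
have sse : size (s ++ [:: x; y]) = 3 * k by rewrite size_cat ss /=; lia.
have e1 : map (nth x0 (s ++ [:: x; y])) (iota 0 k) = take k s.
  by rewrite map_nth_iota ?sse ?drop0 ?takel_cat // ?ss; lia.
have e2 : map (nth x0 (s ++ [:: x; y])) (iota k k) = take k (drop k s).
  rewrite map_nth_iota ?sse; last by lia.
  rewrite drop_cat ss ifT ?takel_cat // ?size_drop ?ss; lia.
have e3 : map (nth x0 (s ++ [:: x; y])) (iota (2 * k) (k - 2)) = drop (2 * k) s.
  rewrite map_nth_iota ?sse; last by lia.
  rewrite drop_cat ss; case: ltnP => hh; last by lia.
  rewrite take_size_cat // size_drop ss; lia.
have t1 : take k (take (k + k) s) = take k s by rewrite take_takel //; lia.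
have t2 : drop k (take (k + k) s) = take k (drop k s) by rewrite take_drop.
rewrite t1 in a1 a2; rewrite t2 in a3 a4; rewrite /P2 !nth_take in a5; try lia.
rewrite /exch_ok /exch_sets /= e1 e2 e3 a2 a4.
have nx : nth x0 (s ++ [:: x; y]) (3 * k - 2) = x by rewrite nth_cat ss ltnn subnn.
have ny : nth x0 (s ++ [:: x; y]) (3 * k - 1) = y.
  rewrite nth_cat ss ifF; last by lia.
  by have -> : 3 * k - 1 - (3 * k - 2) = 1 by lia.
rewrite nx ny !nth_cat ss !ifT; try lia.
have i1 : iota 0 k.-1 = take k.-1 (iota 0 k) by rewrite take_iota; congr iota; lia.
have i2 : iota k k.-1 = take k.-1 (iota k k) by rewrite take_iota; congr iota; lia.
rewrite i1 i2 !map_take e1 e2 a1 a3 /= andbT.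
by move: a5; rewrite mul2n -addnn.
Qed.

End ExchangeBoxes.

Lemma cpos_inj c : injective (cpos c).
Proof.
by move=> i j [/addnI h1 h2]; rewrite (divn_eq i k) (divn_eq j k) h1 h2.
Qed.

Lemma pathlike_map (V : finType) (E : {set {set V}}) (f : nat * nat -> V) z :
  epath l d (edge E) (map f z) -> l <= size z -> d %| size z - l ->
  pathlike E (map f z).
Proof. by split; rewrite ?size_map. Qed.

Lemma mem_cyc c p q : q \in cyc c p -> q = p \/ q \in map (cpos c) (iota 0 L1).
Proof.
have h := L1_ge; rewrite mem_cat inE => /or3P[/mapP[i hi ->]|/eqP->|/mapP[i hi ->]]; [right|by left|right];
  by apply: map_f; move: hi; rewrite !mem_iota; lia.
Qed.

Lemma ends_cyc (V : finType) (f : nat * nat -> V) c p p' :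
  ends (map f (cyc c p)) = ends (map f (cyc c p')).
Proof.
have h := L1_ge; rewrite /cyc !map_cat /= -[f p :: _]cat1s -[f p' :: _]cat1s.
by apply: ends_cat; rewrite !size_map size_iota; lia.
Qed.

Local Opaque cyc.

(** The gadget has three paths: one around the edge of the [z_i] and [u], one inside the edge of
    [w], [u] and the [v_i], one around the [z'_i] with [y] inserted. Bringing in [x] moves [u] from
    the first path to the second and [w] from the second to the third, which releases [y]. *)
Lemma exchange mu : exists q sh p C n0, [/\ sumn sh = q.+1, p <= q &
  forall (V : finType) (E : {set {set V}}), codense l d mu E -> n0 <= #|V| ->
  forall x y : V, dense C q (fun W => `[< exch E sh p x y W >])].
Proof.
have k3 : 3 <= k by lia.
have [u0 [m1 [m2 [v0 [du lu [sv dm] [ew1 ew2] pm]]]]] := exch_word hl hd s1_gt0 kE r0.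
(* The traded letters 0 and 1 of [exch_word] become [w] and [u]; the other letters become the
   [v_i]. *)
pose phi i := if i is i'.+2 then 2 * k + i' else if i == 1 then k.-1 else 2 * k - 1.
pose Tk := L1.
(* The shift by [Tk] keeps these copies apart from the copies used around the two outer edges. *)
pose F := [seq (p.1, p.2 + Tk) | p <- occs [::] (map phi (u0 ++ m1 ++ v0))].
have Fst : map fst F = map phi (u0 ++ m1 ++ v0).
  by rewrite -map_comp -[RHS](occs_fst [::]); apply: eq_map.
have sF : size F = size u0 + size m1 + k.
  by rewrite -(size_map fst) Fst size_map !size_cat sv addnA.
have uF : uniq F.
  rewrite map_inj_uniq ?occs_uniq // => [[a b]] [a' b'] /= [-> /eqP].
  by rewrite eqn_add2r => /eqP ->.
pose zu := take (size u0) F; pose zm0 := take (size m1) (drop (size u0) F).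
pose zv := drop (size m1) (drop (size u0) F).
have FE : F = zu ++ zm0 ++ zv by rewrite !cat_take_drop.
have fu : map fst zu = map phi u0 by rewrite map_take Fst map_cat take_size_cat ?size_map.
have fm0 : map fst zm0 = map phi m1.
  by rewrite map_take map_drop Fst !map_cat drop_size_cat ?take_size_cat ?size_map.
have fv : map fst zv = map phi v0.
  by rewrite !map_drop Fst !map_cat !drop_size_cat ?size_map.
pose pu := (k.-1, 1); pose pw := (2 * k - 1, 1).
have sm : size m2 = size m1 by move: (perm_size pm) => /= [].
(* One occurrence of [w] in the middle word is given the label [pw]: this is the vertex that later
   replaces [y] in the third path. *)
have [p0 p0in p0E] : exists2 p0, p0 \in zm0 & p0.1 = 2 * k - 1.
  have : 0 \in m1 by have := perm_mem pm 0; rewrite !inE eqxx.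
  move/(map_f phi); rewrite -fm0 => /mapP[p0 ? e]; exists p0 => //; by rewrite -e.
pose R := rem p0 zm0; have pR : perm_eq zm0 (p0 :: R) by exact: perm_to_rem.
have pR1 : perm_eq (map fst (pw :: R)) (map phi m1).
  by rewrite -fm0 perm_sym (perm_trans (perm_map fst pR)) //= p0E.
(* By the letter counts of [exch_word], the same supply with [pu] in place of [pw] spells the other
   middle word. *)
have pR2 : perm_eq (map fst (pu :: R)) (map phi m2).
  have := perm_map phi pm; rewrite /= => h; rewrite -(perm_cons (2 * k - 1)).
  rewrite perm_sym -(permPl h) perm_sym (perm_trans (_ : perm_eq _ (k.-1 :: map fst (pw :: R)))).
  - by [].
  - exact/permPl/(perm_catCA [:: 2 * k - 1] [:: k.-1]).
  - by rewrite perm_cons.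
have [zm1 pz1 fm1] := perm_lift pR1.
have [zm2 pz2 fm2] := perm_lift pR2.
pose mid1 := zu ++ zm1 ++ zv; pose mid2 := zu ++ zm2 ++ zv.
pose R3a := map (cpos k) (iota 0 (2 * k - 1)).
pose R3b := map (cpos k) (iota (2 * k) (L1 - 2 * k)).
pose P := cyc 0 pu ++ mid1 ++ (R3a ++ R3b).
pose N := 3 * k - 2; pose X := (N, 0); pose Y := (3 * k - 1, 0).
have pwE : pw = (k + k.-1, 1) by congr pair; clear -k3; lia.
have Lge := L1_ge.
(* Moving [pw] from the middle path into the gap of the third path turns [P] into two full cyclic
   words and the rest of the middle word, whose labels are easily seen to be distinct. *)
have P_perm : perm_eq (pw :: P) (pw :: (map (cpos 0) (iota 0 L1) ++ map (cpos k) (iota 0 L1)) ++ (zu ++ R ++ zv)).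
  rewrite -!cyc_full -pwE -/pu; apply/permP => a.
  have ca := count_cyc k pw a; rewrite -/R3a -/R3b in ca.
  rewrite /P; move: (cyc 0 pu) (cyc k pw) ca => A B ca.
  by rewrite /mid1 /= !count_cat ca (permP pz1) /=; clear; lia.
have uP : uniq P.
  move: P_perm; rewrite perm_cons => /perm_uniq ->; rewrite cat_uniq; apply/and3P; split.
  - rewrite cat_uniq !map_inj_uniq ?iota_uniq; try exact: cpos_inj.
    rewrite andbT /=; apply/hasPn => _ /mapP[i _ ->]; apply/mapP => -[j _ [e _]].
    have : j %% k < k by rewrite ltn_mod; clear -k3; lia.
    by move: e; clear; lia.
  - apply/hasPn => p pin; have {}pin : p \in F.
      rewrite FE !mem_cat; move: pin; rewrite !mem_cat => /or3P[->|/mem_rem ->|->] //; by rewrite ?orbT.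
    have Tp : Tk <= p.2 by case/mapP: pin => p' _ ->; exact: leq_addl.
    apply/negP; rewrite mem_cat => /orP[] /mapP[i]; rewrite mem_iota => ii pE;
      move: Tp; rewrite pE /= leqNgt => /negP; apply; rewrite add0n in ii;
      by apply: leq_ltn_trans (leq_div _ _) _; case/andP: ii.
  - have : uniq (p0 :: (zu ++ R ++ zv)).
      rewrite (perm_uniq (_ : perm_eq _ F)) // FE; apply/permP => a.
      by rewrite /= !count_cat (permP pR) /=; clear; lia.
    by case/andP.
pose tt := Tk + size F + L1.
have mod_lt i : i %% k < k by rewrite ltn_mod; clear -k3; lia.
have w_lt : all (fun x => x < k) (u0 ++ m1 ++ v0).
  have [m me] := dvdnP dm; have [m' me'] := dvdnP du.
  apply: (epath_letters hd (N := k) (KS := [:: iota 0 k]) (m := m' + m)).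
  - move=> K; rewrite inE => /eqP ->; split; rewrite ?iota_uniq ?size_iota //.
    by apply/allP => i; rewrite mem_iota.
  - by rewrite !size_cat sv me me' mulnDl; clear; lia.
  - by apply: epath_impl ew1 => w pw'; rewrite /inKS /= pw'.
have FN : all (fun p => (p.1 < N) && (p.2 < tt.+1)) F.
  apply/allP => p pF; apply/andP; split.
    have : p.1 \in map phi (u0 ++ m1 ++ v0) by rewrite -Fst map_f.
    case/mapP => i /(allP w_lt) ik ->; move: ik; rewrite /phi /N; clear -k3.
    by case: i => [|[|i]] /=; lia.
  case/mapP: pF => p' /occs_bound; rewrite /= add0n => h ->.
  have sFF : size F = size (map phi (u0 ++ m1 ++ v0)) by rewrite -Fst size_map.
  by rewrite /tt /= sFF; move: h; clear; lia.
have cN c i : c <= k -> i \in iota 0 L1 -> (c + i %% k < N) && (i %/ k < tt.+1).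
  move=> ck; rewrite mem_iota => /andP[_ iL]; apply/andP; split.
    by have := mod_lt i; rewrite /N; move: ck; clear -k3; lia.
  by have := leq_div i k; rewrite /tt; move: iL; clear; lia.
have PN : all (fun p => (p.1 < N) && (p.2 < tt.+1)) P.
  apply/allP => p; have pE : p \in P -> p \in pw :: P by rewrite inE orbC => ->.
  have := perm_mem P_perm; move: P_perm; rewrite perm_cons => /perm_mem -> _.
  rewrite !mem_cat => /orP[/orP[]|].
  - by case/mapP => i iL ->; apply: cN.
  - by case/mapP => i iL ->; apply: cN.
  - by move=> h; apply: (allP FN); rewrite FE !mem_cat; case/or3P: h => [->|/mem_rem ->|->]; rewrite ?orbT.
have Pcopy : all (fun p => p.2 < tt.+1) P by apply/allP => p /(allP PN)/andP[].
pose idx := map (fun p => p.1 * tt.+1 + p.2) P.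
pose Ce := 2 ^ k * mu.
have [Cb hCb] := blow_dense tt N (2 * (Ce * Ce * (Ce * Ce)) * Ce).
pose sh := [:: L1; size mid1; L1]; pose pp := L1 + (size mid1 + (2 * k - 1)).
have sP : size P = L1 + (size mid1 + (L1 - 1)).
  rewrite /P size_cat (size_cyc 0 pu) size_cat; congr (_ + (_ + _)).
  by rewrite size_cat !size_map !size_iota; move: Lge; clear -k3; lia.
exists (size idx), sh, pp, Cb, (maxn (2 * k) (2 * (Ce * Ce * (Ce * Ce)) * ((k + k) * (k + k)))).
rewrite size_map; split.
- by rewrite sP /sh /=; move: Lge; clear -k3; lia.
- by rewrite sP /pp; move: Lge; clear -k3; lia.
move=> V E hE; rewrite geq_max => /andP[h1 h2] x y.
have n0 : 0 < #|V| by move: h1; clear -k3; lia.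
have /card_gt0P[x0 _] := n0.
have hB := hCb _ _ n0 (exch_ok_dense x0 hE x y h1 h2).
rewrite -(size_map (fun p => p.1 * tt.+1 + p.2) P).
apply: (dense_proj (x0 := x0) n0 _ _ _ hB).
- rewrite map_inj_in_uniq // => -[i m] [i' m'] /(allP PN)/andP[/= _ mt] /(allP PN)/andP[/= _ mt'] e.
  have t0 : 0 < tt.+1 by [].
  have := congr1 (fun x => x %/ tt.+1) e; rewrite !divnMDl // !divn_small // !addn0 => ->.
  by have := congr1 (fun x => x %% tt.+1) e; rewrite !modnMDl !modn_small // => ->.
- apply/allP => _ /mapP[p /(allP PN)/andP[p1 p2] ->].
  have : p.1.+1 * tt.+1 <= N * tt.+1 by rewrite leq_mul2r p1 orbT.
  by apply: leq_trans; rewrite mulSn addnC ltn_add2r.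
move=> b sb hb; apply/asboolP.
pose f := vtxe x0 N tt.+1 b [:: x; y].
have fP : map (nth x0 b) idx = map f P.
  by rewrite -map_comp; apply/eq_in_map => p /(allP PN)/andP[p1 _]; rewrite /f /vtxe p1.
have fX : f X = x by rewrite /f /vtxe ltnn subnn.
have fY : f Y = y.
  rewrite /f /vtxe /Y /N [_.1]/= ifF; last by clear -k3; lia.
  by have -> : 3 * k - 1 - (3 * k - 2) = 1 by clear -k3; lia.
have EP z : all (fun p => p.2 < tt.+1) z -> epath l d (inKS exch_sets) (map fst z) ->
    epath l d (edge E) (map f z).
  move=> hz Ez; apply: (blow_epath_ext (N := N) (xs := [:: x; y]) (Q := exch_ok E x0 x y) exch_sets_good) hz Ez => //.
have hcyc c p : c <= k -> p.2 < tt.+1 -> all (fun p => p.2 < tt.+1) (cyc c p).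
  move=> ck p2; apply/allP => q /mem_cyc[-> //|/mapP[i hi ->] /=].
  by have /andP[] := cN c i ck hi.
have k1E c : iota c k = iota c k.-1 ++ [:: c + k.-1].
  have e : k = k.-1 + 1 by clear -k3; lia.
  by rewrite {1}e iotaD.
have K1 : inKS exch_sets (iota 0 k) by rewrite /inKS /= perm_refl.
have K2 : inKS exch_sets (iota k k) by rewrite /inKS /= perm_refl !orbT.
have pc (V' : finType) (E' : {set {set V'}}) (g : nat * nat -> V') c p :
    epath l d (edge E') (map g (cyc c p)) -> pathlike E' (map g (cyc c p)).
  move=> h; apply: pathlike_map => //; rewrite size_cyc; first exact: leq_addr.
  by rewrite addKn dvdn_mull.
have tt1 : 1 < tt.+1 by rewrite /tt ltnS; move: Lge; clear -k3; lia.
have E1 : pathlike E (map f (cyc 0 pu)).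
  apply: pc; apply: EP; first by apply: hcyc => //; exact: tt1.
  by apply: cyc_epath => //; apply: inKS_perm K1; rewrite k1E add0n perm_catC.
have E1' : pathlike E (map f (cyc 0 X)).
  apply: pc; apply: EP; first exact: hcyc.
  by apply: cyc_epath => //; rewrite /inKS /= perm_refl !orbT.
have E3' : pathlike E (map f (cyc k pw)).
  apply: pc; apply: EP; first by apply: hcyc => //; exact: tt1.
  apply: cyc_epath => //; apply: inKS_perm K2; rewrite k1E pwE /= ; exact/permPl/perm_catC.
have E3 : pathlike E (map f (cyc k Y)).
  apply: pc; apply: EP; first exact: hcyc.
  by apply: cyc_epath => //; rewrite /inKS /= perm_refl !orbT.
have phiK : map phi (iota 0 k) = 2 * k - 1 :: k.-1 :: iota (2 * k) (k - 2).
  by apply: relabel_iota; clear -k3; lia.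
have Emap w : epath l d (perm_eq (iota 0 k)) w -> epath l d (inKS exch_sets) (map phi w).
  move=> Ew j; rewrite size_map => /Ew; rewrite -map_drop -map_take => h.
  rewrite /inKS /= -phiK; rewrite (perm_map phi h) !orbT //.
have smid : size mid1 = l + (size u0 + size m1 + d).
  rewrite -(size_map fst) !map_cat fu fm1 fv !size_cat !size_map sv; clear; lia.
have sm12 : size mid2 = size mid1.
  by rewrite -(size_map fst) -(size_map fst mid1) !map_cat fu fm1 fm2 fv !size_cat !size_map sm.
have pm' z : size z = size mid1 -> epath l d (edge E) (map f z) -> pathlike E (map f z).
  move=> sz h; apply: pathlike_map => //; rewrite sz smid ?leq_addr // addKn.
  by rewrite !dvdn_addr.
have midP p : p \in mid1 -> p \in P.
  by move=> h; rewrite /P mem_cat; apply/orP; right; rewrite mem_cat h.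
have E2 : pathlike E (map f mid1).
  apply: pm' => //; apply: EP.
    by apply/allP => p pin; apply: (allP Pcopy); apply: midP.
  by rewrite !map_cat fu fm1 fv -!map_cat; exact: Emap.
have E2' : pathlike E (map f mid2).
  apply: pm' => //; apply: EP.
    apply/allP => p; rewrite /mid2 !mem_cat => /or3P[pin|pin|pin].
    - by apply: (allP Pcopy); apply: midP; rewrite /mid1 !mem_cat pin ?orbT.
    - have : p \in pu :: R by rewrite -(perm_mem pz2).
      rewrite inE => /orP[/eqP-> //|/mem_rem pin'].
      have /andP[] // : (p.1 < N) && (p.2 < tt.+1).
      by apply: (allP FN); rewrite FE !mem_cat pin' orbT.
    - by apply: (allP Pcopy); apply: midP; rewrite /mid1 !mem_cat pin ?orbT.
  by rewrite !map_cat fu fm2 fv -!map_cat; exact: Emap.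
have insE : ins pp y (map f P) = flatten [:: map f (cyc 0 pu); map f mid1; map f (cyc k Y)].
  have PE : P = (cyc 0 pu ++ mid1 ++ R3a) ++ R3b by rewrite /P -!catA.
  have sA : size (map f (cyc 0 pu ++ mid1 ++ R3a)) = pp.
    by rewrite size_map size_cat (size_cyc 0 pu) size_cat size_map size_iota.
  rewrite PE map_cat /ins -sA take_size_cat // drop_size_cat //= cats0 !map_cat /= fY.
  by rewrite -!catA.
exists [:: map f (cyc 0 X); map f mid2; map f (cyc k pw)]; split.
  rewrite fP insE.
  have -> : sh = shape [:: map f (cyc 0 pu); map f mid1; map f (cyc k Y)].
    by rewrite /sh /shape /= !size_map !size_cyc.
  rewrite flattenK.
  constructor; first by split=> //; exact: ends_cyc.
  constructor; last by do 2?constructor=> //; exact: ends_cyc.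
  split=> //; rewrite /mid1 /mid2 !map_cat; apply: ends_cat.
    by rewrite size_map -(size_map fst) fu size_map.
  by rewrite size_map -(size_map fst) fv size_map sv leq_addr.
have -> : x :: map (nth x0 b) idx = map f (X :: P) by rewrite fP /= fX.
have -> : flatten [:: map f (cyc 0 X); map f mid2; map f (cyc k pw)] =
    map f (cyc 0 X ++ mid2 ++ cyc k pw).
  by rewrite /= cats0 (map_cat f (cyc 0 X)) (map_cat f mid2).
apply: perm_map.
apply/permP => a; have ca := count_cyc k pw a; rewrite -/R3a -/R3b in ca.
have cX := count_cyc 0 X a; have cu := count_cyc 0 pu a.
rewrite /P; move: (cyc 0 pu) (cyc 0 X) (cyc k pw) ca cX cu => A B C ca cX cu.
rewrite /= /mid1 /mid2 !count_cat ca cX cu (permP pz1) (permP pz2) /=.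
by clear; lia.
Qed.

End Exchange.

(** * Absorbers: a base path combined with exchange gadgets *)

Section Absorber.
Variables (l d s1 r : nat).
Hypotheses (hl : 0 < l) (hd : 2 <= d) (hkd : ~~ (d %| l + d)) (s1_gt0 : 0 < s1).
Hypotheses (kE : l + d = s1 * d + r) (r0 : 0 < r < d).
Local Notation k := (l + d).

Definition absorbs (V : finType) (E : {set {set V}}) sh (D W : seq V) : Prop :=
  exists ps', List.Forall2 (swap l d E) (reshape sh W) ps' /\
    perm_eq (flatten ps') (W ++ D).

Lemma perm_ins (T : eqType) p (y : T) W : perm_eq (ins p y W) (y :: W).
Proof. by rewrite /ins -cat1s perm_catCA /= perm_cons cat_take_drop. Qed.

(** Both words return to the initial arrangement of the edge. The first idles around it; the second
    makes one rotation more and is led back by [box_conn], hence is longer by one block. *)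
Lemma box_two_words : exists cA cB : seq nat, exists mA : nat,
  [/\ size cB = size cA + d,
      epath l d (perm_eq (iota 0 k)) (iota 0 k ++ cA ++ iota 0 k),
      epath l d (perm_eq (iota 0 k)) (iota 0 k ++ cB ++ iota 0 k)
    & size cA + k = mA * d].
Proof.
have sK : size (iota 0 k) = k by exact: size_iota.
have dp : 0 < d by lia.
set u := iota 0 k in sK *.
have Au : perm_eq u u by [].
have Ar : perm_eq u (rot d u) by rewrite perm_sym; apply/permPl/perm_rot.
have [M hM] := box_conn sK hl hd hkd Ar Au.
have h1 := conn_idle sK hl hd hkd M.+1 Au.
have h2 := conn_trans dp _ (conn_rot sK hl hd hkd 1 Au) (hM M.+1 (leqnSn M)).
have {}h2 := h2 ltac:(by rewrite size_rot).
have split m w : size w = m * d -> k <= m * d -> epath l d (perm_eq u) (u ++ w) ->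
    (exists2 w', size w' = m * d & u ++ w = w' ++ u) ->
    exists c, size c + k = m * d /\ epath l d (perm_eq u) (u ++ c ++ u).
  move=> sw km Ew [w' sw' e]; exists (take (m * d - k) w); split.
    by rewrite size_takel ?sw ?leq_subr // subnK.
  suff <- : w = take (m * d - k) w ++ u by [].
  rewrite -[LHS](cat_take_drop (m * d - k)); congr (_ ++ _).
  have : drop (m * d) (u ++ w) = u by rewrite e -sw' drop_size_cat.
  by rewrite drop_cat sK ltnNge km.
have [wA [sA EA hA]] := h1; have [wB [sB EB hB]] := h2.
have km : k <= M.+1 * k * d by rewrite mulSn mulnDl; apply: leq_trans (leq_addr _ _); rewrite leq_pmulr.
have [cA [scA ecA]] := split _ _ sA km EA hA.
have [cB [scB ecB]] := split _ _ sB ltac:(by rewrite mulnDl; lia) EB hB.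
exists cA, cB, (M.+1 * k); split=> //; move: scA scB; rewrite mulnDl; lia.
Qed.

Lemma dense_pairs (V : finType) (x0 : V) t N C (Q R : pred (seq V)) (P : seq (nat * nat)) :
  0 < #|V| -> uniq P -> all (fun p => (p.1 < N) && (p.2 < t)) P ->
  dense C (N * t) (blow t N Q) ->
  (forall b, size b = N * t -> blow t N Q b -> R (map (vtx x0 t b) P)) ->
  dense C (size P) R.
Proof.
move=> n0 uP /allP PN hB hR; rewrite -(size_map (fun p => p.1 * t + p.2) P).
apply: (dense_proj (x0 := x0) n0 _ _ _ hB).
- rewrite map_inj_in_uniq // => -[i m] [i' m'] /PN/andP[/= _ mt] /PN/andP[/= _ mt'] e.
  have t0 : 0 < t by lia.
  have := congr1 (fun x => x %/ t) e; rewrite !divnMDl // !divn_small // !addn0 => ->.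
  by have := congr1 (fun x => x %% t) e; rewrite !modnMDl !modn_small // => ->.
- apply/allP => _ /mapP[p /PN/andP[p1 p2] ->].
  have : p.1.+1 * t <= N * t by rewrite leq_mul2r p1 orbT.
  by apply: leq_trans; rewrite mulSn addnC ltn_add2r.
by move=> b sb hb; rewrite -map_comp; exact: hR.
Qed.

Definition base_ok (V : finType) (E : {set {set V}}) nA (s : seq V) : Prop :=
  let U := take k s in let a := take nA (drop k s) in
  let Z := take k (drop (k + nA) s) in let b := drop (k + nA + k) s in
  pathlike l d E (U ++ a ++ Z) /\ pathlike l d E (U ++ b ++ Z).

Lemma base_gadget mu : exists nA C n0, forall (V : finType) (E : {set {set V}}),
  codense l d mu E -> n0 <= #|V| ->
  dense C (k + nA + k + (nA + d)) (fun s => `[< base_ok E nA s >]).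
Proof.
have [cA [cB [mA [sB EA EB sA]]]] := box_two_words.
pose T := 2 + size cA.
pose za := [seq (p.1, p.2 + 2) | p <- occs [::] cA].
pose zb := [seq (p.1, p.2 + T) | p <- occs [::] cB].
pose zu := [seq (i, 0) | i <- iota 0 k]; pose zv := [seq (i, 1) | i <- iota 0 k].
pose P := (zu ++ za ++ zv) ++ zb.
pose t := T + size cB; pose KS := [:: iota 0 k].
have off m c : map fst [seq (p.1, p.2 + m) | p <- occs [::] c] = c.
  by rewrite -map_comp -[RHS](occs_fst [::]); apply: eq_map.
have uoff m c : uniq [seq (p.1, p.2 + m) | p <- occs [::] c].
  rewrite map_inj_uniq ?occs_uniq // => [[a b]] [a' b'] /= [-> /eqP].
  by rewrite eqn_add2r => /eqP ->.
have boff m (c : seq nat) p : p \in [seq (p.1, p.2 + m) | p <- occs [::] c] -> m <= p.2 < m + size c.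
  by case/mapP => q /occs_bound; rewrite /= add0n => h -> /=; move: h; clear; lia.
have ufix (m : nat) : uniq [seq (i, m) | i <- iota 0 k].
  by rewrite map_inj_uniq ?iota_uniq // => i j [].
have bfix (m : nat) p : p \in [seq (i, m) | i <- iota 0 k] -> p.2 = m by case/mapP => i _ ->.
have uP : uniq P.
  rewrite /P cat_uniq; apply/and3P; split; last exact: uoff.
    rewrite cat_uniq ufix; apply/and3P; split=> //.
      by apply/hasPn => p; rewrite mem_cat => /orP[/boff|/bfix] h; apply/negP => /bfix; move: h; clear; lia.
    rewrite cat_uniq uoff; apply/and3P; split=> //; last exact: ufix.
    by apply/hasPn => p /bfix h; apply/negP => /boff; move: h; clear; lia.
  apply/hasPn => p /boff h; apply/negP; rewrite !mem_cat.
  by case/or3P => [/bfix|/boff|/bfix]; move: h; rewrite /T; clear; lia.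
have hKS : KSgood l d k KS.
  move=> K; rewrite inE => /eqP ->; split; rewrite ?iota_uniq ?size_iota //.
  by apply/allP => i; rewrite mem_iota.
have inK w : perm_eq (iota 0 k) w -> inKS KS w by move=> pw; rewrite /inKS /= pw.
have k0 : 0 < k by lia.
have letK (c : seq nat) m : size c = k + m * d -> epath l d (perm_eq (iota 0 k)) c -> all (fun x => x < k) c.
  by move=> sc /(epath_impl inK) h; apply: (epath_letters hd hKS sc h).
have lA : all (fun x => x < k) (iota 0 k ++ cA ++ iota 0 k).
  by apply: (letK _ mA) EA; rewrite !size_cat !size_iota -sA; clear; lia.
have lB : all (fun x => x < k) (iota 0 k ++ cB ++ iota 0 k).
  by apply: (letK _ mA.+1) EB; rewrite !size_cat !size_iota !mulSn -sA sB; clear; lia.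
have PN : all (fun p => (p.1 < k) && (p.2 < t.+1)) P.
  apply/allP => p; rewrite !mem_cat => /orP[/or3P[]|] h; apply/andP; split.
  - by move: h => /mapP[i]; rewrite mem_iota => hi ->.
  - by rewrite (bfix _ _ h) /t /T.
  - have : p.1 \in cA by rewrite -(off 2 cA) map_f.
    by move=> pc; apply: (allP lA); rewrite !mem_cat pc orbT.
  - by have /andP[_ h2] := boff _ _ _ h; apply: leq_trans h2 _; rewrite /t /T; clear; lia.
  - by move: h => /mapP[i]; rewrite mem_iota => hi ->.
  - by rewrite (bfix _ _ h) /t /T.
  - have : p.1 \in cB by rewrite -(off T cB) map_f.
    by move=> pc; apply: (allP lB); rewrite !mem_cat pc orbT.
  - by have /andP[_ h2] := boff _ _ _ h; apply: leq_trans h2 _; rewrite /t; clear; lia.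
have sza : size za = size cA by rewrite -(size_map fst) off.
have szb : size zb = size cA + d by rewrite -(size_map fst) off sB.
have szu (m : nat) : size [seq (i, m) | i <- iota 0 k] = k by rewrite size_map size_iota.
have szu0 : size zu = k := szu 0.
have szv0 : size zv = k := szu 1.
have fzu (m : nat) : map fst [seq (i, m) | i <- iota 0 k] = iota 0 k by rewrite -map_comp map_id.
have [Cb hCb] := blow_dense t k (2 ^ k * mu).
exists (size cA), Cb, (2 * k) => V E hE hV.
have n0 : 0 < #|V| by lia.
have /card_gt0P[x0 _] := n0.
have := edge_ext hl hd s1_gt0 kE r0 hE (B := [::]) isT k0 hV; rewrite subn0 => he.
have hB := hCb _ _ n0 he.
have -> : k + size cA + k + (size cA + d) = size P by rewrite !size_cat szu0 szv0 sza szb; clear; lia.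
apply: (dense_pairs (x0 := x0) n0 uP PN hB) => b sb hb; apply/asboolP.
have pl (z : seq (nat * nat)) (c : seq nat) : epath l d (perm_eq (iota 0 k)) c -> map fst z = c -> all (fun p => p.2 < t.+1) z ->
    l <= size c -> d %| size c - l -> pathlike l d E (map (vtx x0 t.+1 b) z).
  move=> Ec zc zt lc dc; have sz : size z = size c by rewrite -zc size_map.
  split; rewrite ?size_map ?sz //.
  apply: (blow_epath hl hd hkd (x0 := x0) hKS) hb zt _ => //; last by rewrite zc; apply: epath_impl Ec.
  by move=> s ss /= es; rewrite map_nth_iota0 ?ss // take_oversize ?ss // es.
have Pt (z : seq (nat * nat)) : {subset z <= P} -> all (fun p => p.2 < t.+1) z.
  by move=> zP; apply/allP => p /zP /(allP PN)/andP[].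
have tk1 : take k (map (vtx x0 t.+1 b) P) = map (vtx x0 t.+1 b) zu.
  by rewrite -map_take /P -catA take_size_cat.
have tk2 : take (size cA) (drop k (map (vtx x0 t.+1 b) P)) = map (vtx x0 t.+1 b) za.
  by rewrite -map_drop -map_take /P -!catA drop_size_cat // take_size_cat.
have tk3 : take k (drop (k + size cA) (map (vtx x0 t.+1 b) P)) = map (vtx x0 t.+1 b) zv.
  by rewrite -map_drop -map_take /P -!catA catA drop_size_cat ?take_size_cat // size_cat szu0 sza.
have tk4 : drop (k + size cA + k) (map (vtx x0 t.+1 b) P) = map (vtx x0 t.+1 b) zb.
  by rewrite -map_drop /P drop_size_cat // !size_cat szu0 szv0 sza addnA.
rewrite /base_ok tk1 tk2 tk3 tk4 -!map_cat; split.
  apply: (pl _ _ EA); first by rewrite !map_cat !fzu off.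
  - by apply: Pt => p; rewrite /P !mem_cat => ->.
  - by rewrite !size_cat !size_iota; clear; lia.
  - rewrite !size_cat !size_iota (_ : _ - l = d + mA * d); last by rewrite -sA; clear; lia.
    by rewrite dvdn_add ?dvdn_mull.
apply: (pl _ _ EB); first by rewrite !map_cat !fzu off.
- by apply: Pt => p; rewrite /P !mem_cat => /or3P[->|->|->]; rewrite ?orbT.
- by rewrite !size_cat !size_iota; clear; lia.
- rewrite !size_cat !size_iota (_ : _ - l = d + (d + mA * d)); last by rewrite sB -sA; clear; lia.
  by rewrite !dvdn_add ?dvdn_mull.
Qed.

Lemma block_perm p q1 c o e : p <= q1 ->
  perm_eq (flatten [seq iota (o + i * q1) p ++ (c + i) :: iota (o + i * q1 + p) (q1 - p) | i <- iota 0 e])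
    (iota c e ++ iota o (e * q1)).
Proof.
move=> pq; elim: e => [|e IH]; first by rewrite mul0n.
rewrite -addn1 iotaD map_cat flatten_cat /= cats0 add0n; apply/permP => a.
rewrite mulnDl mul1n !iotaD !count_cat (permP IH) !count_cat /=.
have -> : iota (o + e * q1) q1 = iota (o + e * q1) p ++ iota (o + e * q1 + p) (q1 - p).
  by rewrite -iotaD subnKC.
by rewrite count_cat; lia.
Qed.

Section Family.
Variables (V : finType) (E : {set {set V}}).

Lemma exch_family_dense sh p q C n0 (x y : nat -> V) e :
  (forall x y : V, dense C q (fun W => `[< exch l d E sh p x y W >])) -> 0 < n0 ->
  dense (C ^ e) (e * q) (fun W => all (fun i => `[< exch l d E sh p (x i) (y i) (take q (drop (i * q) W)) >]) (iota 0 e)).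
Proof.
move=> hC _; elim: e => [|e IH]; first by rewrite /dense /cnt /=.
have := dense_comp IH (fun _ _ _ => hC (x e) (y e)).
rewrite expnSr (_ : e * q + q = e.+1 * q); last by rewrite mulSn addnC.
apply: dense_le => // W sW /andP[/allP h1 h2].
rewrite -addn1 iotaD all_cat /= add0n andbT; apply/andP; split; last first.
  by rewrite take_oversize // size_drop sW mulSn addnK.
apply/allP => i ie; have := h1 i ie; rewrite mem_iota in ie.
congr (is_true `[< exch l d E sh p (x i) (y i) _ >]).
have ii : i.+1 * q <= e * q by rewrite leq_mul2r; apply/orP; right; case/andP: ie.
by rewrite mulSn in ii; rewrite take_drop take_takel // -take_drop.
Qed.

Lemma exch_collect sh p (x y : nat -> V) (W : nat -> seq V) q (rs : seq nat) :
  sumn sh = q.+1 -> (forall i, i \in rs -> size (W i) = q /\ exch l d E sh p (x i) (y i) (W i)) ->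
  exists PS', List.Forall2 (swap l d E) (flatten [seq reshape sh (ins p (y i) (W i)) | i <- rs]) PS' /\
    perm_eq (flatten PS') (map x rs ++ flatten (map W rs)).
Proof.
move=> hsh; elim: rs => [|i rs IH] h; first by exists [::]; split.
have [|PS' [F1 P1]] := IH; first by move=> j jr; apply: h; rewrite inE jr orbT.
have [sW [ps' [F2 P2]]] := h i (mem_head _ _).
exists (ps' ++ PS'); split; first by rewrite /=; apply: List.Forall2_app.
rewrite flatten_cat; apply/permP => a.
by rewrite /= !count_cat (permP P1) (permP P2) /= count_cat; lia.
Qed.

Lemma ins_collect p (y : nat -> V) (W : nat -> seq V) (rs : seq nat) :
  perm_eq (flatten [seq ins p (y i) (W i) | i <- rs]) (map y rs ++ flatten (map W rs)).
Proof.
elim: rs => //= i rs IH; apply/permP => a.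
have e := permP (perm_ins p (y i) (W i)) a.
by rewrite [LHS]count_cat e (permP IH) /= !count_cat; lia.
Qed.

Lemma flatten_slices q e (W : seq V) : size W = e * q ->
  flatten [seq take q (drop (i * q) W) | i <- iota 0 e] = W.
Proof.
elim: e W => [|e IH] W; first by move/size0nil->.
rewrite mulSn => sW; rewrite /= mul0n drop0 -[1]/(1 + 0) iotaDl -map_comp.
rewrite (eq_map (g := fun i => take q (drop (i * q) (drop q W)))); last first.
  by move=> i /=; rewrite drop_drop mulnDl mul1n addnC.
by rewrite IH ?cat_take_drop // size_drop sW addKn.
Qed.

End Family.

(** At rest the base path runs through [a], and every vertex of [b] fills the gap of an exchange
    gadget. To absorb [D], the base path switches to [b], which is longer by [d], and the gadgets
    take in the vertices of [a ++ D] instead. *)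
Lemma absorber mu : exists q sh C n0, sumn sh = q /\
  forall (V : finType) (E : {set {set V}}), codense l d mu E -> n0 <= #|V| ->
  forall D : seq V, size D = d -> uniq D ->
  dense C q (fun W => `[< absorbs E sh D W >]).
Proof.
have [nA [C1 [n1 hbase]]] := base_gadget mu.
have [q1 [sh1 [p1 [C2 [n2 [hsh1 pq1 hex]]]]]] := exchange hl hd s1_gt0 kE r0 mu.
pose nb := k + nA + k; pose e := nA + d; pose q0 := nb + e.
pose q := q0 + e * q1; pose sh := nb :: flatten (nseq e sh1).
pose C := C1 * C2 ^ e.
exists q, sh, C, (maxn 1 (maxn n1 n2)); split.
  rewrite /sh /= /q /q0 -addnA; congr (_ + _); elim: (e) => //= e' IH.
  by rewrite sumn_cat IH hsh1; lia.
move=> V E hE; rewrite !geq_max => /and3P[n0 hn1 hn2] D sD uD.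
have /card_gt0P[x0 _] := n0.
have hB := hbase V E hE hn1; have hX := hex V E hE hn2.
pose X (B : seq V) i := nth x0 (take nA (drop k B) ++ D) i.
pose Y (B : seq V) i := nth x0 (drop nb B) i.
have hT := dense_comp hB (fun B _ _ => exch_family_dense (X B) (Y B) e hX n0).
(* The dense tuple lists [b] before the gadgets; this reindexing moves each vertex of [b] into the
   gap of its gadget, so that [sh] cuts the tuple into paths. *)
pose idx := iota 0 nb ++ flatten [seq iota (q0 + i * q1) p1 ++ (nb + i) :: iota (q0 + i * q1 + p1) (q1 - p1) | i <- iota 0 e].
have idxP : perm_eq idx (iota 0 q).
  rewrite /idx (perm_trans (_ : perm_eq _ (iota 0 nb ++ (iota nb e ++ iota q0 (e * q1))))) //.
    by rewrite perm_cat2l block_perm.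
  by rewrite /q /q0 !iotaD add0n catA.
have sidx : size idx = q by rewrite (perm_size idxP) size_iota.
rewrite -sidx; apply: (dense_proj (x0 := x0) n0 _ _ _ hT).
- by rewrite (perm_uniq idxP) iota_uniq.
- by apply/allP => i; rewrite (perm_mem idxP) mem_iota.
move=> T sT /andP[/asboolP hB0 /allP hW]; apply/asboolP.
set B := take q0 T in hB0 hW; set Ws := drop q0 T in hW.
have sB : size B = q0 by rewrite size_takel // sT leq_addr.
have sWs : size Ws = e * q1 by rewrite size_drop sT addKn.
have TE : T = B ++ Ws by rewrite cat_take_drop.
pose U := take k B; pose a := take nA (drop k B); pose Z := take k (drop (k + nA) B).
pose b := drop nb B; pose W i := take q1 (drop (i * q1) Ws).
have sU : size U = k by rewrite size_takel // sB /q0 /nb; lia.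
have sa : size a = nA by rewrite size_takel // size_drop sB /q0 /nb; lia.
have sZ : size Z = k by rewrite size_takel // size_drop sB /q0 /nb; lia.
have sb : size b = e by rewrite size_drop sB addKn.
have BE : B = (U ++ a ++ Z) ++ b.
  rewrite -[LHS](cat_take_drop nb); congr (_ ++ _).
  rewrite /nb -addnA takeD; congr (_ ++ _); rewrite takeD; congr (_ ++ _).
  by rewrite drop_drop [nA + k]addnC.
have sW i : i < e -> size (W i) = q1.
  move=> ie; rewrite size_takel // size_drop sWs.
  have : i.+1 * q1 <= e * q1 by rewrite leq_mul2r ie orbT.
  by rewrite mulSn; lia.
have sUaZ : size (U ++ a ++ Z) = nb by rewrite !size_cat sU sa sZ addnA.
have mapidx : map (nth x0 T) idx = (U ++ a ++ Z) ++ flatten [seq ins p1 (Y B i) (W i) | i <- iota 0 e].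
  rewrite map_cat; congr (_ ++ _).
    rewrite map_nth_iota0 ?sT ?/q ?/q0; last by lia.
    by rewrite TE BE -catA take_size_cat.
  rewrite map_flatten -map_comp; congr flatten; apply/eq_in_map => i.
  rewrite mem_iota => ie /=; have ii : i.+1 * q1 <= e * q1 by rewrite leq_mul2r; apply/orP; right; case/andP: ie.
  rewrite mulSn in ii.
  rewrite map_cat /= !map_nth_iota ?sT ?/q; try (move: ii pq1; lia).
  have dT j : drop (q0 + j) T = drop j Ws by rewrite TE drop_cat sB ltnNge leq_addr /= addKn.
  rewrite /ins; congr (_ ++ _ :: _).
  - by rewrite dT /W take_takel.
  - rewrite /Y -/b nth_drop TE nth_cat sB ifT //; move: ie; rewrite /q0; lia.
  - by rewrite -addnA dT addnC -drop_drop take_drop subnK.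
rewrite mapidx.
have YE : map (Y B) (iota 0 e) = b.
  by rewrite -[RHS](@mkseq_nth _ x0) sb /mkseq; apply: eq_map => i; rewrite /Y.
have XE : map (X B) (iota 0 e) = a ++ D.
  by rewrite -[RHS](@mkseq_nth _ x0) size_cat sa sD.
have [|PS' [F1 Pm]] := @exch_collect V E sh1 p1 (X B) (Y B) W q1 (iota 0 e) hsh1.
  by move=> i ie; split; [apply: sW; move: ie; rewrite mem_iota | apply/asboolP/(hW i ie)].
have WE : flatten (map W (iota 0 e)) = Ws by exact: flatten_slices.
rewrite WE XE in Pm.
have [hA1 hA2] := hB0; rewrite -/U -/a -/Z -/nb -/b in hA1 hA2.
have sins i : i < e -> size (ins p1 (Y B i) (W i)) = q1.+1.
  by move=> ie; rewrite (perm_size (perm_ins _ _ _)) /= sW.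
rewrite /absorbs; have -> : reshape sh ((U ++ a ++ Z) ++ flatten [seq ins p1 (Y B i) (W i) | i <- iota 0 e]) =
    (U ++ a ++ Z) :: flatten [seq reshape sh1 (ins p1 (Y B i) (W i)) | i <- iota 0 e].
  rewrite /sh /= take_size_cat // drop_size_cat //; congr (_ :: _).
  have : forall i, i \in iota 0 e -> size (ins p1 (Y B i) (W i)) = q1.+1.
    by move=> i; rewrite mem_iota => /andP[_]; exact: sins.
  rewrite -[in nseq e sh1](size_iota 0 e); elim: (iota 0 e) => //= i rs IH h.
  have si := h i (mem_head _ _).
  rewrite -IH => [|j jr]; last by apply: h; rewrite inE jr orbT.
  have rc (s1' s2' : seq nat) (t1 t2 : seq V) : sumn s1' = size t1 ->
      reshape (s1' ++ s2') (t1 ++ t2) = reshape s1' t1 ++ reshape s2' t2.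
    elim: s1' t1 => [|m s' IHs] t1 /=; first by move/esym/size0nil->.
    move=> h1; rewrite takel_cat -?h1 ?leq_addr // drop_cat -h1.
    case: ltnP => hm; first by rewrite IHs // size_drop -h1 addKn.
    rewrite (_ : m - _ = 0); last by lia.
    rewrite drop0 (drop_oversize (_ : size t1 <= m)) -?h1 //.
    by rewrite -{1}[t2]cat0s IHs // /=; lia.
  by rewrite rc ?hsh1 ?si.
exists ((U ++ b ++ Z) :: PS'); split.
  by constructor=> //; split=> //; apply: ends_cat; rewrite ?sU ?sZ leq_addr.
apply/permP => f; rewrite /= !count_cat (permP Pm) (permP (ins_collect _ _ _ _)) YE WE !count_cat.
move: (count f U) (count f a) (count f Z) (count f b) (count f Ws) (count f D) => *; lia.
Qed.

End Absorber.

(** * Selecting disjoint gadgets *)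

Lemma bernoulli x t : x ^ t * (x + t) <= x.+1 ^ t * x.
Proof.
elim: t => [|t IH]; first by rewrite !expn0 addn0.
have h : x ^ t <= x.+1 ^ t by exact: leq_exp2.
by rewrite !expnS; nia.
Qed.

(** Divide [m] into [e.+1] nearly equal parts of size [j]; by [bernoulli], each contributes a factor
    of at least [1 + j / 2] to [(3 / 2) ^ m]. Their product has degree [e.+1] in [m] and so outgrows
    [n ^ e]. *)
Lemma exp_beats_poly e M : exists n0, forall n m,
  n0 <= n -> n <= M * m.+1 -> n ^ e * 2 ^ m < 3 ^ m.
Proof.
pose K := (2 * e.+1) ^ e.+1; exists (M * (M ^ e * K)).+1 => n m nn nM.
have K0 : 0 < K by rewrite expn_gt0 muln_gt0.
have mK : M ^ e * K < m.+1 by rewrite -(ltn_pmul2l (_ : 0 < M)); [apply: leq_trans nn _ | case: (M) nM nn => //; rewrite !mul0n; lia].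
pose j := m %/ e.+1; pose r := m %% e.+1.
have mE : m = j * e.+1 + r by exact: divn_eq.
have rE : r < e.+1 by rewrite ltn_mod.
have b : 2 ^ j * (2 + j) <= 3 ^ j * 2 by exact: bernoulli.
have := leq_exp2 e.+1 b; rewrite !expnMn -!expnM => {}b.
have mj : m.+1 <= (2 + j) * e.+1 by rewrite mulnDl {1}mE; lia.
have := leq_exp2 e.+1 mj; rewrite expnMn => {}mj.
have h1 : m.+1 ^ e.+1 * 2 ^ m <= K * 3 ^ m.
  have r23 : 2 ^ r <= 3 ^ r by exact: leq_exp2.
  rewrite {2 3}mE !expnD /K expnMn.
  have := leq_mul (leq_mul mj (leqnn (2 ^ (j * e.+1)))) r23.
  have := leq_mul (leq_mul b (leqnn (e.+1 ^ e.+1))) (leqnn (3 ^ r)).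
  set a1 := 2 ^ (j * _); set a2 := (2 + j) ^ _; set a3 := e.+1 ^ _; set a4 := 3 ^ (j * _).
  set a5 := 2 ^ _; set a6 := 3 ^ r; set a7 := 2 ^ r; set a8 := m.+1 ^ _.
  move=> x1 x2; rewrite mulnA; apply: leq_trans x2 _.
  by rewrite (_ : a2 * a3 * a1 * a6 = a1 * a2 * a3 * a6) 1?(_ : a5 * a3 * (a4 * a6) = a4 * a5 * a3 * a6) //; lia.
have ne : n ^ e <= M ^ e * m.+1 ^ e by rewrite -expnMn; exact: leq_exp2.
rewrite -(ltn_pmul2l K0); apply: leq_trans h1; rewrite expnS.
apply: leq_ltn_trans (_ : M ^ e * K * (m.+1 ^ e * 2 ^ m) < _).
  have := leq_mul ne (leqnn (K * 2 ^ m)); rewrite [K * (_ * _)]mulnCA => /leq_trans; apply.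
  by rewrite (_ : M ^ e * m.+1 ^ e * (K * 2 ^ m) = M ^ e * K * (m.+1 ^ e * 2 ^ m)) //; lia.
by rewrite -[X in _ < X]mulnA ltn_pmul2r // muln_gt0 !expn_gt0.
Qed.

Section Selection.
Variables (V : finType) (I : finType) (q : nat) (good : I -> pred (seq V)) (C : nat).
Hypotheses (hgood : forall i, dense C q (good i)) (n0 : 0 < #|V|).

(** Averaging: over all [q]-tuples, those with distinct entries outside [Z] serve at least a
    fraction [1 / (2 * C)] of the total weight, so some tuple does. *)
Lemma selection_step (w : I -> nat) (Z : seq V) : 0 < \sum_i w i ->
  2 * C * (q * (q + size Z)) <= #|V| ->
  exists s, [/\ size s = q, uniq s, ~~ has (mem Z) s &
     \sum_i w i <= 2 * C * \sum_(i | good i s) w i].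
Proof.
move=> w0 hZ; pose ok s := uniq s && ~~ has (mem Z) s.
pose f s := 2 * C * (ok s * \sum_(i | good i s) w i).
have h : #|V| ^ q * \sum_i w i <= msum q f.
  rewrite msumM big_distrr /=.
  have -> : msum q (fun s => ok s * \sum_(i | good i s) w i) =
     \sum_i w i * cnt q (fun s => [&& good i s, uniq s & ~~ has (mem Z) s]).
    rewrite -(eq_bigr _ (fun i _ => msumM q (w i) _)) -msum_sum.
    apply: eq_msum => s _; rewrite big_distrr big_mkcond /=; apply: eq_bigr => i _.
    by rewrite /ok; case: (good i s); rewrite /= ?muln0 // mulnC.
  rewrite big_distrr /=; apply: leq_sum => i _.
  rewrite mulnC mulnCA leq_mul2l; apply/orP; right.
  exact: dense_uniq n0 hZ (hgood i).
have [s ss fs] : exists2 s, size s = q & \sum_i w i <= f s.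
  apply: contrapT => hn; move: h; apply/negP; rewrite -ltnNge.
  have hlt s : size s = q -> f s <= (\sum_i w i).-1.
    move=> ss; rewrite -ltnS prednK // ltnNge; apply/negP => hs; apply: hn; by exists s.
  apply: leq_ltn_trans (leq_msum hlt) _; rewrite msum_const mulnC ltn_pmul2l ?expn_gt0 ?n0 //.
  by rewrite prednK.
move: fs; rewrite /f; case: (boolP (ok s)) => [/andP[us hs]|_]; last by rewrite mul0n muln0; lia.
by rewrite mul1n => fs; exists s.
Qed.

(** Up to the normalization [2 ^ m], the weight of a request is halved whenever a gadget serves it,
    and each gadget can be chosen to reduce the total weight by a factor [1 - 1 / (4 * C)]. *)
Lemma selection_family (Z : seq V) m (i0 : I) :
  2 * C * (q * (q + (size Z + m * q))) <= #|V| ->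
  exists Fs, [/\ size Fs = m, all (fun F => size F == q) Fs, uniq (flatten Fs) /\ ~~ has (mem Z) (flatten Fs)
   & (2 * C) ^ m * \sum_i 2 ^ (m - count (good i) Fs) <= (4 * C - 1) ^ m * #|I|].
Proof.
elim: m => [|m IH] hm.
  by exists [::]; split=> //=; rewrite !expn0 sum_nat_const muln1.
have [|Fs [sF aF [uF dF] hF]] := IH.
  by apply: leq_trans hm; rewrite !leq_mul2l mulSn; apply/orP; right; apply/orP; right; lia.
pose w i := 2 ^ (m - count (good i) Fs).
have sfl : size (flatten Fs) = m * q.
  rewrite size_flatten /shape -sF; elim: (Fs) aF => //= F Fs' IH' /andP[/eqP -> /IH' ->].
  by rewrite mulSn.
have w0 : 0 < \sum_i w i by rewrite (bigD1 i0) //= ltn_addr // expn_gt0.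
have [|s [ss us hs hw]] := @selection_step w (Z ++ flatten Fs) w0.
  apply: leq_trans hm; rewrite size_cat sfl !leq_mul2l mulSn; apply/orP; right; apply/orP; right; lia.
exists (s :: Fs); split=> /=; rewrite ?sF ?ss ?eqxx //.
  rewrite cat_uniq us uF has_cat negb_or dF !andbT; split.
    apply/hasPn => x xF; apply: contra hs => xs; apply/hasP; exists x => //.
    by rewrite /= mem_cat xF orbT.
  by apply: contra hs => /hasP[x xs xZ]; apply/hasP; exists x => //=; rewrite mem_cat (xZ : x \in Z).
have e : \sum_i 2 ^ (m.+1 - (good i s + count (good i) Fs)) + \sum_(i | good i s) w i = 2 * \sum_i w i.
  rewrite [X in _ + X]big_mkcond -big_split big_distrr /=; apply: eq_bigr => i _.
  have hc : count (good i) Fs <= m by rewrite -sF count_size.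
  rewrite /w; case: (good i s); rewrite /= ?add1n ?subSS ?add0n ?addn0.
    by rewrite mul2n addnn.
  by rewrite subSn // expnS.
have C0 : 0 < C by case: (C) hw w0 => //; rewrite muln0 mul0n; lia.
have st : 2 * C * \sum_i 2 ^ (m.+1 - (good i s + count (good i) Fs)) <= (4 * C - 1) * \sum_i w i.
  move: e hw; set A := \sum_i _; set B := \sum_(i | _) _; set D := \sum_i w i => e hw.
  have : 2 * C * A + 2 * C * B = 4 * C * D by rewrite -mulnDr e; lia.
  by rewrite mulnBl; lia.
rewrite !expnSr -mulnA; apply: leq_trans (leq_mul (leqnn _) st) _.
by rewrite mulnCA; apply: leq_trans (leq_mul (leqnn _) hF) _; rewrite mulnA [_ * (4 * C - 1) ^ m]mulnC.
Qed.

End Selection.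

(** A request served fewer than [m / (8 * C)] times would retain too much weight: raising the
    resulting inequality to the power [8 * C], where [bernoulli] bounds
    [(1 - 1 / (4 * C)) ^ (8 * C)] by [1 / 3], contradicts [exp_beats_poly]. *)
Lemma selection q C e M : exists n0, forall (V I : finType) (good : I -> pred (seq V)) (i0 : I),
  #|I| <= #|V| ^ e -> n0 <= #|V| -> (forall i, dense C q (good i)) ->
  forall (Z : seq V) m, #|V| <= M * m.+1 ->
  2 * C * (q * (q + (size Z + m * q))) <= #|V| ->
  exists Fs, [/\ size Fs = m, all (fun F => size F == q) Fs, uniq (flatten Fs),
     ~~ has (mem Z) (flatten Fs) & forall i, m <= 8 * C * count (good i) Fs].
Proof.
have [n1 hn1] := exp_beats_poly (e * (8 * C)) M; exists (maxn 1 n1).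
move=> V I good i0 hI; rewrite geq_max => /andP[n0 hV] hgood Z m hm hZ.
have C0 : 0 < C.
  by have := hgood i0; rewrite /dense; case: (C) => //; rewrite mul0n leqNgt expn_gt0 n0.
have [Fs [sF aF [uF dF] hF]] := selection_family hgood n0 i0 hZ.
exists Fs; split=> // i; rewrite leqNgt; apply/negP => hi.
set h := count (good i) Fs in hi.
have hm' : h <= m by rewrite -sF count_size.
have h1 : (2 * C) ^ m * 2 ^ (m - h) <= (4 * C - 1) ^ m * #|I|.
  by apply: leq_trans hF; rewrite leq_mul2l (bigD1 i) //= leq_addr orbT.
have h2 : (4 * C) ^ m <= (4 * C - 1) ^ m * (#|V| ^ e * 2 ^ h).
  have := leq_mul h1 (leqnn (2 ^ h)); rewrite -mulnA -expnD subnK // -expnMn.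
  have -> : 2 * C * 2 = 4 * C by lia.
  move/leq_trans; apply; rewrite -mulnA leq_mul2l; apply/orP; right.
  by rewrite leq_mul2r hI orbT.
have b : (4 * C - 1) ^ (8 * C) * 3 <= (4 * C) ^ (8 * C).
  have := bernoulli (4 * C - 1) (8 * C).
  have -> : (4 * C - 1).+1 = 4 * C by lia.
  move=> b; rewrite -(leq_pmul2r (_ : 0 < 4 * C - 1)); last by lia.
  by apply: leq_trans b; rewrite -mulnA leq_mul2l; apply/orP; right; lia.
have := leq_exp2 (8 * C) h2; rewrite [X in _ <= X]expnMn [X in _ <= _ * X]expnMn -!expnM => {}h2.
have := leq_exp2 m b; rewrite expnMn -!expnM => {}b.
have x0 : 0 < (4 * C - 1) ^ (8 * C * m) by rewrite expn_gt0; clear -C0; lia.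
rewrite [m * (8 * C)]mulnC in h2; have := leq_trans b h2; rewrite leq_pmul2l // => h3.
have := hn1 _ _ hV hm; rewrite ltnNge => /negP; apply; apply: leq_trans h3 _.
rewrite leq_mul2l; apply/orP; right; rewrite leq_exp2l //.
by apply: ltnW; rewrite mulnC.
Qed.

(** * Duality in the reduced k-graph *)

Section SumCount.
Variable V : finType.

Lemma msum_additive q (g : V -> nat) :
  #|V| * msum q (fun s => \sum_(x <- s) g x) = q * #|V| ^ q * \sum_x g x.
Proof.
elim: q => [|q IH] /=; first by rewrite big_nil muln0.
rewrite (eq_bigr (fun v => g v * #|V| ^ q + msum q (fun s => \sum_(x <- s) g x))).
  rewrite big_split /= sum_nat_const -big_distrl /= mulnDr mulnCA IH expnS.
  set S := \sum_ _ _; set X := _ ^ q; set n := #|_|.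
  by rewrite mulSn mulnDl -!mulnA; congr (_ + _); rewrite [in RHS]mulnC -!mulnA; nia.
by move=> v _; rewrite -msum_const -msumD; apply: eq_msum => s _; rewrite big_cons.
Qed.

Lemma cnt_has q (X : pred V) : #|V| * cnt q (has X) <= q * #|V| ^ q * #|X|.
Proof.
have -> : #|X| = \sum_v (X v : nat).
  by rewrite -sum1_card big_mkcond; apply: eq_bigr => v _; rewrite unfold_in; case: (X v).
rewrite -msum_additive leq_mul2l; apply/orP; right.
apply: leq_msum => s _; case: hasP => // -[x xs Xx]; rewrite lt0n.
by rewrite (big_rem x xs) /= Xx.
Qed.

End SumCount.

Section Dual.
Variables (k a p : nat) (R : pred (seq 'I_p)) (f : 'I_p -> nat).
Hypotheses (k2 : 2 <= k) (ka : k < a) (kp : k <= p).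
Let F := \sum_i f i.
(** The head of a pointed edge counts [k - 1] times and each other vertex [a - 1] times, in
    proportion to the parts of a tile. *)
Definition cost (K : seq 'I_p) :=
  if K is h :: tl then (k - 1) * f h + (a - 1) * \sum_(x <- tl) f x else 0.
Hypothesis hR : forall K, size K = k -> uniq K -> R K -> a * (k - 1) * F < p * cost K.

(* LP duality by hand: with [S] the (k-1)-set of least weight, the excess
   [(k-1) f u - f(S)] is nonnegative off [S], large on the neighbours of [S],
   and bounded below on average over every edge; its total mass is [tau]. *)
Lemma dual_bound : exists S : {set 'I_p}, #|S| = k - 1 /\
  let N := [set u | (u \notin S) && R (u :: enum S)] in
  0 < #|N| -> a * #|N| <= p /\
  p * cnt k (fun K => [&& uniq K, R K & all (fun x => (x \notin S) && (x \notin N)) K])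
    <= k * p ^ k * (p - a * #|N|).
Proof.
have [S0 hS0] : exists S : {set 'I_p}, #|S| == k - 1.
  have : 0 < #|[set S : {set 'I_p} | #|S| == k - 1]|.
    by rewrite card_draws card_ord bin_gt0; lia.
  by case/card_gt0P => S; rewrite inE; exists S.
case: (arg_minnP (P := fun S : {set 'I_p} => #|S| == k - 1)
  (fun S : {set 'I_p} => \sum_(x in S) f x) hS0) => S /eqP cS minS.
exists S; split=> // N N0.
set sg := \sum_(x in S) f x in minS *.
pose g u := (k - 1) * f u - sg.
(* Exchange argument: by minimality of [S], no weight inside [S] exceeds a weight outside. *)
have gE u : u \notin S -> (k - 1) * f u = g u + sg.
  move=> uS; rewrite /g subnK //.
  have h x : x \in S -> f x <= f u.
    move=> xS; have uSx : u \notin S :\ x by rewrite !inE (negbTE uS) andbF.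
    have := minS (u |: (S :\ x)).
    have cSx : #|u |: S :\ x| == k - 1 by rewrite cardsU1 uSx -cS (cardsD1 x S) xS.
    by move=> /(_ cSx); rewrite big_setU1 //= /sg (big_setD1 x xS) /=; lia.
  rewrite -cS -sum_nat_const; apply: leq_sum => x; exact: h.
pose tau := \sum_(u | u \notin S) g u.
have cSC : #|~: S| = p - (k - 1) by have := cardsC S; rewrite card_ord cS; lia.
have tauE : (k - 1) * F = tau + p * sg.
  rewrite /F (bigID (mem S)) /= mulnDr -/sg [X in _ + X = _]big_distrr /=.
  rewrite (eq_bigr (fun u => g u + sg)) => [|u]; last exact: gE.
  rewrite big_split /= sum_nat_const -/tau.
  have -> : #|[pred u | u \notin S]| = p - (k - 1) by rewrite -cSC; apply: eq_card => u; rewrite !inE.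
  rewrite [(p - _) * sg]mulnBl; have : (k - 1) * sg <= p * sg by rewrite leq_mul2r; lia.
  lia.
(* The cost bound for the edge that consists of [S] and the head [u]. *)
have hN u : u \in N -> a * tau < p * g u.
  rewrite inE => /andP[uS Ru].
  have := hR _ _ Ru; rewrite /= -cardE cS enum_uniq mem_enum uS => /(_ _ isT) h.
  have {}h : a * (k - 1) * F < p * ((k - 1) * f u + (a - 1) * \sum_(x <- enum S) f x) by apply: h; lia.
  have asg : (a - 1) * sg + sg = a * sg by rewrite mulnBl mul1n subnK // leq_pmull; lia.
  move: h; rewrite big_enum /= -/sg -mulnA tauE gE //.
  have -> : g u + sg + (a - 1) * sg = g u + a * sg by lia.
  by rewrite !mulnDr [p * (a * _)]mulnCA ltn_add2r.
have tau0 : 0 < tau.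
  case/card_gt0P: N0 => u uN; have := hN u uN; rewrite inE in uN; case/andP: uN => uS _.
  case: posnP => // t0; rewrite t0 muln0; suff -> : g u = 0 by rewrite muln0.
  by move: t0; rewrite /tau (bigD1 u) //=; lia.
have NS : N \subset ~: S by apply/subsetP => u; rewrite !inE => /andP[].
pose g0 u := if (u \notin S) && (u \notin N) then g u else 0.
have tauD : tau = \sum_(u in N) g u + \sum_u g0 u.
  rewrite /tau (bigID (mem N)) /=; congr (_ + _).
    by apply: eq_bigl => u; rewrite andb_idl // => /(subsetP NS); rewrite inE.
  by rewrite big_mkcond.
have gN : #|N| * (a * tau) <= p * \sum_(u in N) g u.
  by rewrite -sum_nat_const [X in _ <= X]big_distrr /=; apply: leq_sum => u /hN /ltnW.
have Np : a * #|N| <= p.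
  rewrite -(leq_pmul2r tau0) -mulnA mulnCA; apply: leq_trans gN _.
  by rewrite leq_mul2l tauD leq_addr orbT.
split=> //; rewrite -(leq_pmul2r tau0).
set P := fun K => _.
(* An edge avoiding [S] and [N] has total excess at least [tau / p], while all vertices outside [N]
   together have at most [tau * (p - a * #|N|) / p]; so there are few such edges. *)
have h1 : tau * cnt k P <= p * msum k (fun K => \sum_(x <- K) g0 x).
  rewrite /cnt -!msumM; apply: leq_msum => K sK; case PK: (P K); rewrite ?muln0 // muln1.
  case/and3P: PK => uK RK /allP KO; have := hR sK uK RK.
  have {RK} -> : \sum_(x <- K) g0 x = \sum_(x <- K) g x.
    by apply: eq_big_seq => x /KO; rewrite /g0 => ->.
  case: K sK uK KO => [|h tl] /= sK uK KO; first by lia.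
  have hS : h \notin S by case/andP: (KO h (mem_head _ _)).
  rewrite -mulnA tauE gE // big_cons => h2.
  have k1 : 0 < k - 1 by lia.
  have h3 : (k - 1) * \sum_(x <- tl) f x = \sum_(x <- tl) g x + (k - 1) * sg.
    have stl : k - 1 = size tl by rewrite -sK subn1.
    rewrite stl; have -> : size tl * sg = \sum_(x <- tl) sg by rewrite big_const_seq count_predT iter_addn_0 mulnC.
    rewrite -big_split big_distrr /=; apply: eq_big_seq => x xt.
    by rewrite -stl; apply: gE; case/andP: (KO x (mem_behead (s := h :: tl) xt)).
  have ka1 : k - 1 <= a - 1 by lia.
  have aE : a = (a - 1).+1 by lia.
  move: h2 h3 k1 ka1; rewrite {1}aE; move: (\sum_(x <- tl) f x) (\sum_(x <- tl) g x) (g h) => f1 T G.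
  move: (k - 1) (a - 1) => K1 A1; clear => h2 h3 k1 ka1.
  have h4 := leq_mul (leqnn K1) h2.
  have e1 : K1 * (p * (G + sg + A1 * f1)) = K1 * p * G + K1 * p * sg + A1 * p * T + A1 * p * K1 * sg.
    rewrite (_ : _ * _ = K1 * p * G + K1 * p * sg + A1 * p * (K1 * f1)); last by ring.
    by rewrite h3; ring.
  have e2 : K1 * (A1.+1 * (tau + p * sg)) = K1 * A1 * tau + K1 * tau + K1 * A1 * p * sg + K1 * p * sg by ring.
  have h5 : A1 * tau <= K1 * A1 * tau by rewrite leq_mul2r; nia.
  have h6 : K1 * p * G <= A1 * p * G by rewrite !leq_mul2r ka1 !orbT.
  have : A1 * tau <= A1 * (p * (G + T)).
    have -> : A1 * (p * (G + T)) = A1 * p * G + A1 * p * T by ring.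
    have : A1 * p * K1 * sg = K1 * A1 * p * sg by ring.
    rewrite mulnS e1 e2 in h4; lia.
  by rewrite leq_pmul2l //; lia.
rewrite -(leq_pmul2l (_ : 0 < p)); last by lia.
have := msum_additive k g0; rewrite card_ord => h2.
have h3 : p * \sum_u g0 u <= tau * (p - a * #|N|).
  by rewrite mulnBr; have := tauD; rewrite [tau * (a * _)]mulnA; nia.
have := leq_mul (leqnn (p * p)) h1.
have := leq_mul (leqnn (k * p ^ k)) h3.
move: (cnt k P) (msum k _) h2 => c M h2 h4 h5.
have h6 : p * p * (tau * c) = p * (p * c * tau) by ring.
rewrite -h6; apply: leq_trans h5 _; rewrite h2.
have -> : p * p * (k * p ^ k * \sum_u g0 u) = p * (k * p ^ k * (p * \sum_u g0 u)) by ring.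
by rewrite leq_mul2l -[X in _ <= X]mulnA [_ * tau]mulnC h4 orbT.
Qed.

End Dual.

(** * Clusters and the reduced k-graph *)

Section Clusters.
Variables (V : finType) (p t : nat) (c : 'I_p -> 'I_t -> V).
Hypothesis cinj : forall i j i' j', c i j = c i' j' -> i = i' /\ j = j'.

Definition clusters : {set V} := [set c q.1 q.2 | q in setT].
Definition vert (K : seq 'I_p) (js : seq 'I_t) : seq V := [seq c q.1 q.2 | q <- zip K js].

Lemma clusters_sum (F : V -> nat) : \sum_(v in clusters) F v = \sum_i \sum_j F (c i j).
Proof.
rewrite big_imset /=; last by move=> [i j] [i' j'] _ _ /cinj /= [-> ->].
by rewrite pair_bigA /=; apply: eq_bigl => q; rewrite inE.
Qed.

Lemma card_clusters : #|clusters| = p * t.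
Proof. by rewrite card_imset; [rewrite cardsT card_prod !card_ord | move=> [i j] [i' j'] /cinj /= [-> ->]]. Qed.

Lemma vert_uniq K js : uniq K -> size K = size js -> uniq (vert K js).
Proof.
move=> uK s; rewrite map_inj_in_uniq => [|[i j] [i' j'] _ _ /cinj /= [-> ->] //].
by apply: (@map_uniq _ _ fst); rewrite -/unzip1 unzip1_zip // s.
Qed.

Lemma size_vert K js : size K = size js -> size (vert K js) = size K.
Proof. by move=> s; rewrite size_map size1_zip // s. Qed.

Lemma msum_vert q (F : seq V -> nat) :
  msum q (fun s => all (mem clusters) s * F s) =
  msum q (fun K => msum q (fun js => F (vert K js))).
Proof.
elim: q F => [|q IH] F /=; first by rewrite mul1n.
rewrite (bigID (mem clusters)) /= [X in _ + X]big1 ?addn0; last first.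
  move=> v vc; rewrite (eq_msum (g := fun=> 0)) ?msum_const //.
  by move=> s _; rewrite (negbTE vc) mul0n.
rewrite clusters_sum; apply: eq_bigr => i _.
transitivity (\sum_j msum q (fun K => msum q (fun js => F (vert (i :: K) (j :: js))))); last first.
  by rewrite -msum_sum; apply: eq_msum => K _; rewrite -msum_sum.
apply: eq_bigr => j _; rewrite /= -(IH (fun s => F (c i j :: s))); apply: eq_msum => s _; congr (_ * _).
by rewrite (_ : c i j \in clusters) //; apply/imsetP; exists (i, j).
Qed.

End Clusters.

Lemma edges_cnt (V : finType) (E : {set {set V}}) k B : (forall e, e \in E -> #|e| = k) ->
  edges_in E B <= cnt k (fun s => edge E s && all (mem B) s).
Proof.
move=> hE; rewrite /cnt msum_tuple.
have -> : \sum_(s : k.-tuple V) (edge E s && all (mem B) s : nat) =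
  #|[set s : k.-tuple V | edge E s && all (mem B) s]|.
  rewrite -sum1_card [RHS]big_mkcond; apply: eq_bigr => s _; rewrite inE.
  by case: (_ && _).
pose g (s : k.-tuple V) := [set x in (s : seq V)].
apply: leq_trans (leq_imset_card g _); rewrite /edges_in; apply: subset_leq_card.
apply/subsetP => e; rewrite inE => /andP[eE /subsetP eB].
have se : size (enum e) == k by rewrite -cardE hE.
have ge : [set x in enum e] = e by apply/setP => x; rewrite inE mem_enum.
apply/imsetP; exists (Tuple se); last by rewrite /g /= ge.
rewrite inE /edge /= ge eE; apply/allP => x; rewrite mem_enum; exact: eB.
Qed.

Lemma set_near (V : finType) (A : {set V}) m : m <= #|V| ->
  exists2 B : {set V}, #|B| = m & #|B :\: A| <= m - #|A|.
Proof.
move=> mV; pose w := enum A ++ enum (~: A).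
have uw : uniq w.
  rewrite cat_uniq !enum_uniq /= andbT; apply/hasPn => x; rewrite !mem_enum inE.
  by move=> /negbTE /= ->.
have sw : size w = #|V| by rewrite size_cat -!cardE cardsC.
exists [set x in take m w].
  by rewrite cardsE (card_uniqP _) ?take_uniq // size_takel // sw.
apply: leq_trans (_ : size (take (m - #|A|) (enum (~: A))) <= _); last first.
  by rewrite size_take_min geq_minl.
apply: leq_trans (card_size _); apply: subset_leq_card; apply/subsetP => x.
rewrite !inE /w => /andP[xA]; rewrite take_cat -cardE; case: ltnP => h.
  by move/mem_take; rewrite mem_enum (negbTE xA).
by rewrite mem_cat mem_enum (negbTE xA).
Qed.

Section DualEdge.
Variables (V : finType) (E : {set {set V}}) (k a Dn G H p t : nat) (Z : {set V}).
Variable (c : 'I_p -> 'I_t -> V).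
Local Notation n := #|V|.
Hypothesis cinj : forall i j i' j', c i j = c i' j' -> i = i' /\ j = j'.
Hypothesis cZ : n <= #|Z| + p * t + t.
Hypotheses (k2 : 2 <= k) (ka : k < a) (t0 : 0 < t) (Dn0 : 0 < Dn).
Hypothesis H1 : forall e, e \in E -> #|e| = k.
Hypothesis H2 : forall S : seq V, uniq S -> size S = k.-1 ->
  G * n <= a * n + a * G * #|[pred v | edge E (rcons S v)]|.
Hypothesis H3 : forall B : {set V}, #|B| = ((a - 1) * n) %/ a -> n ^ k < Dn * edges_in E B.
Hypothesis H4 : G * #|Z| <= n.
Hypotheses (hG : 96 * a * Dn * k <= G) (hH : 12 * a * Dn * k <= H) (hp : 12 * a * Dn * k * k <= p).

Definition dedge (K : seq 'I_p) := dense H k (fun js => edge E (vert c K js)).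

(** Sum the codegrees over all transversals of the clusters in [S]. A cluster outside [S] and [N]
    contributes a proportion below [1 / H], so nearly all of the degree comes from [N], which must
    have almost [p / a] members. *)
Lemma codeg_clusters (S N : {set 'I_p}) : #|S| = k - 1 ->
  N = [set u | (u \notin S) && dedge (u :: enum S)] ->
  (p - a * #|N|) * (4 * Dn * k) <= p.
Proof.
move=> cS NE; set w := fun js => vert c (enum S) js.
have T0 : 0 < t ^ (k - 1) by rewrite expn_gt0 t0.
have degE js : size js = k - 1 -> #|[pred v | edge E (rcons (w js) v)]| <=
  (n - p * t) + \sum_i \sum_j edge E (c i j :: w js).
  move=> sj; have -> : #|[pred v | edge E (rcons (w js) v)]| = \sum_v (edge E (v :: w js) : nat).
    rewrite -sum1_card big_mkcond; apply: eq_bigr => v _; rewrite inE.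
    by rewrite (edge_perm E (_ : perm_eq _ (v :: w js))) ?perm_rcons //; case: (edge _ _).
  rewrite (bigID (mem (clusters c))) /= addnC leq_add //; last by rewrite clusters_sum.
  apply: (@leq_trans (\sum_(v | v \notin clusters c) 1)); first by apply: leq_sum => v _; case: (edge _ _).
  rewrite sum1_card -(card_clusters cinj) -(cardsC (clusters c)) addKn.
  by apply/eq_leq/eq_card => v; rewrite !inE.
pose X i := cnt k (fun js => edge E (vert c (i :: enum S) js)).
have XE i : msum (k - 1) (fun js => \sum_j (edge E (c i j :: w js) : nat)) = X i.
  have kS : k = (k - 1).+1 by clear -k2; lia.
  by rewrite /X /cnt [in RHS]kS /= msum_sum.
have Xt i : X i <= t ^ k by rewrite -[t in X in _ <= X]card_ord; exact: cnt_le_all.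
have XH i : H * X i <= t ^ k * (H * ((i \in S) || (i \in N)) + 1).
  case: (boolP ((i \in S) || (i \in N))) => h.
    by rewrite muln1 mulnDr muln1; apply: leq_trans (leq_addr _ _); rewrite mulnC leq_mul2r Xt orbT.
  rewrite muln0 muln1; move: h; rewrite negb_or NE inE negb_and => /andP[h1].
  by rewrite h1 /= /dedge /dense -ltnNge card_ord => /ltnW.
have sX : H * \sum_i X i <= t ^ k * (H * (k - 1 + #|N|) + p).
  rewrite [X in X <= _]big_distrr /=; apply: (@leq_trans (\sum_(i < p) t ^ k * (H * ((i \in S) || (i \in N)) + 1))); first by apply: leq_sum => i _; exact: XH.
  rewrite -big_distrr /= leq_mul2l big_split sum_nat_const card_ord /= muln1 leq_add2r -big_distrr /= leq_mul2l.
  apply/orP; right; apply/orP; right; rewrite -cS.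
  have -> : \sum_(i < p) ((i \in S) || (i \in N) : nat) = #|S :|: N|.
    by rewrite -sum1_card [RHS]big_mkcond; apply: eq_bigr => i _; rewrite inE; case: (_ || _).
  by rewrite cardsU leq_subr.
have main : H * G * n <= H * a * n + a * G * (H * (n - p * t) + t * (H * (k - 1 + #|N|) + p)).
  rewrite -(leq_pmul2r T0).
  have h : msum (k - 1) (fun _ : seq 'I_t => G * n) <=
    msum (k - 1) (fun js => a * n + a * G * ((n - p * t) + \sum_i \sum_j edge E (c i j :: w js))).
    apply: leq_msum => js sj; apply: leq_trans (H2 (S := w js) _ _) _.
    - by apply: vert_uniq; rewrite ?enum_uniq // -cardE cS sj.
    - by rewrite size_vert -?cardE cS ?sj //; lia.
    - by rewrite leq_add2l leq_mul2l degE ?orbT.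
  have eh : msum (k - 1) (fun js => a * n + a * G * ((n - p * t) + \sum_i \sum_j edge E (c i j :: w js))) =
    a * n * t ^ (k - 1) + a * G * ((n - p * t) * t ^ (k - 1) + \sum_i X i).
    rewrite (msumD _ (fun=> a * n)) (msumM _ (a * G)) (msumD _ (fun=> n - p * t)) !msum_const msum_sum card_ord.
    by congr (_ + _ * (_ + _)); apply: eq_bigr => i _; apply: XE.
  rewrite msum_const card_ord eh in h.
  have := leq_mul (leqnn H) h.
  have := leq_mul (leqnn (a * G)) sX.
  have -> : t ^ k = t * t ^ (k - 1) by rewrite -expnS; congr (_ ^ _); lia.
  move: (t ^ (k - 1)) (\sum_i X i) (n - p * t) (H * (k - 1 + #|N|) + p) => T SX y z.
  clear; move=> h1 h2.
  have e1 : H * (G * n * T) = H * G * n * T by ring.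
  have e2 : H * (a * n * T + a * G * (y * T + SX)) = H * a * n * T + a * G * H * y * T + a * G * (H * SX) by ring.
  have e3 : (H * a * n + a * G * (H * y + t * z)) * T = H * a * n * T + a * G * H * y * T + a * G * (t * T * z) by ring.
  by rewrite e1 e2 in h2; rewrite e3; lia.
have ptn : p * t <= n by rewrite -(card_clusters cinj) max_card.
move: #|N| main => m main; case: (leqP p (a * m)) => [h|h].
  by have -> : p - a * m = 0 by lia.
have : exists y, p = y + a * m by exists (p - a * m); lia.
case=> y pE; have -> : p - a * m = y by lia.
have G2 : 2 <= G by apply: leq_trans (leq_trans k2 (leq_pmull k _)) hG; rewrite !muln_gt0 Dn0; clear -ka; lia.
have H0 : 0 < H by apply: leq_trans hH; rewrite !muln_gt0 Dn0; clear -k2 ka; lia.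
have nz : n - p * t <= #|Z| + t by lia.
have n4 : n <= 4 * (p * t).
  have : 2 * #|Z| <= n by apply: leq_trans H4; rewrite leq_mul2r G2 orbT.
  have : t <= p * t by rewrite leq_pmull //; lia.
  lia.
have s1 : H * G * n <= H * a * n + a * G * (H * (#|Z| + t) + t * (H * (k - 1 + m) + p)).
  apply: leq_trans main _; rewrite leq_add2l leq_mul2l leq_add2r leq_mul2l nz !orbT //.
have s2 : t * (G * H * y) <= t * (8 * a * H * p + a * G * H * k + a * G * p).
  have e1 : H * G * (p * t) = t * (G * H * y) + a * G * H * t * m.
    by rewrite [in LHS]pE; ring.
  have e2 : a * G * (H * (#|Z| + t) + t * (H * (k - 1 + m) + p)) =
    a * H * (G * #|Z|) + a * G * H * t * k + a * G * H * t * m + a * G * t * p.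
    have -> : k = (k - 1).+1 by lia.
    by rewrite subn1 /=; ring.
  have e3 : a * H * (G * #|Z|) <= a * H * n by rewrite leq_mul2l H4 orbT.
  have e4 : a * H * n <= a * H * (4 * (p * t)) by rewrite leq_mul2l n4 orbT.
  have e5 : H * G * (p * t) <= H * G * n by rewrite leq_mul2l ptn orbT.
  have e6 : t * (8 * a * H * p + a * G * H * k + a * G * p) =
    2 * (a * H * (4 * (p * t))) + a * G * H * t * k + a * G * t * p by ring.
  have e7 : H * a * n = a * H * n by ring.
  move: s1; rewrite e2 e7 e6; clear -e1 e3 e4 e5; lia.
move: s2; rewrite leq_pmul2l // => s2.
have p0 : 0 < p by lia.
have : 3 * (G * H * p) * y * (4 * Dn * k) <= 3 * (G * H * p) * p.
  have := leq_mul s2 (leqnn (12 * Dn * k * p)).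
  have -> : G * H * y * (12 * Dn * k * p) = 3 * (G * H * p) * y * (4 * Dn * k) by ring.
  move/leq_trans; apply.
  have -> : (8 * a * H * p + a * G * H * k + a * G * p) * (12 * Dn * k * p) =
    H * p * p * (96 * a * Dn * k) + G * H * p * (12 * a * Dn * k * k) + G * p * p * (12 * a * Dn * k) by ring.
  have f1 := leq_mul (leqnn (H * p * p)) hG.
  have f2 := leq_mul (leqnn (G * H * p)) hp.
  have f3 := leq_mul (leqnn (G * p * p)) hH.
  have -> : 3 * (G * H * p) * p = H * p * p * G + G * H * p * p + G * p * p * H by ring.
  lia.
by rewrite -mulnA leq_pmul2l // !muln_gt0 H0 p0; lia.
Qed.

(** Otherwise [dual_bound] applies. Its set [N] has nearly [p / a] clusters and the clusters outside
    [S] and [N] span almost no edges; their union, adjusted to the critical size, contradicts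
    [H3]. *)
Lemma dual_edge (f : 'I_p -> nat) : k <= p ->
  exists K, [/\ size K = k, uniq K, dedge K & p * cost k a f K <= a * (k - 1) * \sum_i f i].
Proof.
move=> kp; apply: contrapT => hno.
have hR K : size K = k -> uniq K -> dedge K -> a * (k - 1) * (\sum_i f i) < p * cost k a f K.
  move=> sK uK RK; rewrite ltnNge; apply/negP => h; apply: hno; by exists K.
have [S [cS]] := dual_bound k2 ka kp hR; set N := [set u | _] => hN.
have hA := codeg_clusters cS (erefl N).
have p0 : 0 < p by lia.
have N0 : 0 < #|N|.
  case: posnP => // N0; move: hA; rewrite N0 muln0 subn0 => h.
  have : p * (4 * Dn * k) <= p * 1 by rewrite muln1.
  by rewrite leq_pmul2l //; nia.
have {hN} [aN hN] := hN N0.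
set y := p - a * #|N| in hA hN.
pose O := ~: (S :|: N).
have cO : #|O| + #|N| + k >= p + 1.
  have := cardsC (S :|: N); rewrite card_ord -/O cardsU; lia.
pose Bc := [set c q.1 q.2 | q in setX O [set: 'I_t]].
have cBc : #|Bc| = #|O| * t.
  by rewrite card_imset ?cardsX ?cardsT ?card_ord // => -[i j] [i' j'] /cinj /= [-> ->].
have ptn : p * t <= n by rewrite -(card_clusters cinj) max_card.
have hB := H3; set nB := ((a - 1) * n) %/ a in hB.
have nBle : nB <= #|Bc| + #|Z| + (k + 1) * t.
  have a0 : 0 < a by lia.
  rewrite -(leq_pmul2r a0); apply: leq_trans (leq_trunc_div _ _) _.
  have h1 : (a - 1) * n <= (a - 1) * (#|Z| + p * t + t) by rewrite leq_mul2l cZ orbT.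
  apply: leq_trans h1 _; rewrite cBc.
  have h2 : (p + 1) * (a * t) <= (#|O| + #|N| + k) * (a * t) by rewrite leq_mul2r cO orbT.
  have h3 : a * #|N| * t <= p * t by rewrite leq_mul2r aN orbT.
  have aE : a = (a - 1).+1 by lia.
  move: h2 h3; rewrite aE subn1 /=; move: #|O| #|N| #|Z| (a.-1) => x1 x2 x3 x4; clear => h2 h3.
  nia.
have [B cB BX] : exists2 B : {set V}, #|B| = nB & #|B :\: Bc| <= #|Z| + (k + 1) * t.
  have nBn : nB <= n by apply: leq_trans (leq_div2r a (leq_mul (leq_subr 1 a) (leqnn n))) _; rewrite mulKn //; lia.
  have [B cB BX] := set_near Bc nBn; exists B => //; apply: leq_trans BX _; lia.
have := hB B cB; rewrite ltnNge; case/negP.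
set X := B :\: Bc in BX.
(* An edge inside [B] meets the few vertices outside [Bc] or lies inside [Bc]. The two kinds will
   use up one quarter and three quarters of the bound [n ^ k / Dn]. *)
pose A1 := cnt k (has (mem X)).
pose A2 := cnt k (fun s => edge E s && all (mem Bc) s).
have hA1 : n * A1 <= k * n ^ k * #|X| by exact: cnt_has.
have eA : edges_in E B <= A1 + A2.
  apply: leq_trans (edges_cnt B H1) _; apply: cnt_or => s _ /andP[Es /allP sB].
  rewrite Es /=; case: (boolP (has _ s)) => //= hX; apply/allP => x xs.
  apply: contraNT hX => xB; apply/hasP; exists x => //=; rewrite inE xB; exact: sB.
have hA2 : p * (H * A2) <= (p * t) ^ k * (p + H * (k * y + k * k)).
  pose P1 (K : seq 'I_p) := [&& uniq K, dedge K & all (fun x => (x \notin S) && (x \notin N)) K].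
  pose P2 (K : seq 'I_p) := ~~ (uniq K && ~~ has (mem [::]) K).
  have h1 : A2 <= msum k (fun K => msum k (fun js => edge E (vert c K js) && all (mem Bc) (vert c K js))).
    rewrite -(msum_vert cinj k (fun s => edge E s && all (mem Bc) s)); apply: leq_msum => s _.
    case: (edge E s) => //=; case: (boolP (all (mem Bc) s)) => // /allP hs.
    suff -> : all (mem (clusters c)) s by [].
    by apply/allP => x /hs /imsetP[q _ ->]; apply/imsetP; exists q.
  (* A cluster tuple may contribute fully if it is a dense edge avoiding [S] and [N], or if it
     repeats a cluster; any other contributes at most a fraction [1 / H]. *)
  have h2 : H * A2 <= msum k (fun K => t ^ k * (1 + H * (P1 K + P2 K))).
    apply: leq_trans (leq_mul (leqnn H) h1) _; rewrite -msumM; apply: leq_msum => K sK.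
    have all_le : msum k (fun js => edge E (vert c K js) && all (mem Bc) (vert c K js)) <= t ^ k.
      by rewrite -[t in X in _ <= X]card_ord; apply: cnt_le_all.
    have H_le b : 0 < b -> H * msum k (fun js => edge E (vert c K js) && all (mem Bc) (vert c K js))
        <= t ^ k * (1 + H * b).
      move=> b0; apply: leq_trans (leq_mul (leqnn H) all_le) _.
      by rewrite mulnDr mulnA [H * _]mulnC; apply: leq_trans (leq_addl _ _); rewrite leq_pmulr.
    case: (boolP (uniq K)) => uK; last by apply: H_le; rewrite /P2 negb_and uK addn_gt0 orbT.
    case: (boolP (all (mem O) K)) => KO; last first.
      rewrite (eq_msum (g := fun=> 0)) ?msum_const ?mul0n ?muln0 //.
      move=> js sj; case: (boolP (all (mem Bc) _)); rewrite ?andbF // => /allP hB2.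
      case/negP: KO; apply/allP => i.
      rewrite -{1}(@unzip1_zip _ _ K js) ?sK ?sj // => /mapP[[i' j] ij /= ->].
      have := hB2 (c i' j) (map_f _ ij) => /imsetP[[i1 j1]]; rewrite inE /= => /andP[i1O _].
      by move/cinj => [-> _].
    case: (boolP (dedge K)) => RK.
      apply: H_le; rewrite /P1 uK RK /=; suff -> : all (fun x => (x \notin S) && (x \notin N)) K by [].
      by apply: sub_all KO => x /=; rewrite !inE negb_or.
    apply: leq_trans (_ : H * cnt k (fun js => edge E (vert c K js)) <= _).
      by rewrite leq_mul2l; apply/orP; right; apply: cnt_le => js _ /andP[].
    move: RK; rewrite /dedge /dense -ltnNge card_ord => /ltnW /leq_trans; apply.
    by rewrite mulnDr muln1 leq_addr.
  have h3 := leq_mul (leqnn p) h2; apply: leq_trans h3 _.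
  rewrite msumM msumD msum_const msumM msumD card_ord mul1n.
  have h4 := cnt_meet k ([::] : seq 'I_p); rewrite card_ord addn0 in h4.
  rewrite -/(cnt k P1) -/(cnt k P2) expnMn.
  move: hN h4; rewrite -/P1 -/P2; move: (cnt k P1) (cnt k P2) (p ^ k) (t ^ k) => c1 c2 u v; clear => h1 h2.
  have -> : p * (v * (u + H * (c1 + c2))) = v * (u * p) + v * H * (p * c1) + v * H * (p * c2) by ring.
  have -> : u * v * (p + H * (k * y + k * k)) = v * (u * p) + v * H * (k * u * y) + v * H * (k * k * u) by ring.
  by rewrite -!addnA leq_add2l leq_add ?leq_mul2l ?h1 ?h2 ?orbT.
have H0 : 0 < H by apply: leq_trans hH; rewrite !muln_gt0 Dn0; clear -k2 ka; lia.
have n0 : 0 < n by apply: leq_trans ptn; rewrite muln_gt0 p0.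
have X1 : 4 * Dn * A1 <= n ^ k.
  rewrite -(leq_pmul2l n0).
  have -> : n * (4 * Dn * A1) = 4 * Dn * (n * A1) by ring.
  apply: leq_trans (leq_mul (leqnn _) hA1) _.
  have -> : 4 * Dn * (k * n ^ k * #|X|) = 4 * Dn * k * #|X| * n ^ k by ring.
  rewrite leq_mul2r; apply/orP; right.
  rewrite -(leq_pmul2l (_ : 0 < 2)) //.
  apply: leq_trans (leq_mul (leqnn 2) (leq_mul (leqnn _) BX)) _.
  have -> : 2 * (4 * Dn * k * (#|Z| + (k + 1) * t)) = 8 * Dn * k * #|Z| + 8 * Dn * k * (k + 1) * t by ring.
  have f1 : 8 * Dn * k * #|Z| <= n.
    apply: leq_trans H4; rewrite leq_mul2r; apply/orP; right; apply: leq_trans hG.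
    by rewrite -!mulnA; apply: leq_mul => //; rewrite leq_pmull //; lia.
  have f2 : 8 * Dn * k * (k + 1) * t <= n.
    apply: leq_trans ptn; rewrite leq_mul2r; apply/orP; right; apply: leq_trans hp.
    have -> : 8 * Dn * k * (k + 1) = Dn * k * (8 * (k + 1)) by ring.
    have -> : 12 * a * Dn * k * k = Dn * k * (12 * (a * k)) by ring.
    rewrite leq_mul2l; apply/orP; right; clear -k2 ka; nia.
  lia.
have X2 : 4 * Dn * A2 <= 3 * n ^ k.
  have pH0 : 0 < p * H by rewrite muln_gt0 p0.
  rewrite -(leq_pmul2l pH0).
  have -> : p * H * (4 * Dn * A2) = 4 * Dn * (p * (H * A2)) by ring.
  apply: leq_trans (leq_mul (leqnn _) hA2) _.
  have h : (p * t) ^ k <= n ^ k by exact: leq_exp2.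
  apply: (@leq_trans ((p * t) ^ k * (3 * (p * H)))); last first.
    by have -> : p * H * (3 * n ^ k) = n ^ k * (3 * (p * H)) by [ring]; rewrite leq_mul2r h orbT.
  have -> : 4 * Dn * ((p * t) ^ k * (p + H * (k * y + k * k))) =
    (p * t) ^ k * (p * (4 * Dn) + H * (y * (4 * Dn * k)) + H * (4 * Dn * k * k)) by ring.
  rewrite leq_mul2l; apply/orP; right.
  have f1 : p * (4 * Dn) <= p * H.
    rewrite leq_mul2l; apply/orP; right; apply: leq_trans hH.
    have -> : 12 * a * Dn * k = 4 * Dn * (3 * a * k) by ring.
    by rewrite leq_pmulr // !muln_gt0; clear -k2 ka; lia.
  have f2 : H * (y * (4 * Dn * k)) <= H * p by rewrite leq_mul2l hA orbT.
  have f3 : H * (4 * Dn * k * k) <= H * p.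
    rewrite leq_mul2l; apply/orP; right; apply: leq_trans hp.
    have -> : 12 * a * Dn * k * k = 3 * a * (4 * Dn * k * k) by ring.
    by rewrite leq_pmull //; clear -ka; lia.
  clear -f1 f2 f3; lia.
have := leq_mul (leqnn (4 * Dn)) eA; rewrite mulnDr.
have e4 : 4 * Dn * edges_in E B = 4 * (Dn * edges_in E B) by ring.
lia.
Qed.

End DualEdge.

(** * Tiling *)

Section Balance.
Variables (k a p : nat) (R : seq 'I_p -> Prop).
Hypotheses (k2 : 2 <= k) (a0 : 0 < a).
Hypothesis hR : forall K, R K -> size K = k /\ uniq K.
Hypothesis hD : forall f : 'I_p -> nat, exists2 K, R K & p * cost k a f K <= a * (k - 1) * \sum_i f i.

(** The load of a pointed edge on a cluster: the part sizes of a tile of scale 1. *)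
Definition wt (K : seq 'I_p) (i : 'I_p) : nat :=
  if K is h :: tl then (k - 1) * (i == h) + (a - 1) * count_mem i tl else 0.
Definition load (es : seq (seq 'I_p)) i := \sum_(K <- es) wt K i.

Lemma sumM c (F : 'I_p -> nat) : \sum_i c * F i = c * \sum_i F i.
Proof. by rewrite big_distrr. Qed.

Lemma sum_count (f : 'I_p -> nat) (s : seq 'I_p) :
  \sum_i f i * count_mem i s = \sum_(x <- s) f x.
Proof.
elim: s => [|x s IH]; first by rewrite big_nil big1 // => i _; rewrite muln0.
rewrite big_cons -IH (eq_bigr (fun i => f i * (x == i) + f i * count_mem i s)); last first.
  by move=> i _ /=; rewrite mulnDr.
rewrite big_split /=; congr (_ + _); rewrite (bigD1 x) //= eqxx muln1 big1 ?addn0 // => i.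
by rewrite eq_sym => /negbTE ->; rewrite muln0.
Qed.

Lemma cost_wt f K : \sum_i f i * wt K i = cost k a f K.
Proof.
case: K => [|h tl] /=; first by rewrite big1 // => i _; rewrite muln0.
rewrite -[X in _ = _ * X + _](_ : \sum_i f i * count_mem i [:: h] = f h); last first.
  by rewrite sum_count big_seq1.
rewrite -(sum_count f tl) -!sumM -big_split /=; apply: eq_bigr => i _.
by rewrite addn0 eq_sym; ring.
Qed.

Lemma sum_wt K : size K = k -> \sum_i wt K i = a * (k - 1).
Proof.
move=> sK; rewrite (eq_bigr (fun i => 1 * wt K i)) ?cost_wt; last by move=> i _; rewrite mul1n.
case: K sK => [|h tl] /= sK; first by lia.
rewrite big_const_seq count_predT iter_addn_0 mul1n muln1.
have -> : size tl = k - 1 by rewrite -sK subn1.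
by rewrite -mulSn; congr (_ * _); lia.
Qed.

Definition wt2 := (k - 1) ^ 2 + (k - 1) * (a - 1) ^ 2.

Lemma sum_wt2 K : size K = k -> uniq K -> \sum_i wt K i ^ 2 <= wt2.
Proof.
case: K => [|h tl] //= sK; first by lia.
case/andP=> htl utl.
rewrite (eq_bigr (fun i => (k - 1) ^ 2 * count_mem i [:: h] + (a - 1) ^ 2 * count_mem i tl)); last first.
  move=> i _ /=; rewrite addn0 eq_sym; case: eqVneq => [<-|_] /=.
    by rewrite (count_memPn htl) !muln0 !addn0 !muln1.
  by rewrite !muln0 !add0n expnMn (count_uniq_mem _ utl); case: (i \in tl).
have stl : size tl = k - 1 by rewrite -sK subn1.
have cm (s : seq 'I_p) : \sum_i count_mem i s = size s.
  rewrite -(eq_bigr _ (fun i _ => mul1n _)) (sum_count (fun=> 1)).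
  by rewrite big_const_seq count_predT iter_addn_0 mul1n.
have e1 := sumM ((k - 1) ^ 2) (fun i => count_mem i [:: h]).
have e2 := sumM ((a - 1) ^ 2) (fun i => count_mem i tl).
by rewrite big_split /= {}e1 {}e2 cm cm stl muln1 /wt2 [X in _ + X]mulnC.
Qed.

Lemma sum_load es : (forall K, K \in es -> R K) -> \sum_i load es i = size es * (a * (k - 1)).
Proof.
move=> h; rewrite exchange_big /=.
rewrite (eq_big_seq (fun=> a * (k - 1))); last by move=> K /h /hR [sK _]; exact: sum_wt.
by rewrite big_const_seq count_predT iter_addn_0 mulnC.
Qed.

(* Always adding an edge that is cheap for the current loads keeps the sum of their squares near its minimum. *)
Lemma greedy_balance N : exists es : seq (seq 'I_p), [/\ size es = N, forall K, K \in es -> R K &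
  p * \sum_i load es i ^ 2 <= (N * (a * (k - 1))) ^ 2 + p * N * wt2].
Proof.
elim: N => [|N [es [sN hes IH]]].
  exists [::]; split=> //; rewrite big1 ?muln0 // => i _; by rewrite /load big_nil.
have [K RK hK] := hD (load es); have [sK uK] := hR RK.
exists (K :: es); split=> /=; first by rewrite sN.
  by move=> K'; rewrite inE => /orP[/eqP ->|/hes].
rewrite (eq_bigr (fun i => wt K i ^ 2 + 2 * (load es i * wt K i) + load es i ^ 2)); last first.
  by move=> i _; rewrite /load big_cons; ring.
have e := sumM 2 (fun i => load es i * wt K i).
rewrite big_split big_split /= {}e cost_wt.
have := sum_wt2 sK uK; rewrite sum_load // sN in hK.
move: (\sum_i wt K i ^ 2) (cost _ _ _ _) (\sum_i load es i ^ 2) hK IH => x y z; move: (a * (k - 1)) wt2 => w c; clear.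
move=> h1 h2 h3.
have := leq_mul (leqnn p) h3.
have -> : (N.+1 * w) ^ 2 = (N * w) ^ 2 + 2 * (w * (N * w)) + w ^ 2 by ring.
have -> : p * N.+1 * c = p * N * c + p * c by ring.
rewrite !mulnDr; lia.
Qed.

(** Delete edges through overloaded clusters one at a time; each deletion lowers the total excess
    over [B] by at least one. *)
Lemma prune B (es : seq (seq 'I_p)) : (forall K, K \in es -> R K) -> exists es' : seq (seq 'I_p),
  [/\ forall K, K \in es' -> R K, forall i, load es' i <= B &
    size es <= size es' + \sum_i (load es i - B)].
Proof.
move: {2}(size es) (erefl (size es)) => m; elim: m es => [|m IH] es sm hes.
  exists es; split=> //; last by rewrite leq_addr.
  by rewrite (size0nil sm) => i; rewrite /load big_nil.
case: (pselect (forall i, load es i <= B)) => [h|/existsNP[i /negP]].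
  by exists es; split=> //; rewrite leq_addr.
rewrite -ltnNge => hi.
have [K Kes wK] : exists2 K, K \in es & 0 < wt K i.
  apply: contrapT => hno; have : load es i = 0.
    rewrite /load big1_seq // => K /andP[_ Kes].
    by case: (posnP (wt K i)) => // h; case: hno; exists K.
  by move=> h0; rewrite h0 in hi.
have pe := perm_to_rem Kes.
have sr : size (rem K es) = m by rewrite size_rem // sm.
have hr K' : K' \in rem K es -> R K' by move/mem_rem/hes.
have [es' [h1 h2 h3]] := IH _ sr hr.
exists es'; split=> //; rewrite sm; rewrite sr in h3.
apply: leq_ltn_trans h3 _; rewrite ltn_add2l.
have le j : load (rem K es) j + wt K j = load es j.
  by rewrite /load (perm_big _ pe) /= big_cons addnC.
rewrite (bigD1 i) //= [X in _ < X](bigD1 i) //= -addSn leq_add //.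
  by have := le i; lia.
by apply: leq_sum => j _; have := le j; lia.
Qed.

(** The average load is [lam], and [dl] times the excess of a load over [lam + dl] is at most the
    square of its deviation from [lam]. So the bound of [greedy_balance] limits the number of edges
    lost in pruning. *)
Lemma balanced c0 dl : exists es : seq (seq 'I_p), [/\ forall K, K \in es -> R K,
  forall i, load es i <= c0 * (a * (k - 1)) + dl &
  dl * (c0 * p) <= dl * size es + p * c0 * wt2].
Proof.
have [es [sN hes h]] := greedy_balance (c0 * p).
set lam := c0 * (a * (k - 1)).
have [es' [h1 h2 h3]] := prune (lam + dl) hes.
exists es'; split=> //; rewrite sN in h3.
apply: leq_trans (leq_mul (leqnn dl) h3) _; rewrite mulnDr leq_add2l.
have sumE : \sum_i load es i = p * lam by rewrite sum_load // sN /lam; ring.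
case: (posnP p) => [p0|p0].
  have -> : \sum_i (load es i - (lam + dl)) = 0 by rewrite big1 // => -[i hi]; exfalso; move: (hi); rewrite p0.
  by rewrite muln0.
have key x : dl * (x - (lam + dl)) + 2 * lam * x <= x ^ 2 + lam ^ 2.
  case: (leqP x (lam + dl)) => hx.
    have -> : x - (lam + dl) = 0 by lia.
    by rewrite muln0 add0n -mulnA [lam * x]mulnC nat_Cauchy.
  have -> : x = lam + dl + (x - (lam + dl)) by lia.
  move: (x - _) => y; rewrite addKn; nia.
have : \sum_(i < p) (dl * (load es i - (lam + dl)) + 2 * lam * load es i) <=
       \sum_(i < p) (load es i ^ 2 + lam ^ 2) by apply: leq_sum.
have e1 := sumM dl (fun i => load es i - (lam + dl)).
have e2 := sumM (2 * lam) (load es).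
rewrite !big_split /= {}e1 {}e2 sumE sum_nat_const card_ord => h4.
have h5 : \sum_i load es i ^ 2 <= p * lam ^ 2 + p * c0 * wt2.
  rewrite -(leq_pmul2l p0); apply: leq_trans h _; rewrite /lam; apply/eq_leq; ring.
rewrite -(leq_add2r (2 * lam * (p * lam))); apply: leq_trans h4 _.
apply: leq_trans (leq_add h5 (leqnn _)) _.
by apply/eq_leq; ring.
Qed.

End Balance.

(** * Tiles inside dense tuples of clusters *)

Section Tiles.
Variables (k a : nat).
Hypotheses (k2 : 2 <= k) (ka : k < a).

(* Part 0 plays the role of the head of a pointed edge. *)
Definition psz t i := if i == 0 then (k - 1) * t else (a - 1) * t.

Definition tile (V : finType) (E : {set {set V}}) t (X : seq (seq V)) : Prop :=
  [/\ [seq size s | s <- X] = [seq psz t i | i <- iota 0 k], uniq (flatten X) &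
      forall w : seq V, all2 (fun x (s : seq V) => x \in s) w X -> edge E w].

Lemma psz_le t i : psz t i <= (a - 1) * t.
Proof. by rewrite /psz; case: ifP => // _; rewrite leq_mul2r; apply/orP; right; lia. Qed.

Section OneTile.
Variables (V : finType) (E : {set {set V}}) (p t : nat) (c : 'I_p -> 'I_t -> V).
Hypothesis cinj : forall i j i' j', c i j = c i' j' -> i = i' /\ j = j'.
Variables (H t' : nat).
Local Notation T := ((a - 1) * t').

(** At least half of the density survives when the tuples meeting the used vertices [W] are
    discarded. A blow-up with all parts of size [T] is found among the rest, and its parts are
    trimmed to the sizes of a tile. *)
Lemma one_tile (K : seq 'I_p) (W : seq V) B C :
  (forall Q : pred (seq 'I_t), 0 < #|'I_t| -> dense (2 * H) k Q -> dense C (k * T) (blow T k Q)) ->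
  0 < t' -> 0 < t -> 0 < H ->
  2 * C * (k * T * (k * T)) <= t -> 2 * H * k * k * B * t' <= t ->
  size K = k -> uniq K -> dedge E k H c K ->
  (forall i, #|[set j | c i j \in W]| <= t' * B) ->
  exists X, [/\ tile E t' X, ~~ has (mem W) (flatten X),
    {subset flatten X <= clusters c} &
    forall i, #|[set j | c i j \in flatten X]| <= t' * wt k a K i].
Proof.
move=> hC t'0 t0 H0 hCt hB sK uK RK hW.
have j0 : 'I_t by exact: (Ordinal t0).
have i0 : 'I_p by case: K sK {uK RK} => [|i K _] //=; lia.
pose Q js := edge E (vert c K js) && ~~ has (mem W) (vert c K js).
have hQ : dense (2 * H) k Q.
  pose U := [pred j | has (fun i => c i j \in W) K].
  have cU : #|U| <= k * (t' * B).
    rewrite -sK /U; elim: (K) => [|i K' IH] /=; first by rewrite leqn0; apply/eqP/eq_card0.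
    apply: (@leq_trans #|[set j | c i j \in W] :|: [set j | has (fun i => c i j \in W) K']|).
      by apply/subset_leq_card/subsetP => j; rewrite !inE.
    rewrite cardsU mulSn; apply: leq_trans (leq_subr _ _) _; apply: leq_add => //.
    by rewrite cardsE.
  have h1 : cnt k (fun js => edge E (vert c K js)) <= cnt k Q + cnt k (has U).
    apply: cnt_or => js sj Ej; rewrite /Q Ej /=.
    case: (boolP (has (mem W) _)) => //= /hasP[x /mapP[[i j] ij ->] /= xW].
    apply/hasP; exists j.
      by rewrite -(@unzip2_zip _ _ K js) ?sj ?sK //; apply: (map_f snd ij).
    apply/hasP; exists i => //.
    by rewrite -(@unzip1_zip _ _ K js) ?sj ?sK //; apply: (map_f fst ij).
  have h2 := cnt_has k U; rewrite card_ord in h2.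
  move: RK; rewrite /dedge /dense card_ord => h3.
  have h4 : 2 * H * cnt k (has U) <= t ^ k.
    rewrite -(leq_pmul2l t0).
    have -> : t * (2 * H * cnt k (has U)) = 2 * H * (t * cnt k (has U)) by ring.
    apply: leq_trans (leq_mul (leqnn _) h2) _.
    apply: leq_trans (leq_mul (leqnn _) (leq_mul (leqnn _) cU)) _.
    have -> : 2 * H * (k * t ^ k * (k * (t' * B))) = 2 * H * k * k * B * t' * t ^ k by ring.
    by rewrite leq_mul2r hB orbT.
  have := leq_mul (leqnn (2 * H)) h1; rewrite mulnDr.
  have -> : 2 * H * cnt k (fun js => edge E (vert c K js)) = 2 * (H * cnt k (fun js => edge E (vert c K js))) by ring.
  move: (2 * H * cnt k Q) h3 h4 => x; move: (H * _) (2 * H * _) (t ^ k) => y z u; lia.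
have ct0 : 0 < #|'I_t| by rewrite card_ord.
have cC : 2 * C * (k * T * (k * T + size ([::] : seq 'I_t))) <= #|'I_t| by rewrite card_ord addn0.
have [b [sb hb ub _]] := dense_has ct0 cC (hC Q ct0 hQ).
have T0 : 0 < T by rewrite muln_gt0 t'0 andbT; lia.
have ltb i m : i < k -> m < T -> i * T + m < k * T.
  move=> ik mT; apply: (@leq_trans (i.+1 * T)); last by rewrite leq_mul2r ik orbT.
  by rewrite mulSn addnC ltn_add2r.
pose f i m := c (nth i0 K i) (nth j0 b (i * T + m)).
pose part i := [seq f i m | m <- iota 0 (psz t' i)].
have finj i m i' m' : i < k -> i' < k -> m < T -> m' < T -> f i m = f i' m' -> i = i' /\ m = m'.
  move=> ik ik' mT mT' /cinj[/eqP]; rewrite nth_uniq ?sK // => /eqP <- /eqP.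
  by rewrite nth_uniq ?sb ?ltb // => /eqP; split=> //; lia.
have hf (g : nat -> nat) : (forall i, g i < T) -> edge E [seq f i (g i) | i <- iota 0 k] &&
    ~~ has (mem W) [seq f i (g i) | i <- iota 0 k].
  move=> gT; have := blowP j0 sb gT hb; rewrite /Q.
  suff -> : vert c K [seq nth j0 b (i * T + g i) | i <- iota 0 k] = [seq f i (g i) | i <- iota 0 k] by [].
  apply: (@eq_from_nth _ (c i0 j0)); first by rewrite size_vert !size_map size_iota.
  rewrite size_vert ?size_map ?size_iota // sK => i ik.
  rewrite (nth_map (i0, j0)) ?size1_zip ?size_map ?size_iota ?sK // nth_zip ?size_map ?size_iota //=.
  by rewrite !(nth_map 0) ?size_iota // nth_iota.
exists [seq part i | i <- iota 0 k]; split; first split.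
- by rewrite -map_comp; apply: eq_map => i /=; rewrite size_map size_iota.
- apply: allpairs_uniq_dep => [|i _|[i m] [i' m']]; rewrite ?iota_uniq //.
  move=> /allpairsPdep[x [y [hx hy [-> ->]]]] /allpairsPdep[x' [y' [hx' hy' [-> ->]]]] /=.
  rewrite !mem_iota /= !add0n in hx hy hx' hy'.
  case/finj => //; try exact: leq_trans hy (psz_le _ _); try exact: leq_trans hy' (psz_le _ _).
  by move=> -> ->.
- move=> w hw.
  pose v0 := c i0 j0.
  have sw : size w = k by move: hw; rewrite all2E size_map size_iota => /andP[/eqP].
  have wp i : i < k -> nth v0 w i \in part i.
    move=> ik; move: hw; rewrite all2E => /andP[_] /(all_nthP (v0, [::])) /(_ i).
    rewrite size_zip sw size_map size_iota minnn => /(_ ik).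
    by rewrite nth_zip ?size_map ?size_iota //= (nth_map 0) ?size_iota // nth_iota.
  pose g i := if i < k then index (nth v0 w i) (part i) else 0.
  have gp i : i < k -> g i < psz t' i.
    by move=> ik; rewrite /g ik; have := wp i ik; rewrite -index_mem size_map size_iota.
  have gT i : g i < T.
    case: (ltnP i k) => ik; first by apply: leq_trans (gp i ik) (psz_le _ _).
    by rewrite /g (leq_gtF ik).
  have /andP[+ _] := hf g gT; suff -> : [seq f i (g i) | i <- iota 0 k] = w by [].
  apply: (@eq_from_nth _ v0); rewrite size_map size_iota ?sw // => i ik.
  rewrite (nth_map 0) ?size_iota // nth_iota // add0n.
  have gE : g i = index (nth v0 w i) (part i) by rewrite /g ik.
  by have := nth_index v0 (wp i ik); rewrite -gE (nth_map 0) ?size_iota ?gp // nth_iota ?gp // add0n.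
- apply/hasPn => x /allpairsPdep[i [m [hi hm ->]]].
  rewrite !mem_iota /= !add0n in hi hm.
  have mT : m < T by apply: leq_trans hm (psz_le _ _).
  have /andP[_ /hasPn] := hf (fun=> m) (fun=> mT); apply.
  by apply: (map_f (f^~ m)); rewrite mem_iota.
- move=> x /allpairsPdep[i [m [_ _ ->]]].
  by apply/imsetP; exists (nth i0 K i, nth j0 b (i * T + m)).
- move=> i; set S := [set j | _].
  have hS j : j \in S -> exists i' m, [/\ i' < k, m < psz t' i', i = nth i0 K i' & j = nth j0 b (i' * T + m)].
    rewrite inE => /allpairsPdep[i' [m [hi hm]]] /cinj[-> ->].
    by rewrite !mem_iota /= !add0n in hi hm; exists i', m.
  case: (boolP (i \in K)) => iK; last first.
    have -> : S = set0.
      apply/setP => j; rewrite in_set0; apply/negbTE; apply: contra iK => /hS[i' [m [ik _ -> _]]].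
      by rewrite mem_nth ?sK.
    by rewrite cards0.
  apply: (@leq_trans (psz t' (index i K))).
    apply: leq_trans (_ : size [seq nth j0 b (index i K * T + m) | m <- iota 0 (psz t' (index i K))] <= _); last by rewrite size_map size_iota.
    apply: leq_trans (card_size _); apply/subset_leq_card/subsetP => j /hS[i' [m [ik hm -> ->]]].
    rewrite index_uniq ?sK //; apply: (map_f (fun m => nth j0 b (i' * T + m))).
    by rewrite mem_iota.
  rewrite mulnC; move: iK uK; case: (K) => [|h tl] //=; rewrite inE => iK /andP[htl utl].
  rewrite eq_sym; case: (eqVneq i h) iK => [_ _|hi] /=.
    by rewrite /psz eqxx muln1 leq_mul2r leq_addr orbT.
  move=> itl; rewrite /psz /= muln0 add0n leq_mul2r; apply/orP; right.
  by rewrite leq_pmulr // -has_count has_pred1.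
Qed.

End OneTile.

(** The tiles already placed use at most [t' * B] vertices of a cluster, which the bound on [t]
    makes a proportion small enough for [one_tile] to go on. *)
Lemma realize H t' : 0 < t' -> 0 < H -> exists C0, forall (V : finType) (E : {set {set V}}) p t
  (c : 'I_p -> 'I_t -> V), (forall i j i' j', c i j = c i' j' -> i = i' /\ j = j') ->
  forall B, C0 <= t -> 2 * H * k * k * B * t' <= t ->
  forall es : seq (seq 'I_p), (forall K, K \in es -> [/\ size K = k, uniq K & dedge E k H c K]) ->
  (forall i, load k a es i <= B) ->
  exists Xs : seq (seq (seq V)), [/\ size Xs = size es, forall X, X \in Xs -> tile E t' X,
    uniq (flatten (map flatten Xs)), {subset flatten (map flatten Xs) <= clusters c} &
    forall i, #|[set j | c i j \in flatten (map flatten Xs)]| <= t' * load k a es i].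
Proof.
move=> t'0 H0; have [C hC] := blow_dense ((a - 1) * t').-1 k (2 * H).
have T0 : 0 < (a - 1) * t' by rewrite muln_gt0 t'0 andbT; lia.
rewrite prednK // in hC; set T := (a - 1) * t' in hC T0.
exists (2 * C * (k * T * (k * T)) + 1) => V E p t c cinj B hCt hB; elim=> [|K es IH] hes hl.
  exists [::]; split=> // i; apply: (@leq_trans 0) => //.
  by rewrite leqn0; apply/eqP/eq_card0 => j; rewrite inE.
have le i : load k a es i <= load k a (K :: es) i by rewrite /load big_cons leq_addl.
have [Xs [h1 h2 h3 hC' h4]] : exists Xs : seq (seq (seq V)), [/\ size Xs = size es, forall X, X \in Xs -> tile E t' X,
    uniq (flatten (map flatten Xs)), {subset flatten (map flatten Xs) <= clusters c} &
    forall i, #|[set j | c i j \in flatten (map flatten Xs)]| <= t' * load k a es i].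
  apply: IH => [K' hK'|i]; first by apply: hes; rewrite inE hK' orbT.
  exact: leq_trans (le i) (hl i).
have [sK uK RK] := hes K (mem_head _ _).
have hW i : #|[set j | c i j \in flatten (map flatten Xs)]| <= t' * B.
  by apply: leq_trans (h4 i) _; rewrite leq_mul2l (leq_trans (le i) (hl i)) orbT.
have t0 : 0 < t by lia.
have cT : 2 * C * (k * T * (k * T)) <= t by lia.
have [X [tX dX sX cX]] := one_tile cinj (hC _) t'0 t0 H0 cT hB sK uK RK hW.
exists (X :: Xs); split=> /=.
- by rewrite h1.
- by move=> Y; rewrite inE => /orP[/eqP ->|/h2].
- by rewrite cat_uniq h3 has_sym dX; case: tX => _ ->.
- by move=> x; rewrite mem_cat => /orP[/sX|/hC'].
move=> i; rewrite /load big_cons mulnDr.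
apply: leq_trans (leq_add (cX i) (h4 i)); rewrite -cardsUI.
apply: leq_trans (leq_addr _ _); apply/subset_leq_card/subsetP => j.
by rewrite !inE mem_cat.
Qed.
End Tiles.

(** * Cutting old tiles into smaller ones around newly used vertices *)

Section Retile.
Variable V : finType.

(** The blocks are the clusters cut from a tile. A bound per cluster limits the loss of every part
    in proportion to its size, so the remaining parts still have the ratio required of a tile. *)
Definition blockle (W : seq V) t b (s : seq V) :=
  forall i, count (mem W) (take t (drop (i * t) s)) <= b.

Lemma blockle_catl W t b s1 s2 : 0 < t -> t %| size s1 -> blockle W t b (s1 ++ s2) -> blockle W t b s1.
Proof.
move=> t0 /dvdnP[m sm] h i; case: (ltnP i m) => im; last first.
  by rewrite drop_oversize // sm leq_mul2r im orbT.
have := h i; rewrite drop_cat sm ltn_mul2r t0 im /= take_cat size_drop sm -mulnBl.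
case: ltnP => // h2; have -> : (m - i) * t = t.
  by apply/eqP; rewrite eqn_leq h2 leq_pmull // subn_gt0.
rewrite subnn take0 cats0 => /(leq_trans _); apply.
by rewrite take_oversize // size_drop sm -mulnBl.
Qed.

Lemma blockle_catr W t b s1 s2 : t %| size s1 -> blockle W t b (s1 ++ s2) -> blockle W t b s2.
Proof.
move=> /dvdnP[m sm] h i; have := h (m + i).
by rewrite mulnDl drop_cat sm ltnNge leq_addr /= addKn.
Qed.

Lemma blockle_count W t b m s : size s = m * t -> blockle W t b s -> count (mem W) s <= m * b.
Proof.
elim: m s => [|m IH] s sm h; first by rewrite (size0nil sm).
rewrite -(cat_take_drop t s) count_cat mulSn; apply: leq_add; first by have := h 0; rewrite mul0n drop0.
apply: IH => [|i]; first by rewrite size_drop sm mulSn addKn.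
by rewrite drop_drop -mulSnr; apply: h.
Qed.

Lemma blockle_flatten W t b (ss : seq (seq V)) s : 0 < t -> (forall s', s' \in ss -> t %| size s') ->
  blockle W t b (flatten ss) -> s \in ss -> blockle W t b s.
Proof.
move=> t0; elim: ss => //= s1 ss IH hd h; rewrite inE => /orP[/eqP ->|ssin].
  by apply: blockle_catl t0 _ h; apply: hd; rewrite mem_head.
apply: IH => // [s' hs'|]; first by apply: hd; rewrite inE hs' orbT.
by apply: blockle_catr h; apply: hd; rewrite mem_head.
Qed.

Lemma perm_flatten_split (I : Type) (s : seq I) (f g : I -> seq V) :
  perm_eq (flatten [seq f i ++ g i | i <- s]) (flatten (map f s) ++ flatten (map g s)).
Proof.
elim: s => //= i s IH; rewrite -!catA perm_cat2l.
apply: perm_trans (perm_cat (perm_refl _) IH) _; apply/permP => P.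
by rewrite !count_cat; lia.
Qed.

Lemma all2_in (w : seq V) (X : seq (seq V)) v0 :
  all2 (fun x (s : seq V) => x \in s) w X <->
  size w = size X /\ forall i, i < size X -> nth v0 w i \in nth [::] X i.
Proof.
rewrite all2E; split=> [/andP[/eqP e h]|[e h]].
  split=> // i ik; move/(all_nthP (v0, [::])): h => /(_ i).
  by rewrite size_zip e minnn => /(_ ik); rewrite nth_zip.
rewrite e eqxx /=; apply/(all_nthP (v0, [::])) => i; rewrite size_zip e minnn => ik.
by rewrite nth_zip //; exact: h.
Qed.

Variables (E : {set {set V}}) (k a : nat).

Lemma retile t' g : forall X : seq (seq V), size X = k -> uniq (flatten X) ->
  (forall w : seq V, all2 (fun x (s : seq V) => x \in s) w X -> edge E w) ->
  (forall i, i < k -> psz k a t' i * g <= size (nth [::] X i)) ->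
  exists Ys : seq (seq (seq V)), [/\ size Ys = g, forall Y, Y \in Ys -> tile k a E t' Y,
    uniq (flatten (map flatten Ys)) & {subset flatten (map flatten Ys) <= flatten X}].
Proof.
elim: g => [|g IH] X sX uX eX hX; first by exists [::]; split.
pose f i := take (psz k a t' i) (nth [::] X i).
pose f' i := drop (psz k a t' i) (nth [::] X i).
have pX : perm_eq (flatten X) (flatten (map f (iota 0 k)) ++ flatten (map f' (iota 0 k))).
  apply: perm_trans (perm_flatten_split _ _ _).
  rewrite (eq_map (g := nth [::] X)) => [|i]; last by rewrite /f /f' cat_take_drop.
  by rewrite -sX -/(mkseq _ _) mkseq_nth.
have := uX; rewrite (perm_uniq pX) cat_uniq => /and3P[uf df uf'].
have sub w (F : nat -> seq V) : (forall i x, x \in F i -> x \in nth [::] X i) ->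
    all2 (fun x (s : seq V) => x \in s) w (map F (iota 0 k)) ->
    all2 (fun x (s : seq V) => x \in s) w X.
  case: w => [|v0 w]; first by case: (k) sX => [|k'] // /size0nil ->.
  move=> hF /(all2_in _ _ v0); rewrite size_map size_iota => -[sw hw].
  apply/(all2_in _ _ v0); rewrite sX; split=> // i ik; have := hw i ik.
  by rewrite (nth_map 0) ?size_iota // nth_iota //; exact: hF.
have [||||Ys [h1 h2 h3 h4]] := IH (map f' (iota 0 k)).
- by rewrite size_map size_iota.
- by [].
- by move=> w /sub hw; apply/eX/hw => i x /mem_drop.
- move=> i ik; rewrite (nth_map 0) ?size_iota // nth_iota // size_drop add0n.
  by have := hX i ik; rewrite mulnS; lia.
exists (map f (iota 0 k) :: Ys); split=> /=; first by rewrite h1.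
- move=> Y; rewrite inE => /orP[/eqP ->|/h2 //]; split=> //.
    rewrite -map_comp; apply/eq_in_map => i; rewrite mem_iota /= => ik.
    by rewrite size_takel //; have := hX i ik; rewrite mulnS; lia.
  by move=> w /sub hw; apply/eX/hw => i x /mem_take.
- rewrite cat_uniq uf h3 andbT /=; apply/hasPn => x /h4 xf'.
  by apply: contra df => xf; apply/hasP; exists x.
- by move=> x; rewrite mem_cat (perm_mem pX) mem_cat => /orP[->|/h4 ->] //; rewrite orbT.
Qed.

(** A part of size [m * t] loses at most [m * (t' * B)] vertices, which leaves [m * t' * (h - B)],
    enough for [g] parts of the smaller scale. *)
Lemma tile_retile t' g t h W B : 1 < k < a -> 0 < t -> t = h * t' -> g + B <= h ->
  forall X : seq (seq V), tile k a E t X -> (forall s, s \in X -> blockle W t (t' * B) s) ->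
  exists Ys : seq (seq (seq V)), [/\ size Ys = g, forall Y, Y \in Ys -> tile k a E t' Y,
    uniq (flatten (map flatten Ys)), {subset flatten (map flatten Ys) <= flatten X} &
    ~~ has (mem W) (flatten (map flatten Ys))].
Proof.
move=> kka t0 tE gB X [sX uX eX] hW.
have sXk : size X = k by have := congr1 size sX; rewrite !size_map size_iota.
pose X' := [seq [seq x <- s | x \notin W] | s <- X].
have fX' : flatten X' = [seq x <- flatten X | x \notin W] by rewrite filter_flatten.
have [||||Ys [h1 h2 h3 h4]] := @retile t' g X'.
- by rewrite size_map.
- by rewrite fX' filter_uniq.
- case=> [|v0 w] hw; apply: eX; first by move: hw; rewrite /X'; case: (X).
  move/(all2_in _ _ v0): hw; rewrite size_map => -[sw hw]; apply/(all2_in _ _ v0); split=> // i ik.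
  by have := hw i ik; rewrite (nth_map [::]) // mem_filter => /andP[].
- move=> i ik; rewrite (nth_map [::]) ?sXk // size_filter.
  set s := nth [::] X i.
  have ss : size s = psz k a t i.
    by have := congr1 (nth 0 ^~ i) sX; rewrite /= (nth_map [::]) ?sXk // (nth_map 0) ?size_iota // nth_iota.
  have sX' : s \in X by apply: mem_nth; rewrite sXk.
  have [m pm] : exists m, forall t, psz k a t i = m * t by rewrite /psz; case: (i == 0); eexists.
  have := blockle_count (etrans ss (pm t)) (hW s sX').
  have := count_predC (mem W) s; rewrite ss !pm.
  have e : count (predC (mem W)) s = count (fun x => x \notin W) s by apply: eq_count.
  rewrite e; move=> h5 h6; rewrite -(leq_add2l (count (mem W) s)) h5.
  apply: leq_trans (leq_add h6 (leqnn _)) _; rewrite -!mulnA -mulnDr leq_mul2l tE; apply/orP; right.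
  by rewrite -mulnDr [h * _]mulnC leq_mul2l addnC gB orbT.
exists Ys; split=> //; first by move=> x /h4; rewrite fX' mem_filter => /andP[].
by apply/hasPn => x /h4; rewrite fX' mem_filter => /andP[].
Qed.

End Retile.

(* With [q] tiles cut into [q v] clusters, [u] clusters of uncovered vertices and [N] new
   tiles at the scale [t / h], every old tile still contains [h - B0] of the smaller tiles. *)
Lemma stage_gain v w A dl lam0 p q u N h B0 : 0 < w -> dl = 8 * A * w ->
  8 * A * dl <= lam0 * v -> B0 = lam0 * v + dl -> B0 <= h -> p = q * v + u -> p <= 2 * A * u ->
  dl * (lam0 * p) <= dl * N + p * lam0 * w ->
  4 * A * (q * h * v) + lam0 * v * p <= 4 * A * ((N + q * (h - B0)) * v).
Proof.
move=> w0 dlE hdl BE Bh pE hu hN.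
have h1 : 8 * A * (lam0 * p) <= 8 * A * N + lam0 * p.
  rewrite -(leq_pmul2l w0); apply: leq_trans (leq_trans hN _).
    by apply/eq_leq; rewrite dlE; ring.
  by apply/eq_leq; rewrite dlE; ring.
have {hN} h2 := leq_mul h1 (leqnn v).
set lam := lam0 * v in hdl BE *.
have h3 : 8 * A * dl * (q * v) <= lam * p by apply: leq_mul => //; rewrite pE leq_addr.
have h4 : 4 * lam * p <= 8 * A * lam * u.
  apply: leq_trans (leq_mul (leqnn (4 * lam)) hu) _; apply/eq_leq; ring.
have [g hE] : exists g, h = B0 + g by exists (h - B0); lia.
rewrite hE addKn BE -(leq_pmul2l (_ : 0 < 2)) //.
have e1 : 8 * A * (lam0 * p) * v = 8 * A * lam * (q * v) + 8 * A * lam * u by rewrite pE /lam; ring.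
have e2 : (8 * A * N + lam0 * p) * v = 8 * A * (N * v) + lam * p by rewrite /lam; ring.
have e3 : 2 * (4 * A * (q * (lam + dl + g) * v) + lam * p) =
  8 * A * lam * (q * v) + 8 * A * dl * (q * v) + 8 * A * (q * g * v) + 2 * (lam * p) by ring.
have e4 : 2 * (4 * A * ((N + q * g) * v)) = 8 * A * (N * v) + 8 * A * (q * g * v) by ring.
have e5 : 4 * lam * p = 4 * (lam * p) by ring.
rewrite e1 e2 in h2; rewrite e3 e4; rewrite e5 in h4.
move: h2 h3 h4; clear; lia.
Qed.

(** * Increasing the covered proportion over successive scales *)

Section Tiling.
Variables (k a Dn G A H : nat).
Hypotheses (k2 : 2 <= k) (ka : k < a) (Dn0 : 0 < Dn) (A0 : 0 < A).
Hypotheses (hG : 96 * a * Dn * k <= G) (hH : 12 * a * Dn * k <= H).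
Local Notation v := (a * (k - 1)).

(** With denominators cleared, the second clause reads [(1 / a - 1 / G) * n] and the third is
    non-extremality for [1 / Dn]. [Z] is a small set reserved for other purposes. *)
Definition admissible (V : finType) (E : {set {set V}}) (Z : {set V}) : Prop :=
  [/\ forall e, e \in E -> #|e| = k,
      forall S : seq V, uniq S -> size S = k.-1 ->
        G * #|V| <= a * #|V| + a * G * #|[pred x | edge E (rcons S x)]|,
      forall B : {set V}, #|B| = ((a - 1) * #|V|) %/ a -> #|V| ^ k < Dn * edges_in E B &
      G * #|Z| <= #|V|].

Definition tiling (V : finType) (E : {set {set V}}) (Z : {set V}) t (Xs : seq (seq (seq V))) : Prop :=
  [/\ forall X, X \in Xs -> tile k a E t X, uniq (flatten (map flatten Xs)) &
      forall x, x \in flatten (map flatten Xs) -> x \notin Z].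

Lemma tile_size (V : finType) (E : {set {set V}}) t X : tile k a E t X -> size (flatten X) = v * t.
Proof.
case=> sX _ _; rewrite size_flatten /shape sX.
have -> : iota 0 k = 0 :: iota 1 (k - 1) by rewrite subn1; case: (k) k2.
rewrite /= {1}/psz eqxx (_ : map _ _ = nseq (k - 1) ((a - 1) * t)).
  rewrite sumn_nseq; move: (k - 1) => m; case: (a) ka => // a' _.
  by rewrite subn1 /=; ring.
have h m b : 0 < b -> [seq psz k a t i | i <- iota b m] = nseq m ((a - 1) * t).
  by elim: m b => //= m IH [|b] // _; rewrite IH.
exact: h.
Qed.

Lemma tiles_size (V : finType) (E : {set {set V}}) t (Xs : seq (seq (seq V))) :
  (forall X, X \in Xs -> tile k a E t X) -> size (flatten (map flatten Xs)) = size Xs * v * t.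
Proof.
elim: Xs => //= X Xs IH h; rewrite size_cat IH => [|Y hY]; last by apply: h; rewrite inE hY orbT.
by rewrite (tile_size (h X (mem_head _ _))) mulSn mulnDl.
Qed.

Lemma tiles_retile (V : finType) (E : {set {set V}}) t' g t h (W : seq V) B : 0 < t -> t = h * t' -> g + B <= h ->
  forall Xs : seq (seq (seq V)), (forall X, X \in Xs -> tile k a E t X) -> uniq (flatten (map flatten Xs)) ->
  (forall X s, X \in Xs -> s \in X -> blockle W t (t' * B) s) ->
  exists Ys : seq (seq (seq V)), [/\ size Ys = size Xs * g, forall Y, Y \in Ys -> tile k a E t' Y,
    uniq (flatten (map flatten Ys)), {subset flatten (map flatten Ys) <= flatten (map flatten Xs)} &
    ~~ has (mem W) (flatten (map flatten Ys))].
Proof.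
move=> t0 tE gB; elim=> [|X Xs IH] tX uX hW; first by exists [::]; split.
have kka : 1 < k < a by rewrite k2 ka.
have [Ys [h1 h2 h3 h4 h5]] := tile_retile kka t0 tE gB (tX X (mem_head _ _)) (fun s => hW X s (mem_head _ _)).
have [|||Zs [g1 g2 g3 g4 g5]] := IH.
- by move=> Y hY; apply: tX; rewrite inE hY orbT.
- by move: uX; rewrite /= cat_uniq => /and3P[].
- by move=> Y s hY; apply: hW; rewrite inE hY orbT.
exists (Ys ++ Zs); rewrite map_cat flatten_cat; split.
- by rewrite size_cat h1 g1 /= mulSn.
- by move=> Y; rewrite mem_cat => /orP[/h2|/g2].
- rewrite cat_uniq h3 g3 andbT /=; apply/hasPn => x /g4 xX.
  move: uX; rewrite /= cat_uniq => /and3P[_ /hasPn /(_ x xX) + _].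
  by apply: contra => /h4.
- by move=> x; rewrite /= !mem_cat => /orP[/h4 ->|/g4 ->] //; rewrite orbT.
- by rewrite has_cat negb_or h5.
Qed.

(** The scale is quantified inside, so that one stage can start from the previous one at a coarser
    scale. *)
Definition stage D j := forall t', 0 < t' -> exists n0, forall (V : finType) (E : {set {set V}}) (Z : {set V}),
  admissible E Z -> n0 <= #|V| -> exists Xs, tiling E Z t' Xs /\
    (A * (#|V| - #|Z| - size Xs * v * t') <= #|V| \/ j * #|V| <= D * (size Xs * v * t')).

Lemma stage_step m : stage (64 * A * H * k * k) m -> stage (64 * A * H * k * k) m.+1.
Proof.
move=> IH t' t'0.
have H0 : 0 < H by apply: leq_trans hH; rewrite !muln_gt0 Dn0; clear -k2 ka; lia.
have v0 : 0 < v by rewrite muln_gt0; clear -k2 ka; lia.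
have [C0 hC0] := realize k2 ka t'0 H0.
set w := wt2 k a.
have w0 : 0 < w by rewrite /w /wt2 addn_gt0 expn_gt0; clear -k2; lia.
(* [dl] limits the loss in pruning to a fraction [1 / (8 * A)], [lam0] makes [dl] negligible against
   the average load [lam], and [h] gives the clusters room for loads up to [2 * lam]. *)
set dl := 8 * A * w; set lam0 := maxn (8 * A * dl) C0; set lam := lam0 * v.
set h := 4 * H * k * k * lam; set t := h * t'.
have lam_le : lam0 <= lam by rewrite leq_pmulr.
have dlam : 8 * A * dl <= lam by apply: leq_trans lam_le; rewrite leq_maxl.
have Clam : C0 <= lam by apply: leq_trans lam_le; rewrite leq_maxr.
have dl0 : 0 < dl by rewrite !muln_gt0 A0 w0.
have dllam : dl <= lam by apply: leq_trans dlam; rewrite leq_pmull // muln_gt0 A0.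
have k0 : 0 < k by clear -k2; lia.
have lamh : lam <= h by rewrite leq_pmull // !muln_gt0 H0 k0.
have lamt : lam <= t by apply: leq_trans lamh _; rewrite leq_pmulr.
have t0 : 0 < t by clear -dl0 dllam lamt; lia.
set B0 := lam + dl.
have HB : 2 * H * k * k * B0 * t' <= t.
  rewrite /t leq_mul2r; apply/orP; right.
  have -> : h = 2 * H * k * k * (2 * lam) by rewrite /h; ring.
  by rewrite leq_mul2l /B0; apply/orP; right; clear -dllam; lia.
have Bh : B0 <= h.
  have -> : h = H * k * k * (4 * lam) by rewrite /h; ring.
  apply: (@leq_trans (4 * lam)); first by rewrite /B0; clear -dllam; lia.
  by rewrite leq_pmull // !muln_gt0 H0 k0.
have [n1 hn1] := IH t t0.
exists (maxn n1 (maxn (2 * A * t) (4 * t * (12 * a * Dn * k * k) + 8 * t))) => V E Z adm.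
rewrite !geq_max => /and3P[nn1 nA np].
have [Xs [[tX uX ZX] hX]] := hn1 V E Z adm nn1.
set Lold := flatten (map flatten Xs) in uX ZX *.
have sL : size Lold = size Xs * v * t by rewrite /Lold (tiles_size tX).
set q := size Xs in hX sL *.
(* A tiling that is already good enough is merely cut to the smaller scale. *)
case: (leqP (A * (#|V| - #|Z| - q * v * t)) #|V|) => hA.
  have [||Ys [h1 h2 h3 h4 _]] := @tiles_retile V E t' h t h [::] 0 t0 erefl _ Xs tX uX; first by rewrite addn0.
    by move=> X s _ _ i; rewrite muln0 leqn0; apply/eqP; rewrite (eq_count (a2 := pred0)) ?count_pred0.
  exists Ys; split; first by split=> // x /h4 /ZX.
  by left; rewrite h1 -/q (_ : q * h * v * t' = q * v * t) // /t; ring.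
case: hX => [|hX]; first by rewrite leqNgt hA.
case: (adm) => H1 H2 H3 H4.
set U := enum [pred x | (x \notin Z) && (x \notin Lold)].
have uU : uniq U by exact: enum_uniq.
set u := size U %/ t; set p := q * v + u.
have su : u * t <= size U by exact: leq_trunc_div.
(* Old tiles and uncovered vertices form one list, cut into clusters of [t] consecutive entries.
   Part sizes are multiples of [t], so a cluster of a tile lies in one part; fewer than [t]
   uncovered vertices remain. *)
pose L := Lold ++ take (u * t) U.
have uL : uniq L.
  rewrite cat_uniq uX take_uniq // andbT /=; apply/hasPn => x /mem_take.
  by rewrite mem_enum inE => /andP[].
have sLp : size L = p * t by rewrite size_cat sL size_takel // /p mulnDl.
have LZ x : x \in L -> x \notin Z.
  by rewrite mem_cat => /orP[/ZX //|/mem_take]; rewrite mem_enum inE => /andP[].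
have nU : #|V| <= #|Z| + q * v * t + size U.
  have -> : size U = #|[set x | (x \notin Z) && (x \notin Lold)]| by rewrite -cardE cardsE.
  have -> : q * v * t = #|[set x in Lold]| by rewrite -sL cardsE (card_uniqP uX).
  rewrite -cardsT; apply: (@leq_trans #|Z :|: [set x in Lold] :|: [set x | (x \notin Z) && (x \notin Lold)]|).
    apply/subset_leq_card/subsetP => x _; rewrite !inE.
    by case: (x \in Z) => //; case: (x \in Lold).
  by apply: leq_trans (leq_card_setU _ _) _; rewrite leq_add2r leq_card_setU.
have n0 : 0 < #|V| by clear -nA t0 A0 np; lia.
have [x0 _] := card_gt0P n0.
pose c (i : 'I_p) (j : 'I_t) := nth x0 L (i * t + j).
have ltL (i : 'I_p) (j : 'I_t) : i * t + j < size L.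
  rewrite sLp; apply: (@leq_trans (i.+1 * t)); last by rewrite leq_mul2r ltn_ord orbT.
  by rewrite mulSn addnC ltn_add2r.
have cinj i j i' j' : c i j = c i' j' -> i = i' /\ j = j'.
  move/eqP; rewrite nth_uniq ?ltL // => /eqP e.
  have ei := congr1 (fun x => x %/ t) e; rewrite !divnMDl // !divn_small // !addn0 in ei.
  by have ej := congr1 (fun x => x %% t) e; rewrite !modnMDl !modn_small // in ej; split; apply: val_inj.
have clL x : x \in clusters c -> x \in L by case/imsetP => -[i j] _ ->; rewrite mem_nth ?ltL.
have cZ : #|V| <= #|Z| + p * t + t.
  have := ltn_ceil (size U) t0; rewrite -/u /p mulSn mulnDl; move: nU; clear; lia.
have pn : p * t <= #|V| by rewrite -sLp -(card_uniqP uL) max_card.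
have G2 : 2 <= G by apply: leq_trans (leq_trans k2 (leq_pmull k _)) hG; rewrite !muln_gt0 Dn0; clear -ka; lia.
have n4 : #|V| <= 4 * (p * t).
  have : 2 * #|Z| <= #|V| by apply: leq_trans H4; rewrite leq_mul2r G2 orbT.
  move: cZ np; clear; lia.
have hp : 12 * a * Dn * k * k <= p.
  rewrite -(leq_pmul2r t0) -(leq_pmul2l (_ : 0 < 4)) //; apply: leq_trans n4.
  by apply: leq_trans np; apply: leq_trans (leq_addr _ _); apply/eq_leq; ring.
have kp : k <= p.
  by apply: leq_trans hp; rewrite leq_pmull // !muln_gt0 Dn0 k0; clear -ka; lia.
have hD := dual_edge cinj cZ k2 ka t0 Dn0 H1 H2 H3 H4 hG hH hp _ kp.
pose R (K : seq 'I_p) := [/\ size K = k, uniq K & dedge E k H c K].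
have hR K : R K -> size K = k /\ uniq K by case.
have hD' f : exists2 K, R K & p * cost k a f K <= v * \sum_i f i.
  by have [K [h1 h2 h3 h4]] := hD f; exists K.
have a0 : 0 < a by clear -ka; lia.
have [es [Res loades hes]] := balanced k2 a0 hR hD' lam0 dl.
have CT : C0 <= t by exact: leq_trans Clam lamt.
have [Ws [sW tW uW WC cW]] := hC0 V E p t c cinj B0 CT HB es Res loades.
set W := flatten (map flatten Ws) in uW WC cW.
have blL : blockle W t (t' * B0) L.
  move=> i; case: (ltnP i p) => ip; last first.
    by rewrite drop_oversize // sLp leq_mul2r ip orbT.
  have -> : take t (drop (i * t) L) = [seq c (Ordinal ip) j | j <- enum 'I_t].
    apply: (@eq_from_nth _ x0).
      rewrite size_map size_enum_ord size_takel // size_drop sLp -mulnBl leq_pmull // subn_gt0 //.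
    rewrite size_takel => [z mt|]; last by rewrite size_drop sLp -mulnBl leq_pmull // subn_gt0.
    by rewrite nth_take // nth_drop (nth_map (Ordinal mt)) ?size_enum_ord // /c nth_enum_ord.
  rewrite count_map -size_filter.
  have -> : size (filter (preim (c (Ordinal ip)) (mem W)) (enum 'I_t)) = #|[set j | c (Ordinal ip) j \in W]|.
    rewrite cardE; apply: perm_size; apply: uniq_perm; [exact: filter_uniq (enum_uniq _) | exact: enum_uniq | move=> j].
    by rewrite mem_filter !mem_enum !inE andbT.
  by apply: leq_trans (cW _) _; rewrite leq_mul2l loades orbT.
have [||Ys [h1 h2 h3 h4 h5]] := @tiles_retile V E t' (h - B0) t h W B0 t0 erefl _ Xs tX uX.
- by rewrite subnK.
- move=> X s XX sX.
  have bX : blockle W t (t' * B0) (flatten X).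
    apply: (blockle_flatten t0 _ (_ : blockle W t (t' * B0) (flatten (map flatten Xs)))).
    + by move=> s' /mapP[Y YY ->]; rewrite (tile_size (tX Y YY)) dvdn_mull.
    + apply: blockle_catl t0 _ blL; rewrite -/Lold sL; exact: dvdn_mull.
    + exact: map_f.
  apply: blockle_flatten t0 _ bX sX => s' s'X.
  have [sz _ _] := tX X XX; have := map_f size s'X; rewrite sz => /mapP[i _ ->].
  by rewrite /psz; case: (i == 0); rewrite dvdn_mull.
exists (Ws ++ Ys); split.
  rewrite /tiling map_cat flatten_cat -/W; split.
  - by move=> X; rewrite mem_cat => /orP[/tW|/h2].
  - rewrite cat_uniq uW h3 andbT /=; apply: contra h5 => /hasP[x xY xW]; apply/hasP; by exists x.
  - by move=> x; rewrite mem_cat => /orP[/WC/clL/LZ|/h4/ZX].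
right; rewrite size_cat sW h1 -/q.
(* More than [n / A] vertices are uncovered, so they make up at least a fraction [1 / (2 * A)] of
   the clusters. *)
have pu : p <= 2 * A * u.
  rewrite -(leq_pmul2r t0).
  have s1 : A * #|V| <= A * (#|Z| + q * v * t + size U) by rewrite leq_mul2l nU orbT.
  have s2 : #|V| < A * size U.
    apply: leq_trans hA _; rewrite leq_mul2l; apply/orP; right; rewrite -subnDA leq_subLR; exact: nU.
  have s3 : A * size U <= A * (u.+1 * t) by rewrite leq_mul2l ltnW ?orbT // ltn_ceil.
  have e1 : A * (u.+1 * t) = A * u * t + A * t by ring.
  have e2 : 2 * A * u * t = 2 * (A * u * t) by ring.
  have nA' : 2 * (A * t) <= #|V| by rewrite mulnA.
  rewrite e1 in s3; rewrite e2; have s4 := leq_trans s2 s3.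
  move: s4 nA' pn; move: (A * u * t) (A * t) (p * t) #|V|; clear; lia.
have gain := stage_gain w0 erefl dlam erefl Bh erefl pu hes.
set cov := (size es + q * (h - B0)) * v in gain *.
have e1 : 64 * A * H * k * k * (cov * t') = 16 * H * k * k * t' * (4 * A * cov) by ring.
rewrite e1; apply: leq_trans (leq_mul (leqnn _) gain).
have e2 : 16 * H * k * k * t' * (4 * A * (q * h * v) + lam0 * v * p) =
   64 * A * H * k * k * (q * v * (h * t')) + 4 * (p * (4 * H * k * k * lam * t')) by rewrite /lam; ring.
by rewrite e2 -/h -/t mulSn addnC leq_add.
Qed.

(** After more stages than the reciprocal of the gain, the covered proportion would exceed 1, so the
    first alternative of [stage] must hold. *)
Lemma almost_tiling t : 0 < t -> exists n0, forall (V : finType) (E : {set {set V}}) (Z : {set V}),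
  admissible E Z -> n0 <= #|V| ->
  exists Xs, tiling E Z t Xs /\ A * (#|V| - #|Z| - size Xs * v * t) <= #|V|.
Proof.
move=> t0; have all_stages j : stage (64 * A * H * k * k) j.
  elim: j => [|j IH]; last exact: stage_step.
  move=> t' _; exists 0 => V E Z _ _; exists [::]; split; first by split.
  by right.
have [n0 hn0] := all_stages (64 * A * H * k * k).+1 t t0.
exists n0.+1 => V E Z adm nV; have [|Xs [tXs hX]] := hn0 V E Z adm; first exact: ltnW.
exists Xs; split=> //; case: hX => // hX.
have cv : size Xs * v * t <= #|V|.
  by case: tXs => tX uX _; rewrite -(tiles_size tX) -(card_uniqP uX) max_card.
have := leq_trans hX (leq_mul (leqnn _) cv).
by rewrite leq_mul2r ltnn orbF => /eqP V0; rewrite V0 in nV.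
Qed.

End Tiling.

Lemma flatten_disjoint (T : eqType) (X : seq (seq T)) i j x : uniq (flatten X) ->
  x \in nth [::] X i -> x \in nth [::] X j -> i = j.
Proof.
elim: X i j => [|s X IH] i j /=; first by rewrite !nth_nil.
rewrite cat_uniq => /and3P[_ /hasPn dX uX].
have inX i' : x \in nth [::] X i' -> x \in flatten X.
  case: (ltnP i' (size X)) => h; last by rewrite nth_default.
  by move=> xi; apply/flattenP; exists (nth [::] X i'); rewrite ?mem_nth.
case: i j => [|i] [|j] //= h1 h2; last by congr _.+1; exact: IH.
  by have := dX x (inX j h2); rewrite /= h1.
by have := dX x (inX i h1); rewrite /= h2.
Qed.

Lemma part_uniq (T : eqType) (X : seq (seq T)) s : uniq (flatten X) -> s \in X -> uniq s.
Proof.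
elim: X => //= s' X IH; rewrite cat_uniq inE => /and3P[us _ uX] /orP[/eqP -> //|].
exact: IH.
Qed.

(** * Nearly spanning paths in tiles *)

Section PathTiling.
Variables (l d s1 r : nat).
Hypotheses (hl : 0 < l) (hd : 2 <= d) (hkd : ~~ (d %| l + d)) (s1_gt0 : 0 < s1).
Hypotheses (kE : l + d = s1 * d + r) (r0 : 0 < r < d).
Local Notation k := (l + d).
Local Notation a := (s1.+1 * d).

Lemma k_lt_a : k < a.
Proof. by rewrite kE mulSn addnC ltn_add2r; case/andP: r0. Qed.

Lemma tile_path (V : finType) (E : {set {set V}}) M (X : seq (seq V)) : 0 < M -> tile k a E M X ->
  exists p : seq V, [/\ pathlike l d E p, uniq p, {subset p <= flatten X} &
    a * (k - 1) * M <= size p + d].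
Proof.
move=> M0 [sX uX eX].
have k0 : k - 1 = k.-1 by rewrite subn1.
have sXk : size X = k by have := congr1 size sX; rewrite !size_map size_iota.
set N := a * (k - 1) * M.
have dN : d %| N by rewrite /N -mulnA -mulnA mulnCA dvdn_mulr.
have ka := k_lt_a.
have Nbig : l + d <= N.
  apply: (@leq_trans a); first exact: ltnW.
  by rewrite /N -mulnA leq_pmulr // muln_gt0 M0 andbT subn_gt0; clear -hl hd; lia.
(* The largest number below [N] that is congruent to [l] modulo [d]. *)
pose L := N - d + l %% d.
have Ld : l %% d < d by rewrite ltn_mod; clear -hd; lia.
have LN : L < N by rewrite /L; clear -Ld Nbig; lia.
pose pos := tile_pos l d s1.
have ss i : i < k -> size (nth [::] X i) = psz k a M i.
  move=> ik; have := congr1 (nth 0 ^~ i) sX.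
  by rewrite /= (nth_map [::]) ?sXk // (nth_map 0) ?size_iota // nth_iota.
have pos_lt x : x < N -> (pos x).2 < psz k a M (pos x).1.
  by rewrite /N k0 => /(tile_pos_copy hl hd s1_gt0 kE r0); rewrite /psz !subn1.
have pos_k x : (pos x).1 < k by exact: tile_pos_lt hl hd s1_gt0 kE r0 x.
have [v0 _] : exists v, v \in nth [::] X (pos 0).1.
  have : 0 < size (nth [::] X (pos 0).1).
    by rewrite ss //; apply: leq_ltn_trans (pos_lt 0 _) => //; clear -Nbig hl; lia.
  by case: (nth _ _ _) => // v s _; exists v; rewrite mem_head.
pose F (q : nat * nat) := nth v0 (nth [::] X q.1) q.2.
have Fin x : x < N -> F (pos x) \in nth [::] X (pos x).1.
  by move=> xN; rewrite mem_nth // ss // pos_lt.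
pose p := [seq F (pos x) | x <- iota 0 L].
have sp : size p = L by rewrite size_map size_iota.
have inX x : x < N -> F (pos x) \in flatten X.
  by move=> xN; apply/flattenP; exists (nth [::] X (pos x).1); [rewrite mem_nth // sXk pos_k | exact: Fin].
have Finj q q' : q.1 < k -> q'.1 < k -> q.2 < psz k a M q.1 -> q'.2 < psz k a M q'.1 -> F q = F q' -> q = q'.
  case: q q' => i m [i' m'] /= ik ik' hm hm'; rewrite /F /= => e.
  have ei : i = i'.
    apply: (flatten_disjoint uX (x := nth v0 (nth [::] X i) m)); first by rewrite mem_nth ?ss.
    by rewrite e mem_nth ?ss.
  rewrite -ei in e hm' *; move/eqP: e; rewrite nth_uniq ?ss // => [/eqP -> //|].
  by apply: part_uniq uX _; rewrite mem_nth ?sXk.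
exists p; split.
- split.
  + by rewrite sp /L; clear -Nbig; lia.
  + have -> : size p - l = N - d - l %/ d * d.
      by rewrite sp /L; have := divn_eq l d; move: (l %/ d * d) (l %% d); clear -Nbig; lia.
    by apply: dvdn_sub; rewrite ?dvdn_mull // dvdn_sub.
  + move=> j; rewrite sp => hj.
    have -> : take k (drop (j * d) p) = [seq F (pos x) | x <- iota (j * d) k].
      rewrite /p -map_drop -map_take drop_iota take_iota add0n; congr map; congr iota.
      by apply/minn_idPl; move: hj; clear; lia.
    pose zz := [seq pos x | x <- iota (j * d) k].
    have pz : perm_eq (map fst zz) (iota 0 k).
      by rewrite /zz -map_comp perm_sym; exact: tile_window hl hd s1_gt0 kE r0 j.
    have [z pzz ez] := perm_lift pz.
    have -> : [seq F (pos x) | x <- iota (j * d) k] = map F zz by rewrite /zz -map_comp.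
    rewrite -(edge_perm E (perm_map F pzz)); apply: eX.
    apply/(all2_in _ _ v0); have sz : size z = k by have := congr1 size ez; rewrite size_map size_iota.
    rewrite size_map sz sXk; split=> // i ik.
    rewrite (nth_map (0, 0)) ?sz //.
    have : nth (0, 0) z i \in zz by rewrite -(perm_mem pzz) mem_nth ?sz.
    have e1 : (nth (0, 0) z i).1 = i.
      by have := congr1 (nth 0 ^~ i) ez; rewrite /= (nth_map (0, 0)) ?sz // nth_iota.
    move=> /mapP[x]; rewrite mem_iota => /andP[_ hx] ex; rewrite -{2}e1 ex; apply: Fin.
    clear -hx hj LN; lia.
- rewrite map_inj_in_uniq ?iota_uniq // => x y; rewrite !mem_iota /= !add0n => xL yL.
  move/Finj => /(_ (pos_k x) (pos_k y) (pos_lt x (ltn_trans xL LN)) (pos_lt y (ltn_trans yL LN))).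
  exact: tile_pos_inj hl hd s1_gt0 kE r0 x y.
- by move=> v /mapP[x]; rewrite mem_iota => /andP[_ xL] ->; apply: inX; exact: ltn_trans xL LN.
- by rewrite sp /L -/N; clear -Nbig; lia.
Qed.

Lemma path_tiling Dn G A H m : 0 < Dn -> 0 < A -> 96 * a * Dn * k <= G -> 12 * a * Dn * k <= H ->
  exists n0, forall (V : finType) (E : {set {set V}}) (Z : {set V}),
  admissible k a Dn G E Z -> n0 <= #|V| ->
  exists ps : seq (seq V), [/\ forall p, p \in ps -> pathlike l d E p /\ m <= size p,
    uniq (flatten ps), forall x, x \in flatten ps -> x \notin Z &
    A * (#|V| - #|Z| - size (flatten ps)) <= #|V|].
Proof.
move=> Dn0 A0 hG hH.
have k2 : 1 < k by clear -hl hd; lia.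
have ka := k_lt_a.
(* A path misses at most [d] vertices of its tile, which has at least [M]. The term [2 * A * d]
   bounds the total loss by [n / (2 * A)], and [m + d] makes each path long enough. *)
set M := 2 * A * d + m + d.
have M0 : 0 < M by clear -hd; rewrite /M; lia.
have A20 : 0 < 2 * A by rewrite muln_gt0.
have [n0 hn0] := almost_tiling k2 ka Dn0 A20 hG hH M0.
exists n0 => V E Z adm nV; have [Xs [[tX uX ZX] hX]] := hn0 V E Z adm nV.
set N := a * (k - 1) * M.
have MN : M <= N by rewrite leq_pmull // muln_gt0; clear -k2 ka; lia.
have [ps [h1 h2 h4 h5 h6]] : exists ps : seq (seq V), [/\ size ps = size Xs,
    forall p, p \in ps -> pathlike l d E p /\ m <= size p,
    uniq (flatten ps), {subset flatten ps <= flatten (map flatten Xs)} &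
    size Xs * N <= size (flatten ps) + size Xs * d].
  elim: Xs tX uX {hX ZX} => [|X Xs IH] tX uX; first by exists [::]; split.
  have [||ps [g1 g2 g4 g5 g6]] := IH.
  - by move=> Y hY; apply: tX; rewrite inE hY orbT.
  - by move: uX; rewrite /= cat_uniq => /and3P[].
  have [p [q1 q2 q3 q4]] := tile_path M0 (tX X (mem_head _ _)).
  exists (p :: ps); split=> /=.
  - by rewrite g1.
  - move=> p'; rewrite inE => /orP[/eqP ->|/g2 //]; split=> //.
    by move: MN q4; rewrite -/N /M; clear; lia.
  - rewrite cat_uniq q2 g4 andbT /=; apply/hasPn => x /g5 xX.
    move: uX; rewrite /= cat_uniq => /and3P[_ /hasPn /(_ x xX) + _].
    by apply: contra => /q3.
  - by move=> x; rewrite !mem_cat => /orP[/q3 ->|/g5 ->] //; rewrite orbT.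
  - by move: q4 g6; rewrite size_cat !mulSn -/N; clear; lia.
exists ps; split=> //; first by move=> x /h5 /ZX.
have sN : size Xs * N <= #|V|.
  have := tiles_size k2 ka tX; rewrite -mulnA -/N => <-.
  by rewrite -(card_uniqP uX) max_card.
rewrite -(leq_pmul2l (_ : 0 < 2)) //.
have e1 : 2 * (A * (size Xs * d)) <= #|V|.
  apply: leq_trans sN; have -> : 2 * (A * (size Xs * d)) = size Xs * (2 * A * d) by ring.
  by rewrite leq_mul2l (leq_trans _ MN) ?orbT // /M -addnA leq_addr.
have e2 : #|V| - #|Z| - size (flatten ps) <= (#|V| - #|Z| - size Xs * (a * (k - 1)) * M) + size Xs * d.
  by move: h6; rewrite /N !mulnA; clear; lia.
have := leq_mul (leqnn (2 * A)) e2; rewrite mulnDr.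
have -> : 2 * A * (size Xs * d) = 2 * (A * (size Xs * d)) by ring.
rewrite mulnA; move: e1 hX; clear; lia.
Qed.

End PathTiling.

(** * Assembling the Hamilton cycle *)

Section Pick.
Variables (V : finType) (I : Type) (good : I -> pred (seq V)).

(** Every request has at least as many good gadgets as there are requests, so a greedy choice never
    runs out. *)
Lemma reservoir_pick (js : seq I) (Fs : seq (seq V)) : (forall i, size js <= count (good i) Fs) ->
  exists Gs rest : seq (seq V), perm_eq Fs (Gs ++ rest) /\ all2 good js Gs.
Proof.
elim: js Fs => [|i js IH] Fs h; first by exists [::], Fs.
have /hasP[F FFs gF] : has (good i) Fs by rewrite has_count; apply: leq_trans (h i).
have pF := perm_to_rem FFs.
have [j|Gs [rest [p1 h1]]] := IH (rem F Fs).
  have := h j; rewrite (permP pF) /=; case: (good j F) => /=; lia.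
exists (F :: Gs), rest; split; last by rewrite /= gF.
by apply: perm_trans pF _; rewrite /= perm_cons.
Qed.

Lemma greedy_pick C q (js : seq I) (Z : seq V) : 0 < #|V| -> (forall i, dense C q (good i)) ->
  2 * C * (q * (q + (size Z + size js * q))) <= #|V| ->
  exists Gs : seq (seq V), [/\ all2 good js Gs, all (fun F => size F == q) Gs, uniq (flatten Gs) &
    ~~ has (mem Z) (flatten Gs)].
Proof.
move=> n0 hd; elim: js Z => [|i js IH] Z h; first by exists [::].
have h1 : 2 * C * (q * (q + size Z)) <= #|V|.
  apply: leq_trans h; rewrite leq_mul2l; apply/orP; right; rewrite leq_mul2l; apply/orP; right.
  by rewrite leq_add2l leq_addr.
have [F [sF gF uF dF]] := dense_has n0 h1 (hd i).
have [|Gs [h2 h3 h4 h5]] := IH (F ++ Z).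
  by rewrite size_cat sF [q + size Z]addnC -addnA -mulSn.
exists (F :: Gs); split=> /=.
- by rewrite gF.
- by rewrite sF eqxx.
- rewrite cat_uniq uF h4 andbT /=; apply: contra h5 => /hasP[x xG xF].
  by apply/hasP; exists x => //=; rewrite mem_cat; apply/orP; left.
- rewrite has_cat negb_or dF /=; apply: contra h5 => /hasP[x xG xZ].
  by apply/hasP; exists x => //=; rewrite mem_cat; apply/orP; right.
Qed.

End Pick.

Section Weave.
Variables (l d : nat) (V : finType) (E : {set {set V}}).
Hypotheses (hl : 0 < l) (hd : 2 <= d).
Local Notation k := (l + d).

Definition hd_ (p : seq V) := (ends l p).1.
Definition tl_ (p : seq V) := (ends l p).2.

Definition lk (ST : seq V * seq V) (c : seq V) : bool :=
  (d %| l + size c) && `[< epath l d (edge E) (ST.1 ++ c ++ ST.2) >].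

(* The pairs of ends to be linked when the paths are visited in order and then [T] is reached. *)
Definition prs (T : seq V) (ps : seq (seq V)) := zip (map tl_ ps) (rcons (behead (map hd_ ps)) T).

Definition weave (ps cs : seq (seq V)) := flatten [seq q.1 ++ q.2 | q <- zip ps cs].

(** Neighbouring pieces overlap in the [l] end vertices of a path, and a path with its connector has
    length divisible by [d]; so [epath_cat] applies at the tail of each path and at the head of the
    next. *)
Lemma weave_epath T ps cs : size T = l -> (forall p, p \in ps -> pathlike l d E p) ->
  all2 lk (prs T ps) cs -> d %| size (weave ps cs) /\ epath l d (edge E) (weave ps cs ++ T).
Proof.
move=> sT; elim: ps cs => [|p ps IH] [|c cs] //= hp.
- by move=> _; rewrite dvdn0; split=> // j; rewrite /weave /= sT; lia.
- by rewrite /prs /=; case: (ps) {IH hp}.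
have [lp dp Ep] := hp p (mem_head _ _).
set hdn := if ps is p' :: _ then hd_ p' else T.
have prsE : prs T (p :: ps) = (tl_ p, hdn) :: prs T ps.
  by rewrite /prs /hdn /=; case: (ps).
rewrite prsE /= => /andP[/andP[dc /asboolP /= Ec] hcs].
have [dw Ew] := IH cs (fun p' hp' => hp p' (mem_behead (s := p :: ps) hp')) hcs.
have dpc : d %| size (p ++ c).
  have -> : size (p ++ c) = (size p - l) + (l + size c) by rewrite size_cat addnA subnK.
  by rewrite dvdn_add.
have wE : weave (p :: ps) (c :: cs) = (p ++ c) ++ weave ps cs by [].
split; first by rewrite wE size_cat dvdn_add.
have shdn : size hdn = l.
  rewrite /hdn; case: (ps) hp => // p' ps' hp; rewrite /hd_ /= size_takel //.
  by case: (hp p') => //; rewrite !inE eqxx orbT.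
have [B BE] : exists B, weave ps cs ++ T = hdn ++ B.
  rewrite /hdn; case: (ps) cs hcs {IH wE dw Ew} hp => [|p' ps'] [|c' cs'] //=; first by exists [::]; rewrite cats0.
  - by rewrite /prs /=; case: (ps').
  - move=> _ hp; exists (drop l p' ++ c' ++ weave ps' cs' ++ T).
    by rewrite /hd_ /= [RHS]catA cat_take_drop /weave /= -!catA.
have -> : weave (p :: ps) (c :: cs) ++ T = (p ++ c) ++ hdn ++ B by rewrite wE -[LHS]catA BE.
have d0 : 0 < d by clear -hd; lia.
apply: epath_cat; rewrite -?BE ?shdn //.
rewrite -{1}(cat_take_drop (size p - l) p) -!catA; apply: epath_cat => //.
- by rewrite size_takel // leq_subr.
- by rewrite size_drop subKn.
- by rewrite cat_take_drop.
Qed.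

Lemma connectors_of (pr : seq (seq V * seq V)) Gs :
  all2 (fun ST W => `[< connector l d E ST.1 ST.2 W >]) pr Gs -> uniq (flatten Gs) ->
  exists cs, [/\ all2 lk pr cs, uniq (flatten cs) & {subset flatten cs <= flatten Gs}].
Proof.
elim: pr Gs => [|ST pr IH] [|G Gs] //=; first by exists [::].
case/andP=> /asboolP[c [cG uc dc Ec]] hG; rewrite cat_uniq => /and3P[uG /hasPn dG uGs].
have [cs [h1 h2 h3]] := IH Gs hG uGs.
exists (c :: cs); split=> /=.
- by rewrite /lk dc h1 andbT; apply/asboolP.
- rewrite cat_uniq uc h2 andbT /=; apply/hasPn => x /h3 /dG.
  by apply: contra => /cG.
- by move=> x; rewrite !mem_cat => /orP[/cG ->|/h3 ->] //; rewrite orbT.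
Qed.

Lemma weave_perm ps cs : size ps = size cs -> perm_eq (weave ps cs) (flatten ps ++ flatten cs).
Proof.
elim: ps cs => [|p ps IH] [|c cs] //= [/IH h]; rewrite /weave /= -!catA perm_cat2l.
apply: perm_trans (perm_cat (perm_refl c) h) _; apply/permPl; exact: perm_catCA.
Qed.

End Weave.

Lemma all2_sub_in (S T : Type) (P : pred S) (r r' : S -> T -> bool) s t :
  (forall x y, P x -> r x y -> r' x y) -> all P s -> all2 r s t -> all2 r' s t.
Proof.
move=> h; elim: s t => [|x s IH] [|y t] //= /andP[Px Ps] /andP[rxy rst].
by rewrite (h _ _ Px rxy) IH.
Qed.

Lemma all2_size (S T : Type) (r : S -> T -> bool) s t : all2 r s t -> size s = size t.
Proof. by rewrite all2E => /andP[/eqP]. Qed.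

Lemma size_flatten_const (T : Type) (X : seq (seq T)) q :
  all (fun F => size F == q) X -> size (flatten X) = size X * q.
Proof. by elim: X => //= s X IH /andP[/eqP h /IH]; rewrite size_cat h mulSn => ->. Qed.

Section Absorbing.
Variables (l d s1 r : nat).
Hypotheses (hl : 0 < l) (hd : 2 <= d) (hkd : ~~ (d %| l + d)) (s1_gt0 : 0 < s1).
Hypotheses (kE : l + d = s1 * d + r) (r0 : 0 < r < d).
Local Notation k := (l + d).

Section Links.
Variables (V : finType) (E : {set {set V}}).

Definition linkable (ST : seq V * seq V) :=
  [&& size ST.1 == l, size ST.2 == l, uniq ST.1 & uniq ST.2].

(** Pairs that are not linkable are satisfied by every [W], so that the family is dense for all
    pairs, as the selection of gadgets demands. *)
Definition joins (ST : seq V * seq V) : pred (seq V) :=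
  fun W => linkable ST ==> `[< connector l d E ST.1 ST.2 W >].

Definition pathok (p : seq V) := (l <= size p) && uniq p.

Lemma linkable_prs T ps : size T = l -> uniq T -> all pathok ps -> all linkable (prs l T ps).
Proof.
move=> sT uT; elim: ps => [|p ps IH] //= /andP[/andP[lp up] hps].
have -> : prs l T (p :: ps) = (tl_ l p, if ps is p' :: _ then hd_ l p' else T) :: prs l T ps.
  by rewrite /prs /=; case: (ps).
rewrite /= IH // andbT /linkable /= size_drop subKn // eqxx drop_uniq //=.
case: (ps) hps => [|p' ps'] /=; first by rewrite sT eqxx uT.
by move=> /andP[/andP[lp' up'] _]; rewrite size_takel // eqxx take_uniq.
Qed.

Lemma prs_take T p ps qs :
  zip (map (@tl_ l V) (p :: ps)) (map (@hd_ l V) ps) = take (size ps) (prs l T (p :: ps ++ qs)).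
Proof.
elim: ps p => [|p' ps IH] p; first by rewrite take0.
have -> : prs l T (p :: (p' :: ps) ++ qs) = (tl_ l p, hd_ l p') :: prs l T (p' :: ps ++ qs) by [].
by rewrite [RHS]/= -IH.
Qed.

Lemma pathlike_swap p : pathlike l d E p -> swap l d E p p.
Proof. by move=> h; split. Qed.

Lemma uniq_of_flatten (X : seq (seq V)) : uniq (flatten X) -> [::] \notin X -> uniq X.
Proof.
elim: X => //= s X IH; rewrite cat_uniq inE negb_or => /and3P[_ /hasPn dX uX] /andP[s0 X0].
rewrite IH // andbT; apply/negP => sX; case: s s0 dX sX => // x s _ dX sX.
have /dX : x \in flatten X by apply/flattenP; exists (x :: s); rewrite ?mem_head.
by rewrite /= mem_head.
Qed.

(** The gadgets in [Gs] absorb the entries of [Ds] in order, and those in [rest] keep their paths;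
    either way each path is swapped for one with the same ends. *)
Lemma absorb_many sh (Fs Gs rest Ds : seq (seq V)) : perm_eq Fs (Gs ++ rest) -> uniq Fs ->
  (forall F, F \in Fs -> size F = sumn sh /\ forall p, p \in reshape sh F -> pathlike l d E p) ->
  all2 (fun D F => `[< absorbs l d E sh D F >]) Ds Gs ->
  exists PS', List.Forall2 (swap l d E) (flatten (map (reshape sh) Fs)) PS' /\
    perm_eq (flatten PS') (flatten Fs ++ flatten Ds).
Proof.
move=> pF uF hF hD; have sD := all2_size hD.
have := uF; rewrite (perm_uniq pF) cat_uniq => /and3P[uG /hasPn dG _].
pose D F := if F \in Gs then nth [::] Ds (index F Gs) else [::].
have hDF F : F \in Fs -> exists ps', List.Forall2 (swap l d E) (reshape sh F) ps' /\ perm_eq (flatten ps') (F ++ D F).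
  move=> FF; have [sF pl] := hF F FF; rewrite /D; case: ifP => FG.
    have := hD; rewrite all2E sD eqxx => /(all_nthP ([::], [::])) /(_ (index F Gs)).
    by rewrite size_zip sD minnn index_mem FG => /(_ isT); rewrite nth_zip //= nth_index // => /asboolP.
  exists (reshape sh F); rewrite cats0 reshapeKr ?sF //; split=> //.
  elim: (reshape sh F) pl => [|p ps IH] pl; first by constructor.
  by constructor; [apply/pathlike_swap/pl/mem_head | apply: IH => p' hp; apply: pl; rewrite inE hp orbT].
have {hDF} [PS' [h1 h2]] : exists PS', List.Forall2 (swap l d E) (flatten (map (reshape sh) Fs)) PS' /\
    perm_eq (flatten PS') (flatten [seq F ++ D F | F <- Fs]).
  elim: (Fs) hDF => [|F Fs' IH] h; first by exists [::]; split=> //; constructor.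
  have [ps' [g1 g2]] := h F (mem_head _ _).
  have [|PS' [h1 h2]] := IH; first by move=> F' hF'; apply: h; rewrite inE hF' orbT.
  exists (ps' ++ PS'); split=> /=; first exact: List.Forall2_app.
  by rewrite flatten_cat perm_cat.
exists PS'; split=> //; apply: perm_trans h2 _.
apply: perm_trans (perm_flatten_split Fs id D) _; rewrite map_id perm_cat2l.
apply: perm_trans (perm_flatten (perm_map D pF)) _; rewrite map_cat flatten_cat.
have -> : map D Gs = Ds.
  apply: (@eq_from_nth _ [::]); rewrite size_map ?sD // => i iG.
  by rewrite (nth_map [::]) // /D mem_nth // index_uniq.
have -> : flatten (map D rest) = [::]; last by rewrite cats0.
apply/nilP; rewrite /nilp; apply/eqP; rewrite size_flatten /shape -map_comp.
elim: (rest) dG => //= F rest' IH dG; rewrite IH => [|F' hF']; last by apply: dG; rewrite inE hF' orbT.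
by rewrite /D (negbTE (dG F (mem_head _ _))).
Qed.

End Links.

Lemma connecting_joins mu : exists q C n0, 0 < C /\ forall (V : finType) (E : {set {set V}}),
  codense l d mu E -> n0 <= #|V| -> forall ST, dense C q (joins E ST).
Proof.
have [q [C [n0 h]]] := connecting hl hd hkd mu.
exists q, C.+1, n0; split=> // V E cE nV ST.
case: (boolP (linkable ST)) => [|hn]; last first.
  by rewrite /dense (_ : joins E ST = predT) ?cnt_predT ?leq_pmull //; apply: funext => W; rewrite /joins (negbTE hn).
move=> lST; have := lST; case/and4P => /eqP s1' /eqP s2' u1 u2.
by apply: dense_le (h V E cE nV _ _ s1' s2' u1 u2) => // W _ hW; apply/implyP.
Qed.

(* The absorbing paths are linked one after the other, but kept as a list: absorption replaces
   members of the list by paths with the same ends, which leaves the links valid. *)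
Lemma absorbing_structure mu : exists w C1, forall K1, w <= K1 -> exists n0, forall (V : finType) (E : {set {set V}}),
  codense l d mu E -> n0 <= #|V| -> exists PS cs : seq (seq V),
  [/\ PS != [::], forall p, p \in PS -> pathlike l d E p,
      all2 (lk l d E) (zip (map (@tl_ l V) PS) (behead (map (@hd_ l V) PS))) cs &
      [/\ uniq (flatten PS ++ flatten cs), size (flatten PS ++ flatten cs) <= w * (#|V| %/ K1) &
      forall Ds : seq (seq V), all (fun D => size D == d) Ds -> uniq (flatten Ds) ->
        C1 * size Ds <= #|V| %/ K1 ->
        exists PS', List.Forall2 (swap l d E) PS PS' /\ perm_eq (flatten PS') (flatten PS ++ flatten Ds)]].
Proof.
have [q1 [sh [C1 [na [shq ha]]]]] := absorber hl hd hkd s1_gt0 kE r0 mu.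
have [q2 [C2 [nc [C20 hc]]]] := connecting_joins mu.
pose w0 := q1 + size sh * q2.
(* [w0] counts the vertices of a gadget together with its connectors; with the further terms,
   [w <= K1] leaves the room that the disjoint choices need. *)
pose w := w0 + 4 * C1.+1 * q1 * q1 + 4 * C2 * q2 * w0 + 1.
exists w, (8 * C1.+1) => K1 wK1.
have [ns hs] := selection q1 C1.+1 d K1.
have K10 : 0 < K1 by apply: leq_trans wK1; rewrite /w addn1.
exists (maxn na (maxn nc (maxn ns (d + K1 + 4 * C1.+1 * q1 * q1 + 4 * C2 * q2 * q2)))) => V E cE.
rewrite !geq_max => /and4P[Vna Vnc Vns Vn].
have n0 : 0 < #|V| by move: Vn; clear -hd; lia.
set m := #|V| %/ K1.
have m0 : 0 < m by rewrite divn_gt0 //; move: Vn; clear; lia.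
have mK : m * K1 <= #|V| by exact: leq_trunc_div.
pose good (D : d.-tuple V) : pred (seq V) := fun F => uniq D ==> `[< absorbs l d E sh D F >].
have hgood D : dense C1.+1 q1 (good D).
  case: (boolP (uniq D)) => uD; last first.
    rewrite /dense (_ : good D = predT) ?cnt_predT ?leq_pmull //.
    by apply: funext => W; rewrite /good (negbTE uD).
  by apply: dense_le (ha V E cE Vna D (size_tuple D) uD) => // W _ hW; apply/implyP.
have dV : d <= #|V| by move: Vn; clear; lia.
have sD0 : size (take d (enum V)) == d by rewrite size_takel // -cardE.
pose D0 := Tuple sD0.
have uD0 : uniq D0 by rewrite take_uniq ?enum_uniq.
have cardI : #|{: d.-tuple V}| <= #|V| ^ d by rewrite card_tuple.
have c1 : #|V| <= K1 * m.+1 by rewrite mulnC ltnW // ltn_ceil.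
have c2 : 2 * C1.+1 * (q1 * (q1 + (size ([::] : seq V) + m * q1))) <= #|V|.
  rewrite /= -(leq_pmul2l (_ : 0 < 2)) //.
  have -> : 2 * (2 * C1.+1 * (q1 * (q1 + (0 + m * q1)))) = 4 * C1.+1 * q1 * q1 + m * (4 * C1.+1 * q1 * q1) by ring.
  have : m * (4 * C1.+1 * q1 * q1) <= m * K1.
    by rewrite leq_mul2l (leq_trans _ wK1) ?orbT // /w; clear; lia.
  move=> h'; rewrite mul2n -addnn leq_add //; last exact: leq_trans h' mK.
  exact: leq_trans (leq_trans (leq_addl _ _) (leq_addr _ _)) Vn.
have [Fs [sFs qFs uFs _ gFs]] := hs V _ good D0 cardI Vns hgood [::] m c1 c2.
pose okF F := `[< exists D : d.-tuple V, uniq D /\ absorbs l d E sh D F >].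
(* A selected tuple that absorbs nothing need not consist of paths, so it is dropped. *)
pose Fs' := filter okF Fs.
have okP F : F \in Fs' -> [/\ size F = q1, reshape sh F != [::] & forall p, p \in reshape sh F -> pathlike l d E p].
  rewrite mem_filter => /andP[/asboolP[D [uD [ps' [h1 h2]]]] FFs].
  split; first by apply/eqP; exact: (allP qFs).
    apply: contraTneq h2 => e; rewrite e in h1; inversion h1.
    by apply/negP => /perm_size /=; rewrite size_cat size_tuple; clear -hd; lia.
  by elim: h1 => //= p p' ps1 ps2 [pl _ _] _ IH p''; rewrite inE => /orP[/eqP ->|/IH].
have uFs' : uniq (flatten Fs').
  have := uFs; rewrite -(perm_uniq (perm_flatten (permEl (perm_filterC okF Fs)))) flatten_cat cat_uniq.
  by case/and3P.
have F0 : [::] \notin Fs'.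
  apply/negP => /okP[_ h1 h2]; move e : (reshape sh [::]) h1 h2 => [|p ps] // _ h2.
  have [lp _ _] := h2 p (mem_head _ _).
  have : size (flatten (reshape sh ([::] : seq V))) = 0 by rewrite reshapeKr.
  by rewrite e /= size_cat; clear -lp hl; lia.
have uF' := uniq_of_flatten uFs' F0.
have cg D : m <= 8 * C1.+1 * count (good D) Fs'.
  have cu (D' : d.-tuple V) : uniq D' -> m <= 8 * C1.+1 * count (good D') Fs'.
    move=> uD; rewrite count_filter (eq_count (a2 := good D')) // => F /=.
    rewrite andb_idr // /good uD /= => /asboolP h; apply/asboolP; by exists D'.
  case: (boolP (uniq D)) => uD; first exact: cu.
  apply: leq_trans (cu D0 uD0) _; rewrite leq_mul2l; apply/orP; right.
  by apply: sub_count => F _; rewrite /good (negbTE uD).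
pose PS := flatten (map (reshape sh) Fs').
have fPS : flatten PS = flatten Fs'.
  rewrite /PS; elim: (Fs') okP => //= F Fs1 IH ok.
  rewrite flatten_cat IH => [|F' hF']; last by apply: ok; rewrite inE hF' orbT.
  by have [sF _ _] := ok F (mem_head _ _); rewrite reshapeKr // shq sF.
have sFs' : size Fs' <= m by rewrite -sFs size_filter count_size.
have plPS p : p \in PS -> pathlike l d E p.
  by case/flattenP => s /mapP[F /okP[_ _ h] ->] /h.
have sPS : size PS <= m * size sh.
  rewrite (@size_flatten_const _ _ (size sh)); last by apply/allP => s /mapP[F _ ->]; rewrite size_reshape.
  by rewrite size_map leq_mul2r sFs' orbT.
have sflat : size (flatten PS) <= m * q1.
  rewrite fPS (@size_flatten_const _ _ q1) ?leq_mul2r ?sFs' ?orbT //.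
  by apply/allP => F /okP[-> _ _].
have PS0 : PS != [::].
  have : 0 < count (good D0) Fs' by have := cg D0; case: (count _ _) => //; rewrite muln0; move: m0; clear; lia.
  rewrite /PS; case: (Fs') okP => // F Fs1 ok _ /=.
  by have [_ h _] := ok F (mem_head _ _); case: (reshape sh F) h.
have [p0 [PS1 PSE]] : exists p0 PS1, PS = p0 :: PS1 by case: (PS) PS0 => // p0 PS1 _; exists p0, PS1.
pose pr := zip (map (@tl_ l V) PS) (behead (map (@hd_ l V) PS)).
have prE : pr = take (size PS1) (prs l (hd_ l p0) PS).
  by have := prs_take (hd_ l p0) p0 PS1 [::]; rewrite cats0 /pr PSE => <-.
have uPS : uniq (flatten PS) by rewrite fPS.
have okPS : all (@pathok V) PS.
  by apply/allP => p pPS; rewrite /pathok (part_uniq uPS pPS) andbT; case: (plPS p pPS).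
have lpr : all (@linkable V) pr.
  have /andP[lp0 up0] : pathok p0 by apply: (allP okPS); rewrite PSE mem_head.
  apply/allP => ST; rewrite prE => /mem_take; apply/allP/linkable_prs => //.
    by rewrite size_takel.
  exact: take_uniq.
have spr : size pr <= m * size sh.
  by apply: leq_trans sPS; rewrite size_zip !size_map geq_minl.
have c3 : 2 * C2 * (q2 * (q2 + (size (flatten PS) + size pr * q2))) <= #|V|.
  rewrite -(leq_pmul2l (_ : 0 < 2)) //.
  have h : size (flatten PS) + size pr * q2 <= m * w0.
    by rewrite /w0 mulnDr mulnA leq_add // leq_mul2r spr orbT.
  apply: (@leq_trans (2 * (2 * C2 * (q2 * (q2 + m * w0))))).
    by rewrite !(leq_mul2l, leq_add2l) h !orbT.
  have -> : 2 * (2 * C2 * (q2 * (q2 + m * w0))) = 4 * C2 * q2 * q2 + m * (4 * C2 * q2 * w0) by ring.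
  have : m * (4 * C2 * q2 * w0) <= m * K1.
    by rewrite leq_mul2l (leq_trans _ wK1) ?orbT // /w; clear; lia.
  move=> h'; rewrite mul2n -addnn leq_add //; last exact: leq_trans h' mK.
  exact: leq_trans (leq_addl _ _) Vn.
have [Gs [g1 g2 g3 g4]] := greedy_pick n0 (hc V E cE Vnc) c3.
have [cs [h1 h2 h3]] : exists cs, [/\ all2 (lk l d E) pr cs, uniq (flatten cs) & {subset flatten cs <= flatten Gs}].
  apply: connectors_of => //; apply: all2_sub_in lpr g1 => ST W lST.
  by rewrite /joins lST.
exists PS, cs; split=> //; split.
- rewrite cat_uniq fPS uFs' h2 andbT /=; apply: contra g4 => /hasP[x /h3 xG xF].
  by apply/hasP; exists x; rewrite ?fPS.
- rewrite size_cat; apply: (@leq_trans (m * q1 + m * size sh * q2)).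
    apply: leq_add => //; apply: leq_trans (uniq_leq_size h2 h3) _.
    by rewrite (size_flatten_const g2) -(all2_size g1) leq_mul2r spr orbT.
  have -> : m * q1 + m * size sh * q2 = w0 * m by rewrite /w0; ring.
  have w0w : w0 <= w by rewrite /w -addnA -addnA; exact: leq_addr.
  by rewrite leq_mul2r w0w orbT.
move=> Ds sDs uDs hDs.
have [js jsE] : exists js : seq (d.-tuple V), map val js = Ds.
  elim: Ds sDs {uDs hDs} => [|D Ds IH]; first by exists [::].
  by move=> /= /andP[sD /IH[js <-]]; exists (Tuple sD :: js).
have ujs : all (fun D : d.-tuple V => uniq D) js.
  apply/allP => D Djs; apply: part_uniq uDs _; rewrite -jsE; exact: map_f.
have hjs D : size js <= count (good D) Fs'.
  have : 8 * C1.+1 * size js <= 8 * C1.+1 * count (good D) Fs'.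
    by apply: leq_trans (cg D); rewrite -(size_map val js) jsE.
  by rewrite leq_pmul2l.
have [Gs' [rest [p1 p2]]] := reservoir_pick hjs.
have p3 : all2 (fun D F => `[< absorbs l d E sh D F >]) Ds Gs'.
  rewrite -jsE; have := all2_sub_in (P := fun D : d.-tuple V => uniq D)
    (r' := fun (D : d.-tuple V) F => `[< absorbs l d E sh D F >]) _ ujs p2.
  move=> /(_ _) h; have {h} : all2 (fun (D : d.-tuple V) F => `[< absorbs l d E sh D F >]) js Gs'.
    by apply: h => D F uD; rewrite /good uD.
  by elim: (js) (Gs') => [|D js' IH] [|G' Gs''] //= /andP[-> /IH].
have [|PS' [r1 r2]] := absorb_many p1 uF' _ p3.
  by move=> F /okP[sF _ pl]; rewrite shq.
by exists PS'; split=> //; rewrite fPS.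
Qed.

End Absorbing.

Lemma all2_catlr (S T : Type) (r : S -> T -> bool) s1 s2 t1 t2 :
  all2 r s1 t1 -> all2 r s2 t2 -> all2 r (s1 ++ s2) (t1 ++ t2).
Proof. by elim: s1 t1 => [|x s1 IH] [|y t1] //= /andP[-> h1] h2; exact: IH. Qed.

(** * The closed word through all vertices *)

Section Word.
Variables (l d s1 r : nat).
Hypotheses (hl : 0 < l) (hd : 2 <= d) (hkd : ~~ (d %| l + d)) (s1_gt0 : 0 < s1).
Hypotheses (kE : l + d = s1 * d + r) (r0 : 0 < r < d).
Local Notation k := (l + d).
Local Notation a := (s1.+1 * d).

Lemma swap_maps (V : finType) (E : {set {set V}}) PS PS' : List.Forall2 (swap l d E) PS PS' ->
  [/\ map (@hd_ l V) PS = map (@hd_ l V) PS', map (@tl_ l V) PS = map (@tl_ l V) PS' &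
      forall p, p \in PS' -> pathlike l d E p].
Proof.
elim=> // p p' ps ps' [_ pl' e] _ [e1 e2 h]; rewrite /= -e1 -e2 /hd_ /tl_ e; split=> //.
by move=> q; rewrite inE => /orP[/eqP ->|/h].
Qed.

Lemma joins_count (V : finType) (E : {set {set V}}) q C (Fs : seq (seq V)) m :
  size Fs = m -> 0 < C -> (forall ST : l.-tuple V * l.-tuple V, m <= 8 * C * count (joins l d E (val ST.1, val ST.2)) Fs) ->
  8 * C * q <= m -> forall ST, q <= count (joins l d E ST) Fs.
Proof.
move=> sF C0 h qm [S T].
have cancelC x : 8 * C * q <= 8 * C * x -> q <= x by rewrite leq_pmul2l // muln_gt0.
case: (boolP (linkable l (S, T))) => [|hn].
  case/and4P => /= sS sT _ _; apply: cancelC; apply: leq_trans qm _.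
  exact: (h (Tuple sS, Tuple sT)).
rewrite (eq_count (a2 := predT)) => [|W]; last by rewrite /joins (negbTE hn).
rewrite count_predT sF; apply: leq_trans qm; rewrite leq_pmull // muln_gt0 //.
Qed.

Lemma mul_div_double n K : 0 < K -> K <= n -> n <= 2 * K * (n %/ K).
Proof.
move=> K0 Kn; have := ltn_ceil n K0; have : 0 < n %/ K by rewrite divn_gt0.
by move: (n %/ K) => m m0 h; nia.
Qed.

Lemma hamilton_word Dn : 0 < Dn -> exists G n0, 2 * a <= G /\ forall (V : finType) (E : {set {set V}}),
  admissible k a Dn G E set0 -> n0 <= #|V| -> d %| #|V| ->
  exists c, perm_eq c (enum V) /\ epath l d (edge E) (c ++ take l c).
Proof.
move=> Dn0; have [w [C1 habs]] := absorbing_structure hl hd hkd s1_gt0 kE r0 (2 * a).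
have [q2 [C2 [nc [C20 hc]]]] := connecting_joins hl hd hkd (2 * a).
set G := 96 * a * Dn * k + 2 * a; set H := 12 * a * Dn * k.
set K1 := w + 2 * G * w + 8 * C2 * q2 * w + 1.
set K2 := 2 * G * q2 + 8 * C2 * q2 * q2 + 4 * C1 * q2 * K1 + 1.
set A := 4 * C1 * K1 + 1; set M := 32 * C2 * K2.
have sum4 x y z : [/\ x <= x + y + z + 1, y <= x + y + z + 1 & z <= x + y + z + 1] by split; lia.
have [wK1 K1G K1q] := sum4 w (2 * G * w) (8 * C2 * q2 * w); rewrite -/K1 in wK1 K1G K1q.
have [K2G K2q K2C] := sum4 (2 * G * q2) (8 * C2 * q2 * q2) (4 * C1 * q2 * K1); rewrite -/K2 in K2G K2q K2C.
have K10 : 0 < K1 by rewrite /K1 addn1.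
have K20 : 0 < K2 by rewrite /K2 addn1.
have A0 : 0 < A by rewrite /A addn1.
have [na ha] := habs K1 wK1.
have [ns hs] := selection q2 C2 (l + l) K2.
have hG : 96 * a * Dn * k <= G by exact: leq_addr.
have [nt ht] := path_tiling hl hd s1_gt0 kE r0 M Dn0 A0 hG (leqnn H).
exists G, (maxn na (maxn nc (maxn ns (maxn nt (maxn (K1 + 8 * C2 * q2 * q2) (K2 * (16 * C2))))))).
split=> [|V E adm]; first exact: leq_addl.
rewrite !geq_max => /and4P[Vna Vnc Vns /and3P[Vnt VK1 VK2]] dV.
have [H1 H2 H3 _] := adm.
(* Since [2 * a <= G], the codegrees are at least [n / (2 * a)]. *)
have cE : codense l d (2 * a) E.
  split=> // S uS sS; have := H2 S uS sS; set x := #|[pred _ | _]|.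
  have G0 : 0 < G by rewrite /G addn_gt0 muln_gt0 /= muln_gt0; apply/orP; right; clear -hd; lia.
  have Ga : 2 * a * #|V| <= G * #|V| by rewrite leq_mul2r leq_addl orbT.
  move=> h; rewrite -(leq_pmul2l G0); move: h Ga.
  have -> : G * (2 * a * x) = 2 * (a * G * x) by ring.
  rewrite -[2 * a * #|V|]mulnA; move: (a * G * x) (a * #|V|) (G * #|V|); clear; lia.
set m1 := #|V| %/ K1; set m2 := #|V| %/ K2.
have m1K : m1 * K1 <= #|V| by exact: leq_trunc_div.
have m2K : m2 * K2 <= #|V| by exact: leq_trunc_div.
have n1 : #|V| <= 2 * K1 * m1 by apply: mul_div_double => //; apply: leq_trans VK1; exact: leq_addr.
have m2C : 16 * C2 <= m2 by rewrite /m2 leq_divRL // mulnC.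
have m20 : 0 < m2 by apply: leq_trans m2C; rewrite muln_gt0.
have n2 : #|V| <= 2 * K2 * m2 by apply: mul_div_double => //; move: m20; rewrite /m2 divn_gt0.
have n0 : 0 < #|V| by apply: leq_trans VK1; rewrite addn_gt0 K10.
have [PS1 [cs1 [PS10 pl1 lk1 [u1 sz1 hab]]]] := ha V E cE Vna.
rewrite -/m1 in sz1 hab.
set Z1 := flatten PS1 ++ flatten cs1 in u1 sz1.
have [p0 [PS1' PS1E]] : exists p0 PS1', PS1 = p0 :: PS1' by case: (PS1) PS10 => // p ps _; exists p, ps.
have p01 : p0 \in PS1 by rewrite PS1E mem_head.
have [lp0 _ _] := pl1 p0 p01.
have u1P : uniq (flatten PS1) by move: u1; rewrite cat_uniq => /andP[].
have up0 : uniq p0 := part_uniq u1P p01.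
have [S0 _] : exists S0 : l.-tuple V, true.
  have sS0 : size (take l p0) == l by rewrite size_takel.
  by exists (Tuple sS0).
pose good (ST : l.-tuple V * l.-tuple V) := joins l d E (val ST.1, val ST.2).
have c1 : #|{: l.-tuple V * l.-tuple V}| <= #|V| ^ (l + l) by rewrite card_prod !card_tuple expnD.
have c2 : #|V| <= K2 * m2.+1 by rewrite mulnC ltnW // ltn_ceil.
have zw : 8 * C2 * q2 * size Z1 <= #|V|.
  apply: leq_trans m1K; apply: leq_trans (leq_mul (leqnn _) sz1) _.
  by rewrite mulnA mulnC leq_mul2l K1q orbT.
have m2w : 8 * C2 * q2 * q2 * m2 <= #|V|.
  by apply: leq_trans m2K; rewrite mulnC leq_mul2l K2q orbT.
have c3 : 2 * C2 * (q2 * (q2 + (size Z1 + m2 * q2))) <= #|V|.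
  rewrite -(leq_pmul2l (_ : 0 < 4)) //.
  have -> : 4 * (2 * C2 * (q2 * (q2 + (size Z1 + m2 * q2)))) =
    8 * C2 * q2 * q2 + 8 * C2 * q2 * size Z1 + 8 * C2 * q2 * q2 * m2 by ring.
  have VK1' : 8 * C2 * q2 * q2 <= #|V| by apply: leq_trans VK1; exact: leq_addl.
  have -> : 4 * #|V| = #|V| + #|V| + #|V| + #|V| by ring.
  by apply: leq_trans (leq_addr _ _); rewrite !leq_add.
have [Fs [sFs qFs uFs dFs gFs]] := hs V _ good (S0, S0) c1 Vns (fun ST => hc V E cE Vnc _) Z1 m2 c2 c3.
set Res := flatten Fs in uFs dFs.
have sRes : size Res = m2 * q2 by rewrite /Res (size_flatten_const qFs) sFs.
pose Z : {set V} := [set x in Z1 ++ Res].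
have cZ : #|Z| <= size Z1 + m2 * q2 by rewrite -sRes -size_cat cardsE card_size.
have GZ : G * #|Z| <= #|V|.
  rewrite -(leq_pmul2l (_ : 0 < 2)) //.
  apply: leq_trans (leq_mul (leqnn _) (leq_mul (leqnn G) (leq_trans cZ (leq_add sz1 (leqnn _))))) _.
  have -> : 2 * (G * (w * m1 + m2 * q2)) = m1 * (2 * G * w) + m2 * (2 * G * q2) by ring.
  rewrite [X in _ <= X]mul2n -[X in _ <= X]addnn leq_add //.
    by apply: leq_trans m1K; rewrite leq_mul2l K1G orbT.
  by apply: leq_trans m2K; rewrite leq_mul2l K2G orbT.
have [PS2 [pl2 u2 dZ2 cov]] := ht V E Z (And4 H1 H2 H3 GZ) Vnt.
(* The closed word must return to the first [l] vertices of the first path. *)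
set T := hd_ l p0.
have sT : size T = l by rewrite size_takel.
have uT : uniq T by exact: take_uniq.
have plPS p : p \in PS1 ++ PS2 -> pathlike l d E p.
  by rewrite mem_cat => /orP[/pl1|/pl2[]].
have inZ x : x \in Z1 ++ Res -> x \in Z by rewrite inE.
have u12 : uniq (flatten (PS1 ++ PS2)).
  rewrite flatten_cat cat_uniq u1P u2 andbT /=; apply/hasPn => x /dZ2.
  by apply: contra => xP; apply: inZ; rewrite !mem_cat xP.
have okPS : all (@pathok l V) (PS1 ++ PS2).
  by apply/allP => p pP; rewrite /pathok (part_uniq u12 pP) andbT; case: (plPS p pP).
have lprs := linkable_prs sT uT okPS.
set pr := prs l T (PS1 ++ PS2) in lprs.
(* The pairs before these are already linked by [cs1] inside the absorbing structure; the reservoir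
   links the rest, including the pair that closes the cycle. *)
pose pr2 := drop (size PS1') pr.
have pr1E : take (size PS1') pr = zip (map (@tl_ l V) PS1) (behead (map (@hd_ l V) PS1)).
  by rewrite /pr PS1E -(prs_take l T p0 PS1' PS2).
have spr : size pr = size (PS1 ++ PS2).
  rewrite /pr /prs size_zip size_rcons size_behead !size_map; apply/minn_idPl.
  by rewrite PS1E /=.
have spr2 : size pr2 = (size PS2).+1.
  by rewrite size_drop spr size_cat PS1E /= addSn -addnS addKn.
have lpr2 : all (@linkable l V) pr2 by apply/allP => ST /mem_drop; apply: (allP lprs).
have cnt2 : 8 * C2 * size pr2 <= m2.
  have M2 : M * size PS2 <= #|V|.
    apply: (@leq_trans (size (flatten PS2))); last by rewrite -(card_uniqP u2) max_card.
    elim: (PS2) pl2 {spr2 cov u2 dZ2 plPS u12 okPS lprs pr pr2 pr1E spr lpr2} => [|p ps IH] h; first by rewrite muln0.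
    rewrite /= mulnS size_cat leq_add //; first by case: (h p (mem_head _ _)).
    by apply: IH => q hq; apply: h; rewrite inE hq orbT.
  have : 2 * K2 * (16 * C2 * size PS2) <= 2 * K2 * m2.
    apply: leq_trans n2; apply: leq_trans M2; apply/eq_leq; rewrite /M; ring.
  rewrite leq_pmul2l ?muln_gt0 // => h.
  rewrite spr2 -(leq_pmul2l (_ : 0 < 2)) //.
  have -> : 2 * (8 * C2 * (size PS2).+1) = 16 * C2 * size PS2 + 16 * C2 by ring.
  by rewrite [X in _ <= X]mul2n -[X in _ <= X]addnn leq_add.
have cnt_all := joins_count sFs C20 gFs cnt2.
have [Gs [rest [pFs hGs]]] := reservoir_pick cnt_all.
have uGs : uniq (flatten Gs).
  by move: uFs; rewrite /Res (perm_uniq (perm_flatten pFs)) flatten_cat cat_uniq => /andP[].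
have [cs2 [lk2 uc2 sub2]] : exists cs, [/\ all2 (lk l d E) pr2 cs, uniq (flatten cs) & {subset flatten cs <= flatten Gs}].
  apply: connectors_of => //; apply: all2_sub_in lpr2 hGs => ST W lST.
  by rewrite /joins lST.
have subR x : x \in flatten cs2 -> x \in Res.
  by move=> /sub2 xG; rewrite /Res (perm_mem (perm_flatten pFs)) flatten_cat mem_cat xG.
pose cs := cs1 ++ cs2.
have lkcs : all2 (lk l d E) pr cs.
  by rewrite -(cat_take_drop (size PS1') pr) pr1E; apply: all2_catlr.
have scs : size (PS1 ++ PS2) = size cs by rewrite -spr (all2_size lkcs).
pose Used := (flatten PS1 ++ flatten PS2) ++ (flatten cs1 ++ flatten cs2).
have uUsed : uniq Used.
  have pU : perm_eq Used (Z1 ++ (flatten PS2 ++ flatten cs2)).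
    exact/permPl/perm_catACA.
  rewrite (perm_uniq pU) cat_uniq u1 cat_uniq u2 uc2 /= andbT; apply/andP; split.
    apply/hasPn => x; rewrite mem_cat => /orP[/dZ2|/subR xR].
      by apply: contra => xZ; apply: inZ; rewrite mem_cat xZ.
    by apply: contra dFs => xZ; apply/hasP; exists x.
  apply/hasPn => x /subR xR; apply/negP => /dZ2/negP; apply; apply: inZ.
  by rewrite mem_cat xR orbT.
pose L := enum [pred x | x \notin Used].
have pV : perm_eq (Used ++ L) (enum V).
  apply: uniq_perm; [|exact: enum_uniq|].
    rewrite cat_uniq uUsed enum_uniq andbT /=; apply/hasPn => x.
    by rewrite mem_enum inE.
  by move=> x; rewrite mem_cat !mem_enum !inE; case: (x \in Used).
have sV : size Used + size L = #|V| by rewrite -size_cat (perm_size pV) -cardE.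
(* The length of the weave and [n] are both divisible by [d], hence so is the number of leftover
   vertices, which can be split into [d]-tuples. *)
have [dw _] := weave_epath hl hd sT plPS lkcs.
have pweave ps1 : size ps1 = size PS1 -> perm_eq (weave (ps1 ++ PS2) cs) ((flatten ps1 ++ flatten PS2) ++ (flatten cs1 ++ flatten cs2)).
  move=> s; apply: perm_trans (weave_perm _) _; first by rewrite -scs !size_cat s.
  by rewrite !flatten_cat.
have dU : d %| size Used by rewrite /Used -(perm_size (pweave PS1 erefl)).
have dL : d %| size L by rewrite -(dvdn_addr _ dU) sV.
pose Ds := reshape (nseq (size L %/ d) d) L.
have sL : sumn (nseq (size L %/ d) d) = size L by rewrite sumn_nseq mulnC divnK.
have fDs : flatten Ds = L by rewrite reshapeKr // sL.
have sDs : size Ds = size L %/ d by rewrite size_reshape size_nseq.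
have dDs : all (fun D => size D == d) Ds.
  have : shape Ds = nseq (size L %/ d) d by rewrite reshapeKl // sL.
  move=> e; have : all (pred1 d) (shape Ds) by rewrite e all_nseq /= eqxx orbT.
  by rewrite /shape all_map.
have hL : C1 * size Ds <= m1.
  set U := #|V| - #|Z| - size (flatten PS2) in cov.
  have sLU : size L <= U + m2 * q2.
    have : size Z1 + size (flatten PS2) <= size Used by rewrite /Used /Z1 !size_cat; clear; lia.
    rewrite /U; move: cZ sV; move: (size Z1) (size (flatten PS2)) (size Used) (size L) #|Z| #|V| (m2 * q2); clear; lia.
  have h1 : 2 * K1 * (2 * C1 * U) <= 2 * K1 * m1.
    apply: leq_trans n1; apply: leq_trans cov.
    have -> : 2 * K1 * (2 * C1 * U) = 4 * C1 * K1 * U by ring.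
    by rewrite leq_mul2r /A leq_addr orbT.
  have h2 : 2 * K1 * (2 * C1 * (m2 * q2)) <= 2 * K1 * m1.
    apply: leq_trans n1; apply: leq_trans m2K.
    have -> : 2 * K1 * (2 * C1 * (m2 * q2)) = m2 * (4 * C1 * q2 * K1) by ring.
    by rewrite leq_mul2l K2C orbT.
  rewrite !leq_pmul2l ?muln_gt0 // in h1 h2.
  have h3 : size Ds <= U + m2 * q2 by apply: leq_trans sLU; rewrite sDs leq_div.
  rewrite -(leq_pmul2l (_ : 0 < 2)) //; apply: leq_trans (leq_mul (leqnn 2) (leq_mul (leqnn C1) h3)) _.
  have -> : 2 * (C1 * (U + m2 * q2)) = 2 * C1 * U + 2 * C1 * (m2 * q2) by ring.
  by rewrite [X in _ <= X]mul2n -[X in _ <= X]addnn leq_add.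
have [|PS1s [sw pPS]] := hab Ds dDs _ hL; first by rewrite fDs enum_uniq.
(* Absorption keeps the ends of the paths, so the same connectors still fit. *)
have [mh mt pls] := swap_maps sw.
have prE : prs l T (PS1s ++ PS2) = pr by rewrite /pr /prs !map_cat mh mt.
have sPS1s : size PS1s = size PS1 by rewrite -(size_map (@hd_ l V) PS1) mh size_map.
have plw p : p \in PS1s ++ PS2 -> pathlike l d E p.
  by rewrite mem_cat => /orP[/pls|/pl2[]].
have lkw : all2 (lk l d E) (prs l T (PS1s ++ PS2)) cs by rewrite prE.
have [_ Ew] := weave_epath hl hd sT plw lkw.
exists (weave (PS1s ++ PS2) cs); split.
  apply: perm_trans (pweave PS1s sPS1s) _; apply: perm_trans pV.
  apply/permP => P; have := permP pPS P; rewrite fDs !count_cat => ->; move: (count P L); clear; lia.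
suff -> : take l (weave (PS1s ++ PS2) cs) = T by [].
case: (PS1s) sPS1s mh pls => [|p ps]; first by rewrite PS1E.
rewrite PS1E /= => _ [eh _] pls; have [lp _ _] := pls p (mem_head _ _).
have : 0 < size cs by rewrite -scs PS1E.
case: (cs) => // c cs' _.
by rewrite /weave /= -catA takel_cat // /T eh.
Qed.

End Word.

(** * From the closed word to a Hamilton cycle *)

Section Cycle.
Variables (l d : nat).
Hypotheses (hl : 0 < l) (hd : 2 <= d).
Local Notation k := (l + d).

(** As [k + d <= size c], the second arc does not wrap around, so beyond the common stretch [y] it
    is disjoint from the first. *)
Lemma arc_meet (V : finType) (c : seq V) : uniq c -> k + d <= size c ->
  #|[set x in take k c] :&: [set x in take k (rot d c)]| = l.
Proof.
move=> uc sc; set y := take l (drop d c).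
have sy : size y = l by rewrite size_takel // size_drop; lia.
have e1 : take k c = take d c ++ y by rewrite addnC takeD.
have e2 : take k (rot d c) = y ++ take d (drop l (drop d c)).
  by rewrite /rot takel_cat ?size_drop; [rewrite takeD | lia].
transitivity #|y|; last by rewrite (card_uniqP _) // take_uniq ?drop_uniq.
apply: eq_card => x; rewrite inE !in_set e1 e2 !mem_cat.
case: (boolP (x \in y)) => xy; rewrite ?orbT //= ?orbF.
apply/negP => /andP[x1 /mem_take /mem_drop x2].
by have := uc; rewrite -(cat_take_drop d c) cat_uniq => /and3P[_ /hasPn /(_ x x2) /negP].
Qed.

Lemma cycle_iota (e : rel nat) f m z i : (forall j, i <= j < i + m -> e (f j) (f j.+1)) ->
  e (f (i + m)) z -> path e (f i) (rcons (map f (iota i.+1 m)) z).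
Proof.
elim: m i => [|m IH] i h hz /=; first by rewrite addn0 in hz; rewrite hz.
rewrite h; last by lia.
by apply: IH => [j hj|]; [apply: h; lia | rewrite addSnnS].
Qed.

(** The edges start at the multiples of [d]; appending [take l c] turns the arcs that wrap around
    into ordinary windows of the word. *)
Lemma word_lcycle (V : finType) (E : {set {set V}}) (c : seq V) : uniform k E -> d %| #|V| -> k + d <= #|V| ->
  perm_eq c (enum V) -> epath l d (edge E) (c ++ take l c) -> has_hamilton_lcycle k l E.
Proof.
move=> uE dV kV pc Ec.
have uc : uniq c by rewrite (perm_uniq pc) enum_uniq.
have sc : size c = #|V| by rewrite (perm_size pc) -cardE.
set m := #|V| %/ d.
have md : m * d = #|V| by rewrite divnK.
pose P := [seq j * d | j <- iota 0 m].
have arcE j : j < m -> arc_at k c (j * d) \in E.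
  move=> jm; have jd : j * d + d <= #|V| by rewrite -md -mulSnr leq_mul2r jm orbT.
  have := Ec j; rewrite size_cat sc size_takel ?sc; last by lia.
  move=> /(_ _)/=; rewrite /edge /arc_at.
  suff -> : take k (drop (j * d) (c ++ take l c)) = take k (rot (j * d) c) by apply; rewrite addnCA [#|V| + l]addnC leq_add2l.
  rewrite drop_cat sc ifT; last by lia.
  rewrite /rot !take_cat size_drop sc; case: ltnP => // h.
  by rewrite !take_takel //; lia.
pose C : {set {set V}} := [set:: [seq arc_at k c p | p <- P]].
have CE : C \subset E.
  apply/subsetP => A; rewrite inE => /mapP[p /mapP[j]]; rewrite mem_iota => /andP[_ jm] -> ->.
  exact: arcE.
exists C; split=> //; first by move=> A /(subsetP CE); exact: uE.
exists c, P; split=> //.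
- apply/andP; split.
    apply: (@homo_sorted _ _ (fun j => j * d) ltn ltn _ _ (iota_ltn_sorted 0 m)) => i j /= ij.
    by rewrite ltn_mul2r ij andbT; lia.
  apply/allP => p /mapP[j]; rewrite mem_iota => /andP[_ jm] ->; rewrite sc -md.
  by rewrite ltn_mul2r jm andbT; lia.
- apply/setP => x; rewrite !inE.
  have xc : x \in c by rewrite (perm_mem pc) mem_enum.
  have ic : index x c < #|V| by rewrite -sc index_mem.
  set i := index x c in ic; have jm : i %/ d < m by rewrite ltn_divLR ?md //; lia.
  apply/bigcupP; exists (arc_at k c (i %/ d * d)).
    rewrite inE; apply/mapP; exists (i %/ d * d) => //; by apply: map_f; rewrite mem_iota.
  rewrite /arc_at inE; have iE := divn_eq i d.
  have rd : i %% d < d by rewrite ltn_mod; lia.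
  rewrite -(nth_index x xc) -/i; set p := i %/ d * d in iE *.
  have -> : nth x c i = nth x (take k (rot p c)) (i %% d).
    rewrite nth_take; last by lia.
    by rewrite /rot nth_cat size_drop sc ifT ?nth_drop -?iE //; lia.
  apply: mem_nth; rewrite size_takel ?size_rot ?sc; lia.
- have step p : p + d <= #|V| -> #|arc_at k c p :&: arc_at k c (p + d)| = l.
    move=> pd; rewrite /arc_at [p + d]addnC rotD ?sc; last by rewrite addnC.
    by apply: arc_meet; rewrite ?rot_uniq ?size_rot ?sc.
  have m0 : 0 < m by rewrite divn_gt0; lia.
  rewrite /P; case: (m) m0 md => // m' _ md' /=.
  apply: (@cycle_iota _ (fun j => j * d) m' _ 0) => [j|].
    rewrite add0n => /andP[_ jm]; rewrite mulSnr step //.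
    by rewrite -mulSnr -md' leq_mul2r; lia.
  (* The arc at position [n] is the arc at position 0, so the last and the first edge also meet
     properly. *)
  rewrite add0n mul0n; have := step (m' * d); rewrite -mulSnr md' => /(_ (leqnn _)).
  by rewrite /arc_at -sc rot_size rot0 => ->.
Qed.

End Cycle.

(** * Translation of the real hypotheses *)

Import Order.TTheory GRing.Theory Num.Theory.
Local Open Scope ring_scope.

Lemma big_minn_le (I : eqType) (s : seq I) (P : pred I) F x i : i \in s -> P i ->
  (\big[minn/x]_(j <- s | P j) F j <= F i)%N.
Proof.
elim: s => // j s IH; rewrite inE big_cons => /orP[/eqP <- Pi|si Pi]; first by rewrite Pi geq_minl.
by case: ifP => _; rewrite ?geq_min IH ?orbT.
Qed.

Lemma min_codeg_le (V : finType) (E : {set {set V}}) k (S : seq V) : uniq S -> size S = k.-1 ->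
  (min_codeg k E <= #|[pred v | edge E (rcons S v)]|)%N.
Proof.
move=> uS sS; pose A := [set x in S].
have cA : #|A| == k.-1 by rewrite cardsE (card_uniqP uS) sS.
apply: leq_trans (big_minn_le _ _ (mem_index_enum A) cA) _.
rewrite /codeg cardsE; apply/subset_leq_card/subsetP => v; rewrite !inE => /andP[_].
by rewrite /edge (_ : [set x in rcons S v] = v |: A) //; apply/setP => x; rewrite !inE mem_rcons inE.
Qed.

Lemma ceil_ratioE (k l s r : nat) : (k = s * (k - l) + r)%N -> (0 < r < k - l)%N -> ceil_ratio k l = s.+1%:Z.
Proof.
move=> kE /andP[r0 rd]; rewrite /ceil_ratio; set d := (k - l)%N in kE rd *.
have d0 : 0 < d%:R :> rat by rewrite ltr0n (leq_trans _ rd).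
apply: ceil_def; rewrite [in X in X / _]kE natrD natrM mulrDl mulfK ?lt0r_neq0 //.
have h1 : 0 < r%:R / d%:R :> rat by rewrite divr_gt0 // ltr0n.
have h2 : r%:R / d%:R <= 1 :> rat by rewrite ler_pdivrMr // mul1r ler_nat ltnW.
rewrite intrD -!pmulrn -natr1; move: h1 h2; move: (r%:R / _) => x; lra.
Qed.

Theorem theorem1p6 (R : realType) (k l : nat) (Delta : R)
    (hk : (3 <= k)%N) (hl : (1 <= l < k)%N) (hkl : ~~ (k - l %| k)%N)
    (hDelta : 0 < Delta < 1) :
  exists2 gamma : R, 0 < gamma &
    exists n0 : nat, forall n : nat, (n0 <= n)%N -> (k - l %| n)%N ->
      forall (V : finType) (E : {set {set V}}),
        #|V| = n -> uniform k E ->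
        ~ extremal k l Delta E ->
        (1 / ((ceil_ratio k l)%:~R * (k - l)%N%:R) - gamma) * n%:R
          <= (min_codeg k E)%:R ->
        has_hamilton_lcycle k l E.
Proof.
case/andP: hl => l0 lk; case/andP: hDelta => D0 _.
have [d kl] : exists d, (k - l)%N = d by eexists.
have kE : k = (l + d)%N by lia.
rewrite kl in hkl *; subst k.
have d1 : d != 1%N by apply: contraNneq hkl => ->; rewrite dvd1n.
have d2 : (2 <= d)%N by lia.
pose s := ((l + d) %/ d)%N; pose r := ((l + d) %% d)%N.
have kE : (l + d = s * d + r)%N by exact: divn_eq.
have rd : (0 < r < d)%N by rewrite lt0n -/(dvdn _ _) hkl ltn_mod; lia.
have s0 : (0 < s)%N by rewrite divn_gt0; lia.
have cr : ceil_ratio (l + d) l = s.+1%:Z by apply: (@ceil_ratioE _ _ _ r); rewrite kl.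
set a := (s.+1 * d)%N.
have aE : ((ceil_ratio (l + d) l)%:~R * d%:R : R) = a%:R by rewrite cr -pmulrn natrM.
have a0 : (0 < a)%N by rewrite muln_gt0; lia.
(* [1 / Dn] is below [Delta], so a set of the critical size with at most [n ^ k / Dn] edges would
   make the k-graph extremal. *)
pose Dn := Num.bound Delta^-1.
have Dn1 : 1 < Dn%:R * Delta.
  by rewrite -ltr_pdivrMr // div1r; apply: archi_boundP; rewrite invr_ge0 ltW.
have Dn0 : (0 < Dn)%N by case: (Dn) Dn1 => //; rewrite mul0r ltr10.
have [G [n0 [Ga hw]]] := hamilton_word l0 d2 hkl s0 kE rd Dn0.
have G0 : (0 < G)%N by lia.
(* The slack [1 / G] allowed in the codegree clause of [admissible]. *)
exists (G%:R^-1); first by rewrite invr_gt0 ltr0n.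
exists (n0 + (l + d + d))%N => n nn dn V E cV uE nex hdeg; rewrite aE in hdeg.
have adm : admissible (l + d) a Dn G E set0.
  split; last by rewrite cards0 muln0.
  - exact: uE.
  - move=> S uS sS; have mc := min_codeg_le E uS sS; rewrite cV.
    set x := #|_| in mc *.
    have : (1 / a%:R - G%:R^-1) * n%:R <= x%:R :> R by apply: le_trans hdeg _; rewrite ler_nat.
    have aG : 0 < (a%:R * G%:R : R) by rewrite mulr_gt0 ?ltr0n.
    rewrite -(ler_pM2l aG) mulrA mulrBr div1r.
    have -> : a%:R * G%:R * a%:R^-1 = G%:R :> R by field; rewrite pnatr_eq0; lia.
    have -> : a%:R * G%:R * G%:R^-1 = a%:R :> R by field; rewrite pnatr_eq0; lia.
    by rewrite mulrBl lerBlDl -!natrM -natrD ler_nat.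
  (* The natural quotient [((a - 1) * n) %/ a] is the floor in the definition of extremality, so a
     sparse [B] would be an extremal set. *)
  - move=> B cB; rewrite ltnNge; apply/negP => hB; apply: nex; exists B; split.
      rewrite kl aE cB cV; symmetry; apply: floor_def.
      have aR0 : 0 < a%:R :> R by rewrite ltr0n.
      have -> : (1 - 1 / a%:R) * n%:R = ((a - 1) * n)%N%:R / a%:R :> R.
        by rewrite natrM natrB //; field; rewrite lt0r_neq0.
      rewrite -pmulrn -[(_ + 1)%R]/((_ + 1)%N%:Z) -pmulrn ler_pdivlMr // ltr_pdivrMr // -!natrM ler_nat ltr_nat.
      by rewrite leq_trunc_div addn1 ltn_ceil.
    rewrite cV in hB *; rewrite -(ler_pM2l (_ : 0 < Dn%:R :> R)) ?ltr0n // mulrA.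
    apply: (@le_trans _ _ (n ^ (l + d))%N%:R); first by rewrite -natrM ler_nat.
    by rewrite natrX -[X in X <= _]mul1r ler_wpM2r ?exprn_ge0 ?ler0n // ltW.
have dV : (d %| #|V|)%N by rewrite cV.
have nV : (n0 <= #|V|)%N by rewrite cV; lia.
have [c [pc Ec]] := hw V E adm nV dV.
by apply: (@word_lcycle l d l0 d2 V E c) => //; rewrite cV; lia.
Qed.
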